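(* Let $M\subset\mathbb{R}^3$ be a closed bounded domain with smooth boundary, let $\lambda,\mu,\rho,\nu_1,\dots,\nu_4$ be smooth real functions on $M$ with $\rho>0$, $\lambda+2\mu>0$, and with $3(\nu_1+\nu_2)+2(1+\nu_3+\nu_4)\ne0$ and $1+\nu_3+\nu_4\neq0$ everywhere on $M$. Let $v_p=\sqrt{(\lambda+2\mu)/\rho}$, let $g$ be the Euclidean metric, and let $h=v_p^{-2}g$. Assume that the three-dimensional manifold $(M,h)$ is a convex non-trapping manifold (CNTM), and let $D$ be its diameter, i.e. the length of the longest geodesic. Define $$a=\frac{\nu_1+\nu_2}{2(1+\nu_3+\nu_4)},\quad b=\frac{\rho v_p^4}{1+\nu_3+\nu_4},\quad c=v_p^2,\quad \alpha=b^{-1}\nabla b+\tfrac12c^{-1}\nabla c,\quad \beta=-\tfrac12c^{-1}\nabla c ,$$ $$a_0=\sup_M\left|\frac{a}{1+3a}\right|,\quad \alpha_0=\Big(\sup_M|\alpha|\Big)^{1/2},\quad \beta_0=\Big(\sup_M\left|\frac{a\alpha-\beta}{1+3a}\right|\Big)^{1/2}.$$ Assume that $$3a_0+\frac12\alpha_0+\frac32\beta_0+\frac14(\alpha_0^3+\beta_0^3)D^2<1 .$$ Then the boundary value problem $$\left\{\begin{aligned}&\Big(\frac{a}{1+3a}\,d\delta-\delta d\Big)v-(dv)\alpha+\frac{1}{1+3a}(\delta v)\Big(a\alpha-\beta+(1+3a)\nabla\Big(\frac{a}{1+3a}\Big)\Big)=0,\\ &v|_{\partial M}=0\end{aligned}\right.$$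 for a covector field $v$ on $M$ has only the trivial solution $v=0$.
   Context: Covector fields $v$ are smooth on $M$. Summation over repeated indices is understood. Covariant derivatives $\nabla$, traces, raising of indices and pointwise norms $|\cdot|$ are with respect to $h$. For a function $\varphi$, $\nabla\varphi$ denotes the covector field $d\varphi$ (also written $d\varphi$). For a covector field $v$: $(dv)_{jk}=\frac12(\nabla_jv_k+\nabla_kv_j)$ (inner derivative) and $\delta v=h^{jk}\nabla_jv_k$. For a symmetric tensor field $u$: $(\delta u)_j=h^{kl}\nabla_ku_{jl}$ (divergence). In $d\delta v$, $d$ is the differential of the function $\delta v$. For a symmetric tensor $u$ and covector $\alpha$, $(u\alpha)_j=h^{kl}u_{jk}\alpha_l$. Note $1+3a\neq0$ on $M$ by the assumptions. A compact Riemannian manifold $(M,h)$ with boundary is a convex non-trapping manifold (CNTM, also called compact dissipative Riemannian manifold) if the boundary is strictly convex (its second fundamental form is positive definite at every boundary point) and for every $x\in M$ and $0\neq\xi\in T_xM$ the maximal geodesic $\gamma_{x,\xi}$ with $\gamma_{x,\xi}(0)=x$, $\dot\gamma_{x,\xi}(0)=\xi$ is defined on a finite segment $[\tau_-(x,\xi),\tau_+(x,\xi)]$. Lengths of geodesics are measured in $h$. *)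

(* Defs.v *)
From HB Require Import structures.
From mathcomp Require Import all_boot all_order all_algebra.
From mathcomp Require Import all_classical all_reals all_analysis.

Set Implicit Arguments.
Unset Strict Implicit.
Unset Printing Implicit Defensive.

Import Order.TTheory GRing.Theory Num.Theory.
Import numFieldNormedType.Exports.

Local Open Scope classical_set_scope.
Local Open Scope ring_scope.

(* Everything is written in the global Cartesian coordinates of R^n.  Vector
   and covector fields are given by their components, as maps into
   'rV[R]_n; 2-tensor fields (in particular the metric h) by their
   covariant components, as maps into 'M[R]_n. *)

Definition partial (R : realType) (n : nat) (i : 'I_n)
    (f : 'rV[R]_n -> R) (x : 'rV[R]_n) : R :=
  'D_(delta_mx 0 i) f x.

(* C^infty on an open neighbourhood of A: all iterated partial derivatives
   (of every order, including 0) are differentiable there.  For a closed A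
   these are the functions whose restrictions to A are smooth up to the
   boundary; the values away from A are irrelevant to everything below. *)
Definition smooth_on (R : realType) (n : nat) (A : set 'rV[R]_n)
    (f : 'rV[R]_n -> R) : Prop :=
  exists2 U : set 'rV[R]_n, open U /\ A `<=` U &
    forall (s : seq 'I_n) (x : 'rV[R]_n), U x ->
      differentiable (foldr (@partial R n) f s) x.

Definition smooth_covector_on (R : realType) (n : nat) (A : set 'rV[R]_n)
    (v : 'rV[R]_n -> 'rV[R]_n) : Prop :=
  forall j : 'I_n, smooth_on A (fun x => v x 0 j).

Definition grad (R : realType) (n : nat) (f : 'rV[R]_n -> R)
    (x : 'rV[R]_n) : 'rV[R]_n :=
  \row_j partial j f x.

Definition bdry (R : realType) (n : nat) (M : set 'rV[R]_n) : set 'rV[R]_n :=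
  closure M `\` interior M.

Definition defining_function (R : realType) (n : nat) (M : set 'rV[R]_n)
    (p : 'rV[R]_n) (phi : 'rV[R]_n -> R) : Prop :=
  [/\ smooth_on [set p] phi,
      \forall x \near p, M x <-> phi x <= 0 &
      grad phi p != 0].

Definition closed_bounded_domain (R : realType) (n : nat)
    (M : set 'rV[R]_n) : Prop :=
  bounded_set M /\
  exists O : set 'rV[R]_n, [/\ open O, connected O, O !=set0 & M = closure O].

Definition smooth_boundary (R : realType) (n : nat) (M : set 'rV[R]_n) : Prop :=
  forall p, bdry M p -> exists phi, defining_function M p phi.

(* The inverse metric h^{jk}. *)
Definition hinv (R : realType) (n : nat) (h : 'rV[R]_n -> 'M[R]_n)
    (x : 'rV[R]_n) : 'M[R]_n := invmx (h x).

(* christoffel h x l j k = Gamma^l_{jk}(x). *)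
Definition christoffel (R : realType) (n : nat) (h : 'rV[R]_n -> 'M[R]_n)
    (x : 'rV[R]_n) (l j k : 'I_n) : R :=
  2^-1 * \sum_m hinv h x l m *
    (partial j (fun y => h y m k) x + partial k (fun y => h y m j) x
     - partial m (fun y => h y j k) x).

(* nabla_j xi^k for a vector field xi. *)
Definition cov_vector (R : realType) (n : nat) (h : 'rV[R]_n -> 'M[R]_n)
    (xi : 'rV[R]_n -> 'rV[R]_n) (x : 'rV[R]_n) (j k : 'I_n) : R :=
  partial j (fun y => xi y 0 k) x
  + \sum_l christoffel h x k j l * xi x 0 l.

(* nabla_j v_k for a covector field v. *)
Definition cov_covector (R : realType) (n : nat) (h : 'rV[R]_n -> 'M[R]_n)
    (v : 'rV[R]_n -> 'rV[R]_n) (x : 'rV[R]_n) (j k : 'I_n) : R :=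
  partial j (fun y => v y 0 k) x
  - \sum_l christoffel h x l j k * v x 0 l.

(* nabla_k u_{jl} for a covariant 2-tensor field u. *)
Definition cov_tensor (R : realType) (n : nat) (h : 'rV[R]_n -> 'M[R]_n)
    (u : 'rV[R]_n -> 'M[R]_n) (x : 'rV[R]_n) (k j l : 'I_n) : R :=
  partial k (fun y => u y j l) x
  - \sum_m christoffel h x m k j * u x m l
  - \sum_m christoffel h x m k l * u x j m.

Definition inner_d (R : realType) (n : nat) (h : 'rV[R]_n -> 'M[R]_n)
    (v : 'rV[R]_n -> 'rV[R]_n) (x : 'rV[R]_n) : 'M[R]_n :=
  \matrix_(j, k) (2^-1 * (cov_covector h v x j k + cov_covector h v x k j)).

Definition div_covector (R : realType) (n : nat) (h : 'rV[R]_n -> 'M[R]_n)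
    (v : 'rV[R]_n -> 'rV[R]_n) (x : 'rV[R]_n) : R :=
  \sum_j \sum_k hinv h x j k * cov_covector h v x j k.

Definition div_tensor (R : realType) (n : nat) (h : 'rV[R]_n -> 'M[R]_n)
    (u : 'rV[R]_n -> 'M[R]_n) (x : 'rV[R]_n) : 'rV[R]_n :=
  \row_j \sum_k \sum_l hinv h x k l * cov_tensor h u x k j l.

Definition tensor_app (R : realType) (n : nat) (h : 'rV[R]_n -> 'M[R]_n)
    (u : 'rV[R]_n -> 'M[R]_n) (alpha : 'rV[R]_n -> 'rV[R]_n)
    (x : 'rV[R]_n) : 'rV[R]_n :=
  \row_j \sum_k \sum_l hinv h x k l * u x j k * alpha x 0 l.

Definition inner_vector (R : realType) (n : nat) (h : 'rV[R]_n -> 'M[R]_n)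
    (x xi eta : 'rV[R]_n) : R :=
  \sum_j \sum_k h x j k * xi 0 j * eta 0 k.

Definition norm_vector (R : realType) (n : nat) (h : 'rV[R]_n -> 'M[R]_n)
    (x xi : 'rV[R]_n) : R :=
  Num.sqrt (inner_vector h x xi xi).

Definition norm_covector (R : realType) (n : nat) (h : 'rV[R]_n -> 'M[R]_n)
    (x alpha : 'rV[R]_n) : R :=
  Num.sqrt (\sum_j \sum_k hinv h x j k * alpha 0 j * alpha 0 k).

(* The outward unit normal field determined by a defining function phi,
   extended to a neighbourhood of the boundary along the level sets of phi. *)
Definition unit_normal (R : realType) (n : nat) (h : 'rV[R]_n -> 'M[R]_n)
    (phi : 'rV[R]_n -> R) (x : 'rV[R]_n) : 'rV[R]_n :=
  \row_j ((norm_covector h x (grad phi x))^-1 *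
          \sum_k hinv h x j k * partial k phi x).

(* II(xi, eta) = < nabla_xi nu, eta > with nu the outward unit normal; this
   is positive for the Euclidean ball.  For tangent xi it depends on nu only
   along the boundary. *)
Definition second_fundamental_form (R : realType) (n : nat)
    (h : 'rV[R]_n -> 'M[R]_n) (phi : 'rV[R]_n -> R)
    (p xi eta : 'rV[R]_n) : R :=
  inner_vector h p
    (\row_k \sum_j xi 0 j * cov_vector h (unit_normal h phi) p j k) eta.

Definition strictly_convex_boundary (R : realType) (n : nat)
    (M : set 'rV[R]_n) (h : 'rV[R]_n -> 'M[R]_n) : Prop :=
  forall (p : 'rV[R]_n) (phi : 'rV[R]_n -> R),
    bdry M p -> defining_function M p phi ->
    forall xi : 'rV[R]_n, xi != 0 -> \sum_j partial j phi p * xi 0 j = 0 ->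
      0 < second_fundamental_form h phi p xi xi.

(* gam restricted to [s, t] is a geodesic of (M, h).  The curve may touch or
   end on the boundary; outside [s, t] the map gam is only an auxiliary
   extension (not required to be geodesic or to stay in M) that makes the
   derivatives at s and t meaningful. *)
Definition is_geodesic (R : realType) (n : nat) (M : set 'rV[R]_n)
    (h : 'rV[R]_n -> 'M[R]_n) (s t : R) (gam : R -> 'rV[R]_n) : Prop :=
  forall r : R, s <= r <= t ->
    [/\ M (gam r),
        \forall q \near r, derivable gam q 1,
        derivable (gam^`())%classic r 1 &
        forall k : 'I_n,
          (gam^`())%classic^`()%classic r 0 k
          + \sum_i \sum_j christoffel h (gam r) k i j *
              (gam^`())%classic r 0 i * (gam^`())%classic r 0 j = 0].

Definition geodesic_through (R : realType) (n : nat) (M : set 'rV[R]_n)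
    (h : 'rV[R]_n -> 'M[R]_n) (x xi : 'rV[R]_n) (s t : R)
    (gam : R -> 'rV[R]_n) : Prop :=
  [/\ s <= 0 <= t, is_geodesic M h s t gam, gam 0 = x &
      (gam^`())%classic 0 = xi].

Definition maximal_geodesic (R : realType) (n : nat) (M : set 'rV[R]_n)
    (h : 'rV[R]_n -> 'M[R]_n) (x xi : 'rV[R]_n) (tm tp : R)
    (gam : R -> 'rV[R]_n) : Prop :=
  geodesic_through M h x xi tm tp gam /\
  forall (s t : R) (sig : R -> 'rV[R]_n),
    geodesic_through M h x xi s t sig -> tm <= s /\ t <= tp.

Definition non_trapping (R : realType) (n : nat) (M : set 'rV[R]_n)
    (h : 'rV[R]_n -> 'M[R]_n) : Prop :=
  forall x xi : 'rV[R]_n, M x -> xi != 0 ->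
    exists (tm tp : R) (gam : R -> 'rV[R]_n),
      maximal_geodesic M h x xi tm tp gam.

Definition CNTM (R : realType) (n : nat) (M : set 'rV[R]_n)
    (h : 'rV[R]_n -> 'M[R]_n) : Prop :=
  [/\ compact M, strictly_convex_boundary M h & non_trapping M h].

Definition curve_length (R : realType) (n : nat) (h : 'rV[R]_n -> 'M[R]_n)
    (s t : R) (gam : R -> 'rV[R]_n) : R :=
  \int[lebesgue_measure]_(r in `[s, t])
    norm_vector h (gam r) ((gam^`())%classic r).

Definition geodesic_lengths (R : realType) (n : nat) (M : set 'rV[R]_n)
    (h : 'rV[R]_n -> 'M[R]_n) : set R :=
  [set L | exists (s t : R) (gam : R -> 'rV[R]_n),
     [/\ s <= t, is_geodesic M h s t gam & L = curve_length h s t gam]].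

(* D is the length of the longest geodesic of (M, h). *)
Definition is_diameter (R : realType) (n : nat) (M : set 'rV[R]_n)
    (h : 'rV[R]_n -> 'M[R]_n) (D : R) : Prop :=
  geodesic_lengths M h D /\ ubound (geodesic_lengths M h) D.

(* Main.v *)
(* Write h = N g with N = 1 / v_p^2, and let f be the inner derivative of v.

   Energy: testing the equation with v, the terms d (a' delta v) and delta f
   give a divergence, whose integral vanishes since v = 0 on the boundary; with
   the Cauchy-Schwarz and Young inequalities the integral E of |f|^2 and the
   integral P of |v|^2 satisfy
     E <= (3 a_0 + alpha_0 / 2 + 3 beta_0 / 2) E + (alpha_0^3 + beta_0^3) / 2 P.

   Poincare: P <= (D^2 / 2) E.  The function <v, p> on the unit tangent bundle
   vanishes over the boundary and its derivative along a geodesic, whose length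
   is at most D, is f(p, p); integrate over phase space and then over the
   momenta.  The geodesic flow is replaced by the symplectic Euler scheme of the
   Hamiltonian (|p|^2 - N(x)) / 2 in R^6: each step is a composition of shears,
   hence preserves Lebesgue measure, and no smoothness of the flow, of the exit
   times or of the boundary is needed.  Discrete trajectories in a thin shell
   around the zero energy level leave M within length L for each L > D, since
   otherwise a limit of them would be a geodesic of length > D.

   As 3 a_0 + alpha_0 / 2 + 3 beta_0 / 2 + (alpha_0^3 + beta_0^3) D^2 / 4 < 1,
   both integrals vanish. *)

Require Import Defs.
From HB Require Import structures.
From mathcomp Require Import all_boot all_order all_algebra.
From mathcomp Require Import all_classical all_reals all_analysis.
From mathcomp Require Import measurable_realfun ring lra.

Set Implicit Arguments.
Unset Strict Implicit.
Unset Printing Implicit Defensive.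

Import Order.TTheory GRing.Theory Num.Theory.
Import numFieldNormedType.Exports.

Local Open Scope classical_set_scope.
Local Open Scope ring_scope.

(** * Measure-preserving maps of R^3 *)

(** By the Maupertuis principle, curves with x'' = grad N / 2 and |x'|^2 = N are reparametrized
    geodesics of N g, with length element N dt. This Hamiltonian is a function of p plus a function
    of x, and that is what splits an Euler step into shears. The energy is conserved by a step to
    first order only, and its zero level is a null set; hence the shell |energy| < d, with a cutoff
    that vanishes at its edge. The one-dimensional inequality is used in a local form. Let s be the
    length left until exit and psi(s) = s (2 L - s), so psi'' = -2 and psi <= L^2. Along a
    trajectory the square of the derivative of f is 2 f^2 / psi, plus a square, minus the derivative
    of f^2 psi'(s) / psi(s). The last term integrates to zero by invariance of the measure, which
    leaves the factor 2 / L^2. The average over momenta contributes 1/3 to both sides, so the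
    constant D^2 / 2 survives. The limits are taken in a fixed order: step size to 0, then shell
    width to 0, then L to D. *)

Section scaling_maps.
Context d (T : measurableType d) (R : realType).

Definition scales_measure (mu : set T -> \bar R) (k : R) (phi : T -> T) :=
  measurable_fun [set: T] phi /\
  forall B, measurable B -> mu (phi @^-1` B) = (k%:E * mu B)%E.

Lemma scales_measure_comp (mu : set T -> \bar R) k l phi psi :
  scales_measure mu k phi -> scales_measure mu l psi ->
  scales_measure mu (k * l) (psi \o phi).
Proof.
move=> [mphi Hphi] [mpsi Hpsi]; split; first exact: measurableT_comp.
move=> B mB; rewrite comp_preimage Hphi; last first.
  by rewrite -[X in measurable X]setTI; exact: mpsi.
by rewrite Hpsi// muleA EFinM.
Qed.

Lemma ge0_integral_scales_measure (mu : {measure set T -> \bar R}) phi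
    (f : T -> \bar R) :
  scales_measure mu 1 phi -> measurable_fun [set: T] f -> (forall x, 0 <= f x)%E ->
  (\int[mu]_x f (phi x) = \int[mu]_x f x)%E.
Proof.
move=> [mphi Hphi] mf f0.
have := @ge0_integral_pushforward _ _ _ _ _ _ mphi mu _ f measurableT mf.
rewrite preimage_setT => <-; last by move=> x _; exact: f0.
 apply: eq_measure_integral => A mA _.
by rewrite /= /pushforward; move: (Hphi A mA); rewrite mul1e.
Qed.

Lemma integral_scales_measure (mu : {measure set T -> \bar R}) phi
    (f : T -> \bar R) :
  scales_measure mu 1 phi -> mu.-integrable [set: T] f ->
  (\int[mu]_x f (phi x) = \int[mu]_x f x)%E.
Proof.
move=> mphi /[dup] intf /integrableP[mf _].
rewrite integralE [RHS]integralE; congr (_ - _)%E.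
  by rewrite -(ge0_integral_scales_measure mphi (measurable_funepos mf))// funepos_comp.
by rewrite -(ge0_integral_scales_measure mphi (measurable_funeneg mf))// funeneg_comp.
Qed.

End scaling_maps.

Section skew_products.
Context d1 d2 (T1 : measurableType d1) (T2 : measurableType d2) (R : realType).
Variables (m1 : {sigma_finite_measure set T1 -> \bar R})
          (m2 : {sigma_finite_measure set T2 -> \bar R}).

(** Cavalieri: the map acts on each vertical section by [tau x], so the measures of the sections are
    multiplied by k before being integrated over the first factor. *)
Lemma scales_measure_skewr k (tau : T1 -> T2 -> T2) : 0 <= k ->
  measurable_fun setT (fun z : T1 * T2 => tau z.1 z.2) ->
  (forall x, scales_measure m2 k (tau x)) ->
  scales_measure (m1 \x m2)%E k (fun z => (z.1, tau z.1 z.2)).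
Proof.
move=> k0 mtau Htau; split; first exact: measurable_fun_pair.
move=> B mB; rewrite /= /product_measure1/= -ge0_integralZl//=; last first.
  exact: measurable_fun_xsection.
apply: eq_integral => x _ /=.
have -> : xsection ((fun z => (z.1, tau z.1 z.2)) @^-1` B) x =
    tau x @^-1` xsection B x.
  by apply/seteqP; split => y /=; rewrite !xsectionE.
by rewrite (Htau x).2//; exact: measurable_xsection.
Qed.

Lemma scales_measure_skewl k (tau : T2 -> T1 -> T1) : 0 <= k ->
  measurable_fun setT (fun z : T1 * T2 => tau z.2 z.1) ->
  (forall y, scales_measure m1 k (tau y)) ->
  scales_measure (m1 \x m2)%E k (fun z => (tau z.2 z.1, z.2)).
Proof.
move=> k0 mtau Htau.
have mF : measurable_fun setT (fun z : T1 * T2 => (tau z.2 z.1, z.2)).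
  exact: measurable_fun_pair.
split=> // B mB.
(* The product measure is defined through vertical sections, whereas this map acts on horizontal
   ones; uniqueness of the product measure exchanges the two iterated integrals. *)
have E X : measurable X -> ((m1 \x m2) X = (m1 \x^ m2) X)%E.
  by apply: product_measure_unique => A A' mA mA'; exact: product_measure2E.
rewrite !E//; last by rewrite -[X in measurable X]setTI; exact: mF.
rewrite /product_measure2/= -ge0_integralZl//=; last first.
  exact: measurable_fun_ysection.
apply: eq_integral => y _ /=.
have -> : ysection ((fun z => (tau z.2 z.1, z.2)) @^-1` B) y =
    tau y @^-1` ysection B y.
  by apply/seteqP; split => x /=; rewrite !ysectionE.
by rewrite (Htau y).2//; exact: measurable_ysection.
Qed.

End skew_products.

Section affine.
Context {R : realType}.
Local Notation leb := (@lebesgue_measure R).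

(** Uniqueness of Lebesgue measure: a times the image measure has the right value on half-open
    intervals. *)
Lemma lebesgue_affine (a b : R) : 0 < a ->
  scales_measure leb a^-1 (fun x : R => a * x + b).
Proof.
move=> a0.
pose phi : measurableTypeR R -> measurableTypeR R := fun x => a * x + b.
have mphi : measurable_fun setT phi.
  by apply: measurable_funD => //; exact: measurable_funM.
split=> // B mB.
have a0' : 0 <= a by exact: ltW.
pose push := measure_function_pushforward__canonical__measure_function_Measure
  leb mphi.
pose nu : {measure set (measurableTypeR R) -> \bar R} :=
  mscale (NngNum a0') push.
have -> : leb B = nu B.
  apply: lebesgue_measure_unique => // X [[u v] _ <-] /=.
  rewrite /nu /mscale/= /pushforward.
  have -> : phi @^-1` `]u, v] = [set` `](u - b) / a, (v - b) / a]].
    apply/seteqP; split => x /=; rewrite !in_itv/= ltr_pdivrMr// ler_pdivlMr//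
      ltrBlDr lerBrDr (mulrC x)//.
  rewrite !lebesgue_measure_itv/= !lte_fin ltr_pM2r ?invr_gt0// ltrD2r.
  case: ifPn => _; last by rewrite mule0.
  rewrite -!EFinD -EFinM; congr _%:E; field; exact: lt0r_neq0.
by rewrite /nu /mscale/= muleA -EFinM mulVf ?mul1e//; exact: lt0r_neq0.
Qed.

Lemma lebesgue_translation (b : R) : scales_measure leb 1 (fun x : R => x + b).
Proof.
have := @lebesgue_affine 1 b ltr01; rewrite invr1.
by under eq_fun do rewrite mul1r.
Qed.

End affine.

(** Allows products to be iterated: the measures in dimensions 3 and 6 are built from binary
    products of sigma-finite factors. *)
Lemma product_measure_sigma_finite d1 d2 (T1 : measurableType d1)
    (T2 : measurableType d2) (R : realType)
    (m1 : {sigma_finite_measure set T1 -> \bar R})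
    (m2 : {sigma_finite_measure set T2 -> \bar R}) :
  sigma_finite setT (m1 \x m2)%E.
Proof.
have /sigma_finiteP[F [TF ndF Foo]] := sigma_finiteT m1.
have /sigma_finiteP[G [TG ndG Goo]] := sigma_finiteT m2.
exists (fun n => F n `*` G n).
  apply/esym/seteqP; split => // -[x y] _.
  have [n _ Fx] : (\bigcup_n F n) x by rewrite -TF.
  have [m _ Gy] : (\bigcup_n G n) y by rewrite -TG.
  exists (maxn n m) => //; split => /=.
    by have /subsetPset := ndF _ _ (leq_maxl n m); exact.
  by have /subsetPset := ndG _ _ (leq_maxr n m); exact.
move=> n; have [mF Fy] := Foo n; have [mG Gy] := Goo n.
split; first exact: measurableX.
by rewrite product_measure1E// lte_mul_pinfty// ge0_fin_numE.
Qed.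

Section lebesgue_product.
Context {R : realType}.
Local Notation leb := (@lebesgue_measure R).

Definition lebesgue2 :
    set (measurableTypeR R * measurableTypeR R)%type -> \bar R := (leb \x leb)%E.

HB.instance Definition _ := Measure.on lebesgue2.
HB.instance Definition _ := Measure_isSigmaFinite.Build _ _ _ lebesgue2
  (product_measure_sigma_finite leb leb).

Definition lebesgue3 :
    set (measurableTypeR R * measurableTypeR R * measurableTypeR R)%type -> \bar R := (lebesgue2 \x leb)%E.

HB.instance Definition _ := Measure.on lebesgue3.
HB.instance Definition _ := Measure_isSigmaFinite.Build _ _ _ lebesgue3
  (product_measure_sigma_finite lebesgue2 leb).

End lebesgue_product.

Section lebesgue3.
Context {R : realType}.
Local Notation leb := (@lebesgue_measure R).
Local Notation T1 := (measurableTypeR R).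
Local Notation T2 := (T1 * T1)%type.
Local Notation T3 := (T2 * T1)%type.
Implicit Types (a b c t s : R).

Lemma lebesgue2_translation (b : T2) :
  scales_measure (@lebesgue2 R) 1 (fun z : T2 => (z.1 + b.1, z.2 + b.2)).
Proof.
rewrite -[1]mulr1.
apply: (@scales_measure_comp _ _ _ _ _ _ (fun z : T2 => (z.1, z.2 + b.2))
  (fun z : T2 => (z.1 + b.1, z.2))).
  apply: (@scales_measure_skewr _ _ _ _ _ leb leb 1 (fun _ y => y + b.2)) => //.
    exact: measurable_funD.
  by move=> _; exact: lebesgue_translation.
apply: (@scales_measure_skewl _ _ _ _ _ leb leb 1 (fun _ y => y + b.1)) => //.
  exact: measurable_funD.
by move=> _; exact: lebesgue_translation.
Qed.

Lemma lebesgue3_translation (b : T3) : scales_measure (@lebesgue3 R) 1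
  (fun z : T3 => (z.1.1 + b.1.1, z.1.2 + b.1.2, z.2 + b.2)).
Proof.
rewrite -[1]mulr1.
apply: (@scales_measure_comp _ _ _ _ _ _ (fun z : T3 => (z.1, z.2 + b.2))
  (fun z : T3 => (z.1.1 + b.1.1, z.1.2 + b.1.2, z.2))).
  apply: (@scales_measure_skewr _ _ _ _ _ lebesgue2 leb 1
    (fun _ y => y + b.2)) => //.
    exact: measurable_funD.
  by move=> _; exact: lebesgue_translation.
apply: (@scales_measure_skewl _ _ _ _ _ lebesgue2 leb 1
  (fun _ y => (y.1 + b.1.1, y.2 + b.1.2))) => //.
  apply: measurable_fun_pair; apply: measurable_funD => //.
    by apply: measurableT_comp => //.
  by apply: measurableT_comp => //.
by move=> _; exact: lebesgue2_translation.
Qed.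

Lemma lebesgue3_dilation a : 0 < a -> scales_measure (@lebesgue3 R) (a^-1 ^+ 3)
  (fun z : T3 => (a * z.1.1, a * z.1.2, a * z.2)).
Proof.
move=> a0; have ia0 : 0 <= a^-1 by rewrite invr_ge0 ltW.
have H : scales_measure leb a^-1 (fun x : R => a * x).
  by have := lebesgue_affine 0 a0; under eq_fun do rewrite addr0.
have mM : measurable_fun [set: R] (fun y : R => a * y) by exact: H.1.
rewrite exprS; apply: (@scales_measure_comp _ _ _ _ _ _
  (fun z : T3 => (z.1, a * z.2)) (fun z : T3 => (a * z.1.1, a * z.1.2, z.2))).
  apply: (@scales_measure_skewr _ _ _ _ _ lebesgue2 leb _
    (fun _ y => a * y)) => //.
  by apply: (measurableT_comp mM).
apply: (@scales_measure_skewl _ _ _ _ _ lebesgue2 leb _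
  (fun _ y => (a * y.1, a * y.2))) => //; first exact: exprn_ge0.
  by apply: measurable_fun_pair; apply: measurable_funM => //;
    apply: measurableT_comp.
move=> _; apply: (@scales_measure_comp _ _ _ _ _ _
  (fun z : T2 => (z.1, a * z.2)) (fun z : T2 => (a * z.1, z.2))).
  apply: (@scales_measure_skewr _ _ _ _ _ leb leb _ (fun _ y => a * y)) => //.
  by apply: (measurableT_comp mM).
apply: (@scales_measure_skewl _ _ _ _ _ leb leb _ (fun _ y => a * y)) => //.
by apply: (measurableT_comp mM).
Qed.

Let shear21 t : scales_measure (@lebesgue2 R) 1
  (fun z : T2 => (z.1, z.2 + t * z.1)).
Proof.
apply: (@scales_measure_skewr _ _ _ _ _ leb leb _ (fun x y => y + t * x)) => //.
  by apply: measurable_funD => //; exact: measurable_funM.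
by move=> x; exact: lebesgue_translation.
Qed.

Let shear12 t : scales_measure (@lebesgue2 R) 1
  (fun z : T2 => (z.1 + t * z.2, z.2)).
Proof.
apply: (@scales_measure_skewl _ _ _ _ _ leb leb _ (fun x y => y + t * x)) => //.
  by apply: measurable_funD => //; exact: measurable_funM.
by move=> x; exact: lebesgue_translation.
Qed.

(* For t = - tan (theta / 2) and s = sin theta this is the rotation of angle
   theta in the first two coordinates. *)
Definition shears12 t s (z : T3) : T3 :=
  let x := z.1.1 + t * z.1.2 in let y := z.1.2 + s * x in (x + t * y, y, z.2).

Definition shears23 t s (z : T3) : T3 :=
  let x := z.1.2 + t * z.2 in let y := z.2 + s * x in (z.1.1, x + t * y, y).

(** A shear translates one coordinate by a function of another, so the skew-product lemmas apply.
    For t = -1 and s = 1 the three shears compose to a quarter turn. *)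
Lemma scales_measure_shears12 t s :
  scales_measure (@lebesgue3 R) 1 (shears12 t s).
Proof.
apply: (@scales_measure_skewl _ _ _ _ _ lebesgue2 leb _
  (fun _ w => ((w.1 + t * w.2) + t * (w.2 + s * (w.1 + t * w.2)),
               w.2 + s * (w.1 + t * w.2)))) => //.
  apply: (@measurableT_comp _ _ _ _ _ _ (fun w : T2 =>
    ((w.1 + t * w.2) + t * (w.2 + s * (w.1 + t * w.2)),
      w.2 + s * (w.1 + t * w.2))) _ fst) => //.
  have := scales_measure_comp (scales_measure_comp (shear12 t) (shear21 s))
    (shear12 t).
  by case.
move=> _; have := scales_measure_comp (scales_measure_comp (shear12 t)
  (shear21 s)) (shear12 t).
by rewrite !mulr1.
Qed.

Lemma scales_measure_shears23 t s :
  scales_measure (@lebesgue3 R) 1 (shears23 t s).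
Proof.
have m12 : measurable_fun [set: T3] (fun w : T3 => w.1.2).
  exact: measurableT_comp.
have h1 r : scales_measure (@lebesgue3 R) 1
    (fun z : T3 => ((z.1.1, z.1.2 + r * z.2), z.2)).
  apply: (@scales_measure_skewl _ _ _ _ _ lebesgue2 leb _
    (fun c w => (w.1, w.2 + r * c))) => //.
    apply: measurable_fun_pair => //; first exact: measurableT_comp.
    by apply: measurable_funD => //; exact: measurable_funM.
  move=> c; have := lebesgue2_translation (0, r * c) => /=.
  by under eq_fun do rewrite addr0.
have h2 r : scales_measure (@lebesgue3 R) 1
    (fun z : T3 => (z.1, z.2 + r * z.1.2)).
  apply: (@scales_measure_skewr _ _ _ _ _ lebesgue2 leb _
    (fun w c => c + r * w.2)) => //.
    by apply: measurable_funD => //; exact: measurable_funM.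
  by move=> w; exact: lebesgue_translation.
have := scales_measure_comp (scales_measure_comp (h1 t) (h2 s)) (h1 t).
by rewrite !mulr1.
Qed.

End lebesgue3.

Notation R3 R :=
  (measurableTypeR R * measurableTypeR R * measurableTypeR R)%type.

(** * Measurability in row-vector coordinates *)

Section row_of_triple.
Context {R : realType}.

(** Fubini is applied on triples of reals, while topology and derivatives live on row vectors;
    [row3] and [triple] pass between the two. *)
Definition row3 (t : R * R * R) : 'rV[R]_3 :=
  \row_j nth 0 [:: t.1.1; t.1.2; t.2] j.

Lemma coord_le_norm n (x : 'rV[R]_n) (j : 'I_n) : `|x 0 j| <= `|x|.
Proof.
rewrite [leRHS]/Num.Def.normr/= mx_normrE.
exact: (le_bigmax _ (fun ij => `|x ij.1 ij.2|) (0, j)).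
Qed.

Lemma norm_lt_coord n (x : 'rV[R]_n) (e : R) : 0 < e ->
  (forall j, `|x 0 j| < e) -> `|x| < e.
Proof.
move=> e0 H; rewrite [ltLHS]/Num.Def.normr/= mx_normrE; apply: bigmax_lt => //.
by move=> [i j] _; rewrite (ord1 i).
Qed.

Lemma norm_le_coord n (x : 'rV[R]_n) (e : R) : 0 <= e ->
  (forall j, `|x 0 j| <= e) -> `|x| <= e.
Proof.
move=> e0 H; rewrite [leLHS]/Num.Def.normr/= mx_normrE; apply: bigmax_le => //.
by move=> [i j] _; rewrite (ord1 i).
Qed.

Lemma ord3_ind (P : 'I_3 -> Prop) : P 0 -> P 1 -> P 2%:R -> forall j, P j.
Proof.
move=> P0 P1 P2 [[|[|[|//]]] h].
- by rewrite (_ : Ordinal h = 0)//; exact: val_inj.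
- by rewrite (_ : Ordinal h = 1)//; exact: val_inj.
- by rewrite (_ : Ordinal h = 2%:R)//; exact: val_inj.
Qed.

Lemma sum_ord3 (V : nmodType) (F : 'I_3 -> V) :
  \sum_j F j = F 0 + F 1 + F 2%:R.
Proof.
rewrite !big_ord_recr big_ord0/= add0r; congr (F _ + F _ + F _);
  exact: val_inj.
Qed.

Let box (i : rat * rat * rat * nat) : set (R3 R) :=
  [set t | [/\ `|t.1.1 - ratr i.1.1.1| < i.2.+1%:R^-1,
               `|t.1.2 - ratr i.1.1.2| < i.2.+1%:R^-1 &
               `|t.2 - ratr i.1.2| < i.2.+1%:R^-1]].

Let mbox i : measurable (box i).
Proof.
pose I (q : rat) (e : R) : set (measurableTypeR R) :=
  `](ratr q - e), (ratr q + e)[%classic.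
have IE q e x : I q e x <-> `|x - ratr q| < e.
  by rewrite /I /= in_itv/= distrC ltr_distlC; split.
pose e : R := i.2.+1%:R^-1.
have -> : box i = (I i.1.1.1 e `*` I i.1.1.2 e) `*` I i.1.2 e.
  by apply/seteqP; split => -[[a b] c]; rewrite /box /=;
    [move=> [] /IE ? /IE ? /IE ?|move=> [[/IE ? /IE ?] /IE ?]].
by do !apply: measurableX; exact: measurable_itv.
Qed.

(** The cubes with rational centre and half-width 1 / (m + 1) are countably many, and an open set is
    the union of those it contains. *)
Lemma measurable_row3_open (O : set 'rV[R]_3) : open O ->
  measurable (row3 @^-1` O : set (R3 R)).
Proof.
move=> oO.
pose F i := if `[< box i `<=` row3 @^-1` O >] then box i else set0.
suff -> : (row3 @^-1` O : set (R3 R)) = \bigcup_i F i.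
  apply: countable_bigcupT_measurable => // i.
  by rewrite /F; case: ifP.
apply/seteqP; split; last first.
  move=> t [i _]; rewrite /F; case: ifPn => // /asboolP; exact.
move=> t /= Ot.
have /nbhs_ballP[e /= e0 He] : nbhs (row3 t) O by exact: open_nbhs_nbhs.
have e2 : 0 < e / 2 by rewrite divr_gt0.
have [n _ /(_ _ (leqnn n))/= Hn] := near_infty_natSinv_lt (PosNum e2).
have n0 : 0 < (n.+1%:R^-1 : R) by rewrite invr_gt0.
have rat_near (x : R) : exists q : rat, `|x - ratr q| < n.+1%:R^-1.
  have /rat_in_itvoo[q] : x - n.+1%:R^-1 < x + n.+1%:R^-1.
    by rewrite ltrD2l (lt_trans _ n0)// oppr_lt0.
  by rewrite in_itv/= -ltr_distlC => ?; exists q.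
have [q1 H1] := rat_near t.1.1; have [q2 H2] := rat_near t.1.2.
have [q3 H3] := rat_near t.2.
exists (q1, q2, q3, n) => //; rewrite /F asboolT//.
move=> y [/= h1 h2 h3]; apply: He.
rewrite -ball_normE /ball_/=; apply: norm_lt_coord => //.
have near2 (a b : R) q : `|a - ratr q| < n.+1%:R^-1 ->
    `|b - ratr q| < n.+1%:R^-1 -> `|a - b| < e.
  move=> ha hb; rewrite -(subrK (ratr q) a) -addrA.
  rewrite (le_lt_trans (ler_normD _ _))// (splitr e) ltrD ?(lt_trans ha)//.
  by rewrite distrC (lt_trans hb).
by elim/ord3_ind; rewrite !mxE/=; [exact: near2 H1 h1|exact: near2 H2 h2|
  exact: near2 H3 h3].
Qed.

Lemma measurable_row3_patch (O : set 'rV[R]_3) (F : 'rV[R]_3 -> R) : open O ->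
  (forall x, O x -> {for x, continuous F}) ->
  measurable_fun [set: R3 R] (fun t => (F \_ O) (row3 t)).
Proof.
move=> oO cF.
apply: (measurability _ (RGenOInfty.measurableE R)) => // _ [_ [a ->] <-].
rewrite setTI.
have oOa : open (O `&` F @^-1` `]a, +oo[).
  rewrite openE => x [Ox]; rewrite /= in_itv/= andbT => Fx.
  apply: filterI; first exact: open_nbhs_nbhs.
  by apply: (cF _ Ox); rewrite nbhsE/=; exists `]a, +oo[%classic;
    [split=> //=; rewrite in_itv/= andbT|].
(* The patch is 0 off O, and 0 lies in []a, +oo[] exactly when a < 0; the complement of O then joins
   the preimage. *)
have [a0|a0] := ltP a 0.
- rewrite (_ : _ @^-1` _ = row3 @^-1` (O `&` F @^-1` `]a, +oo[) `|`
    ~` (row3 @^-1` O)); last first.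
    apply/seteqP; split => t /=; rewrite /patch; case: ifPn.
    + by rewrite inE => Ot h; left.
    + by rewrite notin_setE => Ot _; right.
    + by rewrite inE => Ot [[]|].
    + by rewrite notin_setE => Ot [[]//|_]; rewrite in_itv/= andbT.
  apply: measurableU; first exact: measurable_row3_open.
  by apply: measurableC; exact: measurable_row3_open.
- rewrite (_ : _ @^-1` _ = row3 @^-1` (O `&` F @^-1` `]a, +oo[)); last first.
    apply/seteqP; split => t /=; rewrite /patch; case: ifPn.
    + by rewrite inE.
    + by rewrite in_itv/= andbT => _; rewrite ltNge a0.
    + by rewrite inE => Ot [].
    + by rewrite notin_setE => Ot [].
  exact: measurable_row3_open.
Qed.

End row_of_triple.

(** * Limits of discrete trajectories *)

Lemma ultra_compact_cvg (I : Type) (T : topologicalType) (F : set_system I)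
    (K : set T) (f : I -> T) : UltraFilter F -> compact K ->
  (forall i, K (f i)) -> exists2 l, K l & f @ F --> l.
Proof.
move=> FU cK Kf.
have [l [Kl lcl]] : K `&` cluster (f @ F) !=set0.
  have FF : ProperFilter (f @ F) by exact: fmap_proper_filter.
  by apply: (cK _ FF); exact: (@filterE _ F _ (f @^-1` K)).
exists l => // A lA.
have [//|FnA] := in_ultra_setVsetC (f @^-1` A) FU.
have [z [nAz Az]] := lcl _ _ (FnA : (f @ F) (~` A)) lA.
by case: (nAz Az).
Qed.

Lemma is_derive_increment (R : realType) (V : normedModType R) (Y : R -> V) (t : R) q :
  (forall e, 0 < e -> exists2 r, 0 < r &
    forall t', `|t' - t| < r -> `|Y t' - Y t - (t' - t) *: q| <= e * `|t' - t|) ->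
  is_derive t 1 Y q.
Proof.
move=> H.
have cvgq : (h^-1 *: (Y (h *: 1 + t) - Y t)) @[h --> 0^'] --> q.
  apply/cvgrPdist_le => e e0; have [r r0 Hr] := H _ e0.
  near=> h.
  have h0 : h != 0 by near: h; exact: nbhs_dnbhs_neq.
  have hr : `|h| < r by near: h; exact: dnbhs0_lt.
  have := Hr (h + t); rewrite addrK => /(_ hr) Hh.
  rewrite distrC.
  have -> : h^-1 *: (Y (h *: 1 + t) - Y t) - q =
      h^-1 *: (Y (h + t) - Y t - h *: q).
    have -> : h *: (1 : R) = h by exact: mulr1.
    by rewrite [RHS]scalerBr scalerA mulVf// scale1r.
  by rewrite normrZ normfV ler_pdivrMl ?normr_gt0// mulrC.
have dY : derivable Y t 1 by apply/cvg_ex; exists q.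
by apply: DeriveDef => //; apply/cvg_lim.
Unshelve. all: by end_near. Qed.

(* The limit is taken along an ultrafilter, in the time variable
   T = sum of eps * N, so that no subsequence extraction is needed and the
   limit is directly parametrized by arc length. *)
Section limit_curve.
Context {R : realType} {n : nat}.
Local Notation V := 'rV[R]_n.
Variables (M : set V) (N : V -> R) (G : V -> V) (P0 G0 N0 N1 L : R).
Variables (eps del : R^nat) (m : nat -> nat) (x p : nat -> nat -> V).
Hypothesis cM : compact M.
Hypothesis cN : forall y, M y -> {for y, continuous N}.
Hypothesis cG : forall y, M y -> {for y, continuous G}.
Hypothesis N0_gt0 : 0 < N0.
Hypothesis NE : forall y, M y -> N0 <= N y <= N1.
Hypothesis GE : forall y, M y -> `|G y| <= G0.
Hypothesis eps_gt0 : forall k, 0 < eps k.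
Hypothesis eps0 : eps @ \oo --> 0.
Hypothesis Mx : forall k i, (i <= m k)%N -> M (x k i).
Hypothesis pP : forall k i, (i <= m k)%N -> `|p k i| <= P0.
Hypothesis pS : forall k i, (i < m k)%N ->
  p k i.+1 = p k i + eps k *: G (x k i).
Hypothesis xS : forall k i, (i < m k)%N ->
  x k i.+1 = x k i + eps k *: p k i.+1.
Hypothesis L_gt0 : 0 < L.

Let T k i := \sum_(j < i) eps k * N (x k j).
Hypothesis TL : forall k, L < T k (m k).

Let TS k i : T k i.+1 = T k i + eps k * N (x k i).
Proof. by rewrite /T big_ord_recr. Qed.

Let idx_ex k (t : R) : exists i, 0 <= t < L ->
  (i < m k)%N /\ T k i <= t < T k i.+1.
Proof.
have [/andP[t0 tL]|h] := boolP (0 <= t < L); last by exists 0%N.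
have Pm : exists i, t < T k i by exists (m k); exact: lt_trans (TL k).
case: (ex_minnP Pm) => -[|i] Hi mini.
  by move: Hi; rewrite /T big_ord0 ltNge t0.
exists i => _; split; first by apply: mini; exact: lt_trans (TL k).
by rewrite Hi andbT leNgt; apply/negP => /mini; rewrite ltnn.
Qed.

(** The step during which the accumulated length passes t, so that [x k (idx k t)] is the k-th
    discrete curve parametrized by length. It is controlled on [[0, L[] only. *)
Let idx k (t : R) := xget 0%N [set i | (i < m k)%N /\ T k i <= t < T k i.+1].

Let idxP k (t : R) : 0 <= t < L -> (idx k t < m k)%N /\
  T k (idx k t) <= t < T k (idx k t).+1.
Proof.
move=> tL; have [i /(_ tL) Hi] := idx_ex k t.
exact: (@xgetPex _ 0%N [set i | (i < m k)%N /\ T k i <= t < T k i.+1]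
  (ex_intro _ i Hi)).
Qed.

Let T_step k i : (i < m k)%N -> T k i < T k i.+1 <= T k i + eps k * N1.
Proof.
move=> im; have /andP[h1 h2] := NE (Mx (ltnW im)).
rewrite TS ltrDl lerD2l ler_pM2l// h2 andbT mulr_gt0//.
exact: lt_le_trans h1.
Qed.

Let T_le k i j : (i <= j <= m k)%N -> T k i <= T k j.
Proof.
move=> /andP[]; elim: j => [|j IH]; first by rewrite leqn0 => /eqP->.
rewrite leq_eqVlt => /orP[/eqP->//|ij] jm.
rewrite (le_trans (IH _ (ltnW jm)))//.
by have /andP[/ltW] := T_step jm.
Qed.

Let T_idx k (t : R) : 0 <= t < L -> `|T k (idx k t) - t| <= eps k * N1.
Proof.
move=> tL; have [im /andP[h1 h2]] := idxP k tL.
have /andP[h3 h4] := T_step im.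
by rewrite ler_distl; apply/andP; split; lra.
Qed.

Section increments.
Variables (y r : nat -> nat -> V).
Hypothesis yS : forall k i, (i < m k)%N -> y k i.+1 = y k i + eps k *: r k i.

(** Discrete mean value inequality with T as the variable: y and T advance by eps r and eps N, so
    the rate in length is r / N. The lower bound N0 <= N converts an error per step into an error
    proportional to the length covered. It serves the positions, with r the next momentum, and the
    momenta, with r the force. *)
Let segment k a b (q : V) e : (a <= b <= m k)%N ->
  (forall l, (a <= l < b)%N -> `|r k l - N (x k l) *: q| <= e * N0) ->
  `|y k b - y k a - (T k b - T k a) *: q| <= e * (T k b - T k a).
Proof.
move=> /andP[]; elim: b => [|b IH].
  by rewrite leqn0 => /eqP-> _ _; rewrite !subrr scale0r subr0 normr0 mulr0.
rewrite leq_eqVlt => /orP[/eqP<- _ _|ab bm H].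
  by rewrite !subrr scale0r subr0 normr0 mulr0.
have IHb : `|y k b - y k a - (T k b - T k a) *: q| <= e * (T k b - T k a).
  by apply: IH => //; [exact: ltnW|move=> l /andP[al lb]; apply: H;
    rewrite al/= ltnS ltnW].
have := H b; rewrite -ltnS ab ltnSn => /(_ isT) Hb.
have /andP[Nb _] := NE (Mx (ltnW bm)).
rewrite yS// TS.
have -> : y k b + eps k *: r k b - y k a -
    (T k b + eps k * N (x k b) - T k a) *: q =
  (y k b - y k a - (T k b - T k a) *: q) + eps k *: (r k b - N (x k b) *: q).
  by apply/rowP => j; rewrite !mxE; ring.
rewrite (le_trans (ler_normD _ _))// normrZ gtr0_norm//.
rewrite (le_trans (lerD IHb (_ : _ <= eps k * (e * N0))))//.
  by rewrite ler_pM2l.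
have e0 : 0 <= e by rewrite -(pmulr_lge0 _ N0_gt0); exact: le_trans Hb.
have : eps k * (e * N0) <= eps k * (e * N (x k b)).
  by rewrite ler_pM2l// ler_wpM2l.
lra.
Qed.

Let displacement k a b B : 0 <= B -> (a <= m k)%N -> (b <= m k)%N ->
  (forall l, (l < m k)%N -> `|r k l| <= B) ->
  `|y k b - y k a| <= B / N0 * `|T k b - T k a|.
Proof.
move=> B0 am bm HB.
wlog ab : a b am bm / (a <= b)%N.
  move=> H; have [ab|/ltnW ba] := leqP a b; first exact: H.
  by rewrite distrC (distrC (T k b)); exact: H.
have := @segment k a b 0 (B / N0) _ _; rewrite ab bm => /(_ isT).
rewrite scaler0 subr0 ger0_norm; last by rewrite subr_ge0 T_le// ab.
apply=> l /andP[_ lb]; rewrite scaler0 subr0 mulfVK ?gt_eqF// HB//.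
exact: leq_trans lb bm.
Qed.

Context {F : set_system nat} {FU : UltraFilter F}.
Hypothesis Foo : \oo `<=` F.
Variable Y : R -> V.
Hypothesis yY : forall t, 0 <= t < L -> y k (idx k t) @[k --> F] --> Y t.

Let near_eps e : 0 < e -> \forall k \near F, eps k < e.
Proof.
move=> e_gt0; apply: Foo; move/cvgrPdist_lt : eps0 => /(_ _ e_gt0).
apply: filterS => k; rewrite sub0r normrN => /(le_lt_trans _); apply.
exact: ler_norm.
Qed.

Lemma limit_near t B : 0 < t < L -> 0 <= B ->
  (forall k l, (l < m k)%N -> `|r k l| <= B) ->
  forall z, 0 < z -> exists2 h, 0 < h & \forall k \near F,
    forall l, (l <= m k)%N -> `|T k l - t| < h -> `|y k l - Y t| < z.
Proof.
move=> /andP[t0 tL] B0 HB z z0.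
have tL' : 0 <= t < L by rewrite ltW.
have B1 : 0 < (B + 1) / N0 by rewrite divr_gt0// ltr_wpDl.
(* The discrete curves have Lipschitz constant at most (B + 1) / N0 in length, so lengths that
   differ by less than 2 h move y by less than z / 2. Taking B + 1 instead of B keeps the divisor
   positive. *)
pose h := z / 4 / ((B + 1) / N0).
have h0 : 0 < h by rewrite /h (divr_gt0 _ B1)// divr_gt0.
have N1_gt0 : 0 < N1.
  have /andP[h1 h2] := NE (Mx (leq0n (m 0))).
  by rewrite (lt_le_trans N0_gt0)// (le_trans h1).
exists h => //.
near=> k => l lm Tl.
have [im _] := idxP k tL'.
have e1 : eps k * N1 < h.
  by rewrite -ltr_pdivlMr//; near: k; apply: near_eps; exact: divr_gt0.
have Hd := displacement (ltW (_ : 0 < B + 1)) (ltnW im) lm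
  (fun l lm => le_trans (HB k l lm) _).
have {Hd} : `|y k l - y k (idx k t)| <= (B + 1) / N0 *
    `|T k l - T k (idx k t)|.
  by apply: Hd; rewrite ?lerDl// ltr_wpDl.
have HT := T_idx k tL'.
have : `|T k l - T k (idx k t)| < 2 * h.
  rewrite -(subrK t (T k l)) -addrA (le_lt_trans (ler_normD _ _))//.
  by rewrite mulr2n mulrDl mul1r ltrD// distrC (le_lt_trans HT).
rewrite -(ltr_pM2l B1) => h1 h2.
have h3 : (B + 1) / N0 * (2 * h) = z / 2 by rewrite /h; field;
  rewrite ?gt_eqF ?ltr_wpDl.
have h4 : `|y k (idx k t) - Y t| < z / 2.
  rewrite distrC; near: k.
  by move/cvgrPdist_lt : (yY tL'); apply; exact: divr_gt0.
rewrite -(subrK (y k (idx k t)) (y k l)) -addrA (le_lt_trans (ler_normD _ _))//.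
by rewrite (splitr z) ltrD// -h3 (le_lt_trans h2).
Unshelve. all: by end_near. Qed.

(** Between the indices of t and t', [segment] bounds the increment of y with an error of e times
    the length; replacing discrete lengths by t and t' costs a multiple of eps, which disappears in
    the limit along F. *)
Lemma limit_derive t q : 0 < t < L ->
  (forall e, 0 < e -> exists2 h, 0 < h & \forall k \near F,
    forall l, (l < m k)%N -> `|T k l - t| < h ->
      `|r k l - N (x k l) *: q| <= e) ->
  is_derive t 1 Y q.
Proof.
move=> /andP[t0 tL] H; apply: is_derive_increment => e e0.
have tL' : 0 <= t < L by rewrite ltW.
have [h h0 Hh] := H _ (mulr_gt0 e0 N0_gt0).
have N1_gt0 : 0 < N1.
  have /andP[h1 h2] := NE (Mx (leq0n (m 0))).
  by rewrite (lt_le_trans N0_gt0)// (le_trans h1).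
exists (Num.min (h / 2) (Num.min t (L - t))).
  by rewrite !lt_min divr_gt0// t0 subr_gt0 tL.
move=> t'; rewrite !lt_min => /and3P[t'h t't t'L].
have t'L' : 0 <= t' < L.
  move: t't t'L; rewrite !ltr_norml => /andP[? ?] /andP[? ?].
  by apply/andP; split; lra.
(* Each of t and t' is within eps N1 of its discrete length, so the difference of lengths is off by
   at most 2 eps N1; this error enters once with weight e and once with weight |q|. *)
pose K := e * (2 * N1) + 2 * N1 * `|q|.
have K0 : 0 <= K by rewrite addr_ge0// mulr_ge0 ?mulr_ge0// ltW.
suff Hk : \forall k \near F,
    `|y k (idx k t') - y k (idx k t) - (t' - t) *: q| <=
    e * `|t' - t| + K * eps k.
  apply/ler_addgt0Pr => z z0.
  have z2 : 0 < z / 2 by exact: divr_gt0.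
  have Hcvg : (y k (idx k t') - y k (idx k t) - (t' - t) *: q) @[k --> F] -->
      Y t' - Y t - (t' - t) *: q.
    by apply: cvgB; [apply: cvgB; exact: yY|exact: cvg_cst].
  move/cvgrPdist_lt : Hcvg => /(_ _ z2) Hcvg.
  near F => k.
  have h1 : `|Y t' - Y t - (t' - t) *: q -
      (y k (idx k t') - y k (idx k t) - (t' - t) *: q)| < z / 2 by near: k.
  have h2 : `|y k (idx k t') - y k (idx k t) - (t' - t) *: q| <=
    e * `|t' - t| + K * eps k by near: k.
  have h3 : eps k < z / 2 / (K + 1).
    by near: k; apply: near_eps; rewrite divr_gt0// ltr_wpDl.
  have h4 : K * eps k < z / 2.
    rewrite (@le_lt_trans _ _ ((K + 1) * eps k))//.
      by rewrite ler_wpM2r ?lerDl// ltW.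
    by rewrite mulrC -ltr_pdivlMr// ltr_wpDl.
  rewrite -(subrK (y k (idx k t') - y k (idx k t) - (t' - t) *: q)
    (Y t' - Y t - _)) (le_trans (ler_normD _ _))//.
  lra.
near=> k.
have e1 : eps k * N1 < h / 2.
  rewrite -ltr_pdivlMr//; near: k; apply: near_eps; rewrite divr_gt0//.
  exact: divr_gt0.
have Hk : forall l, (l < m k)%N -> `|T k l - t| < h ->
      `|r k l - N (x k l) *: q| <= e * N0 by near: k.
have [im /andP[i1 i2]] := idxP k tL'; have [jm /andP[j1 j2]] := idxP k t'L'.
have HT := T_idx k tL'; have HT' := T_idx k t'L'.
set i := idx k t in im i1 i2 HT *; set j := idx k t' in jm j1 j2 HT' *.
(* Every step between the indices i and j lies within h of t, where the hypothesis on the rates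
   applies. *)
have Tt u s : (u < m k)%N -> T k i <= T k u \/ T k j <= T k u -> 
   T k u <= T k s -> s = i \/ s = j -> `|T k u - t| < h.
  move=> _ hu us hs.
  have hs' : T k s <= Num.max t t'.
    by case: hs => ->; rewrite le_max ?i1 ?j1 ?orbT.
  have hu' : Num.min t t' - eps k * N1 <= T k u.
    move: HT HT'; rewrite !ler_distl => /andP[a1 _] /andP[a2 _].
    have : Num.min t t' <= t /\ Num.min t t' <= t'.
      by rewrite !ge_min !lexx orbT.
    case: hu => ? [? ?]; lra.
  have : Num.max t t' < t + h / 2.
    by rewrite gt_max ltrDl divr_gt0//=; move: t'h; rewrite ltr_norml; lra.
  have : t - h / 2 < Num.min t t'.
    rewrite lt_min; apply/andP; split; last first.
      by move: t'h; rewrite ltr_norml; lra.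
    by rewrite ltrBlDr ltrDl divr_gt0.
  by rewrite ltr_norml; move=> ? ?; apply/andP; split; lra.
have key : `|y k j - y k i - (T k j - T k i) *: q| <=
    e * `|T k j - T k i|.
  have [ij|/ltnW ji] := leqP i j.
    rewrite [leRHS](_ : _ = e * (T k j - T k i)); last first.
      by rewrite ger0_norm// subr_ge0 T_le// ij ltnW.
    apply: segment; first by rewrite ij ltnW.
    move=> l /andP[il lj]; have lm := ltn_trans lj jm; apply: Hk => //.
    by apply: (Tt _ j) => //; [left; rewrite T_le// il ltnW|
      rewrite T_le// (ltnW lj) ltnW|right].
  rewrite [leRHS](_ : _ = e * (T k i - T k j)); last first.
    by rewrite distrC ger0_norm// subr_ge0 T_le// ji ltnW.
  rewrite -normrN.
  have -> : - (y k j - y k i - (T k j - T k i) *: q) =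
      y k i - y k j - (T k i - T k j) *: q.
    by apply/rowP => u; rewrite !mxE; ring.
  apply: segment; first by rewrite ji ltnW.
  move=> l /andP[jl li]; have lm := ltn_trans li im; apply: Hk => //.
  by apply: (Tt _ i) => //; [right; rewrite T_le// jl ltnW|
    rewrite T_le// (ltnW li) ltnW|left].
have hT : `|(T k j - T k i) - (t' - t)| <= 2 * (eps k * N1).
  have -> : (T k j - T k i) - (t' - t) = (T k j - t') - (T k i - t) by lra.
  rewrite (le_trans (ler_normB _ _))//; lra.
have hT2 : `|T k j - T k i| <= `|t' - t| + 2 * (eps k * N1).
  rewrite -(subrK (t' - t) (T k j - T k i)) (le_trans (ler_normD _ _))// addrC.
  by rewrite lerD2l.
have -> : y k j - y k i - (t' - t) *: q =
  (y k j - y k i - (T k j - T k i) *: q) +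
  ((T k j - T k i) - (t' - t)) *: q.
  by apply/rowP => u; rewrite !mxE; ring.
rewrite (le_trans (ler_normD _ _))// normrZ.
have : e * `|T k j - T k i| <= e * (`|t' - t| + 2 * (eps k * N1)).
  by rewrite ler_pM2l.
have : `|(T k j - T k i) - (t' - t)| * `|q| <= 2 * (eps k * N1) * `|q|.
  by rewrite ler_wpM2r.
rewrite /K; nra.
Unshelve. all: by end_near. Qed.

End increments.

Let compact_ball (B : R) : compact [set v : V | `|v| <= B].
Proof.
apply: bounded_closed_compact.
  by exists B; split; [exact: num_real|move=> z Bz v /= /le_trans; apply; exact: ltW].
rewrite (_ : [set v : V | `|v| <= B] = (@Num.norm R V) @^-1` [set z | z <= B]).
  by apply: closed_comp => [v _|]; [exact: norm_continuous|exact: closed_le].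
by apply/seteqP; split.
Qed.

Lemma limit_curve (E : V -> R) : continuous E -> del @ \oo --> 0 ->
  (forall k i, (i <= m k)%N -> `|E (p k i) - N (x k i)| <= del k) ->
  exists gam q : R -> V, forall t, 0 < t < L ->
    [/\ M (gam t), E (q t) = N (gam t),
        is_derive t 1 gam ((N (gam t))^-1 *: q t) &
        is_derive t 1 q ((N (gam t))^-1 *: G (gam t))].
Proof.
move=> cE del0 HE.
have [F [FU Foo]] := @ultraFilterLemma _ (nbhs \oo) _.
have P00 : 0 <= P0 by rewrite (le_trans _ (pP (leq0n (m 0)))).
have G00 : 0 <= G0 by rewrite (le_trans _ (GE (Mx (leq0n (m 0))))).
pose gam (t : R) : V := xget (0 : V) [set l : V | M l /\ x k (idx k t) @[k --> F] --> l].
pose q (t : R) : V := xget (0 : V) [set l : V | p k (idx k t) @[k --> F] --> l].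
have gamP t : 0 <= t < L ->
    M (gam t) /\ x k (idx k t) @[k --> F] --> gam t.
  move=> tL; have [|l Ml xl] := @ultra_compact_cvg _ _ F M
      (fun k => x k (idx k t)) FU cM.
    by move=> k; have [/ltnW im _] := idxP k tL; exact: Mx.
  exact: (@xgetPex V 0 [set l : V | M l /\ x k (idx k t) @[k --> F] --> l]
    (ex_intro _ l (conj Ml xl))).
have qP t : 0 <= t < L -> p k (idx k t) @[k --> F] --> q t.
  move=> tL; have [|l Ml xl] := @ultra_compact_cvg _ _ F _
      (fun k => p k (idx k t)) FU (@compact_ball P0).
    by move=> k; have [/ltnW im _] := idxP k tL; exact: pP.
  exact: (@xgetPex V 0 [set l : V | p k (idx k t) @[k --> F] --> l]
    (ex_intro _ l xl)).
exists gam, q => t t0L.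
have tL' : 0 <= t < L by case/andP: t0L => /ltW-> ->.
have [Mg xg] := gamP _ tL'; have pq := qP _ tL'.
have Ng : 0 < N (gam t) by case/andP: (NE Mg) => h _; exact: lt_le_trans h.
have nearx := @limit_near x (fun k l => p k l.+1) xS F FU Foo gam
  (fun t h => (gamP t h).2) t P0 t0L P00 (fun k l => @pP k l.+1).
have nearp := @limit_near p (fun k l => G (x k l)) pS F FU Foo q qP t G0
  t0L G00 (fun k l lm => GE (Mx (ltnW lm))).
(* [limit_derive] compares r with N(x) times the limiting rate Q / N(gam t); continuity of N at
   [gam t] absorbs the quotient of the two values of N. *)
have near_rate (r : nat -> nat -> V) (Q : V) :
    (forall z, 0 < z -> exists2 h, 0 < h & \forall k \near F,
      forall l, (l < m k)%N -> `|T k l - t| < h -> `|r k l - Q| < z) ->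
    forall e, 0 < e -> exists2 h, 0 < h & \forall k \near F,
      forall l, (l < m k)%N -> `|T k l - t| < h ->
      `|r k l - N (x k l) *: ((N (gam t))^-1 *: Q)| <= e.
  move=> Hr e e0.
  have [h1 h10 H1] := Hr _ (divr_gt0 e0 (ltr0n _ 2)).
  pose z := e / 2 / (`|Q| + 1) * N (gam t).
  have z0 : 0 < z by rewrite /z mulr_gt0// divr_gt0 ?divr_gt0// ltr_wpDl.
  move/cvgrPdist_lt : (cN Mg) => /(_ _ z0) /nbhs_ballP[w /= w0 Hw].
  have [h2 h20 H2] := nearx _ w0.
  exists (Num.min h1 h2); first by rewrite lt_min h10.
  near=> k => l lm; rewrite lt_min => /andP[t1 t2].
  have a1 : `|r k l - Q| < e / 2.
    by move: l lm t1 {t2}; near: k; exact: H1.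
  have a2 : `|x k l - gam t| < w.
    by move: t2; apply: (near (H2) k) => //; exact: ltnW.
  have a3 : `|N (gam t) - N (x k l)| < z.
    by apply: Hw; rewrite -ball_normE /ball_/= distrC.
  have -> : r k l - N (x k l) *: ((N (gam t))^-1 *: Q) = (r k l - Q) +
      ((N (gam t) - N (x k l)) / N (gam t)) *: Q.
    apply/rowP => j; rewrite !mxE; field; exact: lt0r_neq0.
  rewrite (le_trans (ler_normD _ _))// (splitr e) lerD// ?(ltW a1)//.
  rewrite normrZ normrM normfV (gtr0_norm Ng).
  rewrite (@le_trans _ _ (z / N (gam t) * `|Q|))//.
    by rewrite ler_wpM2r// ler_pM2r ?invr_gt0// ltW.
  rewrite /z mulfK ?gt_eqF// -mulrA ler_piMr ?divr_ge0 ?(ltW e0)//.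
  by rewrite mulrC ler_pdivrMr ?mul1r ?lerDl// ltr_wpDl.
split; first exact: Mg.
- apply/eqP; rewrite -subr_eq0 -normr_le0; apply/ler_addgt0Pr => z z0.
  rewrite add0r.
  have z3 : 0 < z / 3 by exact: divr_gt0.
  have c1 : \forall k \near F, `|E (q t) - E (p k (idx k t))| < z / 3.
    by move/cvgrPdist_lt : (cvg_comp _ _ pq (cE (q t))); exact.
  have c2 : \forall k \near F, `|N (gam t) - N (x k (idx k t))| < z / 3.
    by move/cvgrPdist_lt : (cvg_comp _ _ xg (cN Mg)); exact.
  have c3 : \forall k \near F, del k < z / 3.
    apply: Foo; move/cvgrPdist_lt : del0 => /(_ _ z3); apply: filterS => k.
    rewrite sub0r normrN; apply: le_lt_trans; exact: ler_norm.
  near F => k.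
  have b1 : `|E (q t) - E (p k (idx k t))| < z / 3 by near: k.
  have b2 : `|N (gam t) - N (x k (idx k t))| < z / 3 by near: k.
  have b3 : del k < z / 3 by near: k.
  have [im _] := idxP k tL'; have b4 := HE k (idx k t) (ltnW im).
  move: b1 b2 b4; rewrite !ltr_norml !ler_norml.
  by move=> /andP[? ?] /andP[? ?] /andP[? ?]; apply/andP; split; lra.
- apply: (@limit_derive x (fun k l => p k l.+1) xS F FU Foo gam
    (fun t h => (gamP t h).2) t _ t0L).
  apply: near_rate => z z0.
  have [h h0 Hh] := nearp _ z0.
  have h2 : 0 < h / 2 by exact: divr_gt0.
  have N1_gt0 : 0 < N1.
    have /andP[? h4] := NE Mg; exact: lt_le_trans h4.
  (* The position update uses the momentum after the kick, at index l + 1, whose length exceeds that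
     of l by at most eps N1 < h / 2. *)
  exists (h / 2) => //; near=> k => l lm Tl.
  have e1 : eps k * N1 < h / 2.
    rewrite -ltr_pdivlMr//; near: k; apply: Foo.
    move/cvgrPdist_lt : eps0 => /(_ _ (divr_gt0 h2 N1_gt0)).
    apply: filterS => k; rewrite sub0r normrN; apply: le_lt_trans.
    exact: ler_norm.
  apply: (near Hh k) => //.
  have /andP[u1 u2] := T_step lm.
  by move: Tl; rewrite !ltr_norml => /andP[? ?]; apply/andP; split; lra.
- apply: (@limit_derive p (fun k l => G (x k l)) pS F FU Foo q qP t _ t0L).
  apply: near_rate => z z0.
  move/cvgrPdist_lt : (cG Mg) => /(_ _ z0) /nbhs_ballP[w /= w0 Hw].
  have [h h0 Hh] := nearx _ w0.
  exists h => //; apply: filterS Hh => k Hh l lm Tl.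
  rewrite distrC; apply: Hw; rewrite -ball_normE /ball_/= distrC.
  by apply: Hh => //; exact: ltnW.
Unshelve. all: by end_near. Qed.

End limit_curve.

(** * Finitely differentiable fields *)

Section calculus.
Context {R : realType}.

Lemma near_eq_differentiable (V W : normedModType R) (f g : V -> W) x :
  (\near x, f x = g x) -> differentiable f x -> differentiable g x.
Proof.
move=> fg df.
have fgx : f x = g x := nbhs_singleton fg.
have H : g \o shift x = cst (g x) + 'd f x +o_ 0 id.
  apply/eqaddoP => _/posnumP[e].
  have := diff_locally df => /eqaddoP /(_ e%:num (gt0 e)).
  have fg0 : \forall h \near (0 : V), f (h + x) = g (h + x).
    by move: fg; rewrite (near_shift 0)/= subr0.
  apply: filterS2 fg0 => h fgh.
  suff <- : (f \o shift x - (cst (f x) + 'd f x)) h =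
    (g \o shift x - (cst (g x) + 'd f x)) h by [].
  suff : f (h + x) - (f x + 'd f x h) = g (h + x) - (g x + 'd f x h) by [].
  by rewrite fgh fgx.
have Hd := diff_unique (diff_continuous df) H.
by apply/diff_locallyP; rewrite Hd; split => //; exact: diff_continuous.
Qed.

Lemma derive_partial n (f : 'rV[R]_n -> R) (x v : 'rV[R]_n) :
  differentiable f x -> 'D_v f x = \sum_j v 0 j * partial j f x.
Proof.
move=> df; rewrite deriveE// {1}(row_sum_delta v) linear_sum/=.
apply: eq_bigr => j _; rewrite linearZ/= /partial deriveE//.
Qed.

Lemma is_derive_comp_curve n (f : 'rV[R]_n -> R) (gam : R -> 'rV[R]_n) (t : R) (d : 'rV[R]_n) :
  differentiable f (gam t) -> is_derive t 1 gam d ->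
  is_derive t 1 (f \o gam) (\sum_j d 0 j * partial j f (gam t)).
Proof.
move=> df [dgam dE].
have dg : differentiable gam t by exact/derivable1_diffP.
have dfg : differentiable (f \o gam) t by exact: differentiable_comp.
apply: DeriveDef; first exact: diff_derivable.
rewrite -derive_partial// !deriveE// diff_comp//=; congr ('d f _ _).
by rewrite -deriveE.
Qed.

Lemma is_derive_coord n (gam : R -> 'rV[R]_n) (t : R) (d : 'rV[R]_n) j :
  is_derive t 1 gam d -> is_derive t 1 (fun s => gam s 0 j) (d 0 j).
Proof.
move=> [dgam dE]; have /derivable_mxP/(_ 0 j) H := dgam.
by apply: DeriveDef => //; rewrite -dE derive_mx// mxE.
Qed.

Lemma is_derive_row n (gam : R -> 'rV[R]_n) (t : R) (d : 'rV[R]_n) :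
  (forall j, is_derive t 1 (fun s => gam s 0 j) (d 0 j)) ->
  is_derive t 1 gam d.
Proof.
move=> H.
have dgam : derivable gam t 1.
  by apply/derivable_mxP => i j; rewrite (ord1 i); case: (H j).
apply: DeriveDef => //; rewrite derive_mx//.
by apply/rowP => j; rewrite mxE; case: (H j).
Qed.

End calculus.

Section smooth_class.
Context {R : realType} {n : nat}.
Local Notation V := 'rV[R]_n.
Implicit Types (U : set V) (f g : V -> R).

(** All partial derivatives up to order k are differentiable, hence continuous; [Cdiff 0] already
    means differentiable. A finite order permits induction for products and inverses and records how
    many derivatives a step consumes. *)
Fixpoint Cdiff (k : nat) U f : Prop :=
  (forall x, U x -> differentiable f x) /\
  if k is k'.+1 then forall j, Cdiff k' U (partial j f) else True.

Lemma Cdiff_differentiable k U f x : Cdiff k U f -> U x -> differentiable f x.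
Proof. by case: k => [|k] [H _]; exact: H. Qed.

Lemma Cdiff_partial k U f j : Cdiff k.+1 U f -> Cdiff k U (partial j f).
Proof. by move=> [_ H]; exact: H. Qed.

Lemma CdiffW k U f : Cdiff k.+1 U f -> Cdiff k U f.
Proof.
elim: k f => [f []//|k IH f [H1 H2]]; split=> // j.
exact/IH/H2.
Qed.

Lemma Cdiff_le k l U f : (k <= l)%N -> Cdiff l U f -> Cdiff k U f.
Proof.
elim: l => [|l IH]; first by rewrite leqn0 => /eqP->.
by rewrite leq_eqVlt => /orP[/eqP->//|kl] /CdiffW; exact: IH.
Qed.

Lemma CdiffS k U U' f : U' `<=` U -> Cdiff k U f -> Cdiff k U' f.
Proof.
move=> UU; elim: k f => [f [H _]|k IH f [H1 H2]]; split => //.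
- by move=> x /UU; exact: H.
- by move=> x /UU; exact: H1.
- by move=> j; exact: (IH _ (H2 j)).
Qed.

Lemma open_near_eq U f g x : open U -> (forall y, U y -> f y = g y) -> U x ->
  \near x, f x = g x.
Proof.
by move=> oU fg Ux; apply: filterS fg _; exact: open_nbhs_nbhs.
Qed.

Lemma partial_eq U f g x j : open U -> (forall y, U y -> f y = g y) -> U x ->
  partial j f x = partial j g x.
Proof. by move=> oU fg Ux; apply: near_eq_derive; exact: open_near_eq Ux. Qed.

Lemma Cdiff_eq k U f g : open U -> (forall x, U x -> f x = g x) ->
  Cdiff k U f -> Cdiff k U g.
Proof.
move=> oU; elim: k f g => [|k IH] f g fg [H1 H2]; split => //.
- move=> x Ux; apply: near_eq_differentiable (H1 _ Ux).
  exact: open_near_eq Ux.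
- move=> x Ux; apply: near_eq_differentiable (H1 _ Ux).
  exact: open_near_eq Ux.
- by move=> j; apply: IH (H2 j) => x Ux; exact: partial_eq Ux.
Qed.

Lemma partialD f g x j : differentiable f x -> differentiable g x ->
  partial j (fun y => f y + g y) x = partial j f x + partial j g x.
Proof. by move=> df dg; rewrite /partial deriveD//; exact: diff_derivable. Qed.

Lemma partialN f x j : differentiable f x ->
  partial j (fun y => - f y) x = - partial j f x.
Proof. by move=> df; rewrite /partial deriveN//; exact: diff_derivable. Qed.

Lemma partialM f g x j : differentiable f x -> differentiable g x ->
  partial j (fun y => f y * g y) x = f x * partial j g x + g x * partial j f x.
Proof. by move=> df dg; rewrite /partial deriveM//; exact: diff_derivable. Qed.

Lemma partialV f x j : f x != 0 -> differentiable f x ->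
  partial j (fun y => (f y)^-1) x = - (f x) ^- 2 * partial j f x.
Proof. by move=> f0 df; rewrite /partial deriveV//; exact: diff_derivable. Qed.

Lemma partial_cst (a : R) (x : V) j : partial j (fun _ => a) x = 0.
Proof. exact: derive_cst. Qed.

Lemma Cdiff_cst k U (a : R) : Cdiff k U (fun _ => a).
Proof.
elim: k a => [|k IH] a; (split; first by move=> x _; exact: differentiable_cst).
  by [].
by move=> j; rewrite (_ : partial j _ = fun=> 0)//; apply/funext => x;
  rewrite partial_cst.
Qed.

Lemma CdiffD k U f g : open U -> Cdiff k U f -> Cdiff k U g ->
  Cdiff k U (fun x => f x + g x).
Proof.
move=> oU; elim: k f g => [|k IH] f g Hf Hg; split => //.
- by move=> x Ux; exact: differentiableD (Cdiff_differentiable Hf Ux) (Cdiff_differentiable Hg Ux).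
- by move=> x Ux; exact: differentiableD (Cdiff_differentiable Hf Ux) (Cdiff_differentiable Hg Ux).
- move=> j; apply: Cdiff_eq (IH _ _ (Hf.2 j) (Hg.2 j)) => // x Ux.
  by rewrite partialD//; [exact: Cdiff_differentiable Hf Ux|
    exact: Cdiff_differentiable Hg Ux].
Qed.

Lemma CdiffM k U f g : open U -> Cdiff k U f -> Cdiff k U g ->
  Cdiff k U (fun x => f x * g x).
Proof.
move=> oU; elim: k f g => [|k IH] f g Hf Hg; split => //.
- by move=> x Ux; exact: differentiableM (Cdiff_differentiable Hf Ux) (Cdiff_differentiable Hg Ux).
- by move=> x Ux; exact: differentiableM (Cdiff_differentiable Hf Ux) (Cdiff_differentiable Hg Ux).
- move=> j; apply: (@Cdiff_eq _ _
    (fun x => f x * partial j g x + g x * partial j f x)) => // [x Ux|].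
    by rewrite partialM//; [exact: Cdiff_differentiable Hf Ux|
    exact: Cdiff_differentiable Hg Ux].
  apply: CdiffD => //.
    exact: IH (CdiffW Hf) (Hg.2 j).
  exact: IH (CdiffW Hg) (Hf.2 j).
Qed.

Lemma CdiffN k U f : open U -> Cdiff k U f -> Cdiff k U (fun x => - f x).
Proof.
move=> oU Hf; have := CdiffM oU (Cdiff_cst k U (-1)) Hf.
by apply: Cdiff_eq => // x _; rewrite mulN1r.
Qed.

Lemma CdiffB k U f g : open U -> Cdiff k U f -> Cdiff k U g ->
  Cdiff k U (fun x => f x - g x).
Proof. by move=> oU Hf Hg; apply: CdiffD => //; exact: CdiffN. Qed.

Lemma CdiffV k U f : open U -> (forall x, U x -> f x != 0) -> Cdiff k U f ->
  Cdiff k U (fun x => (f x)^-1).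
Proof.
move=> oU f0; elim: k => [|k IH] Hf; split => //.
- by move=> x Ux; apply: differentiableV; [exact: Cdiff_differentiable Hf Ux|exact: f0].
- by move=> x Ux; apply: differentiableV; [exact: Cdiff_differentiable Hf Ux|exact: f0].
- move=> j; have HV := IH (CdiffW Hf).
  apply: (@Cdiff_eq _ _
    (fun x => - ((f x)^-1 * (f x)^-1 * partial j f x))) => // [x Ux|].
    rewrite partialV ?f0//; last exact: Cdiff_differentiable Hf Ux.
    by rewrite -exprVn expr2 mulNr.
  by apply: CdiffN => //; apply: CdiffM (Hf.2 j) => //; exact: CdiffM.
Qed.

Lemma Cdiff_sum k U (I : finType) (F : I -> V -> R) : open U ->
  (forall i, Cdiff k U (F i)) -> Cdiff k U (fun x => \sum_i F i x).
Proof.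
move=> oU HF; elim: (index_enum I) => [|i s IH].
  by apply: Cdiff_eq (Cdiff_cst k U 0) => // x _; rewrite big_nil.
by apply: Cdiff_eq (CdiffD oU (HF i) IH) => // x _; rewrite big_cons.
Qed.

Lemma smooth_Cdiff (A : set V) f : smooth_on A f ->
  exists U, [/\ open U, A `<=` U & forall k, Cdiff k U f].
Proof.
move=> [U [oU AU] H]; exists U; split=> // k.
suff : forall s, Cdiff k U (foldr (@partial R n) f s) by move=> /(_ [::]).
elim: k => [|k IH] s; (split; first exact: H) => // j.
exact: (IH (j :: s)).
Qed.

Lemma Cdiff_continuous k U f x : Cdiff k U f -> U x -> {for x, continuous f}.
Proof.
move=> Hf Ux; apply: differentiable_continuous.
exact: Cdiff_differentiable Hf Ux.
Qed.

End smooth_class.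

(** * Geodesics of conformally Euclidean metrics *)

Section conformal.
Context {R : realType} {n : nat}.
Local Notation V := 'rV[R]_n.
Variables (U : set V) (N : V -> R) (h : V -> 'M[R]_n).
Hypothesis oU : open U.
Hypothesis hE : forall x, U x -> h x = N x *: 1%:M.
Hypothesis dN : forall x, U x -> differentiable N x.

Lemma partial_conformal x (i j k : 'I_n) : U x ->
  partial i (fun y => h y j k) x = (j == k)%:R * partial i N x.
Proof.
move=> Ux; rewrite (@partial_eq _ _ U _ (fun y => N y * (j == k)%:R))//.
  rewrite partialM ?partial_cst ?mulr0 ?add0r//; first exact: dN.
move=> y Uy; by rewrite hE// !mxE.
Qed.

Lemma hinv_conformal x (j k : 'I_n) : U x ->
  hinv h x j k = (j == k)%:R * (N x)^-1.
Proof.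
move=> Ux; rewrite /hinv hE// scalemx1 invmx_scalar mulr_natl. by rewrite mxE.
Qed.

Lemma christoffel_conformal x (l j k : 'I_n) : U x ->
  christoffel h x l j k = (2 * N x)^-1 *
    ((l == k)%:R * partial j N x + (l == j)%:R * partial k N x -
     (j == k)%:R * partial l N x).
Proof.
move=> Ux; rewrite /christoffel (bigD1 l)//= big1 ?addr0; last first.
  by move=> m ml; rewrite hinv_conformal// eq_sym (negbTE ml) !mul0r.
rewrite hinv_conformal// eqxx mul1r !partial_conformal// invfM -mulrA.
by rewrite mulrA.
Qed.

End conformal.

(** The equations x' = q, q' = grad N / 2 divided by the length element N. In the geodesic equation
    for w = q / N the terms along w cancel, and unit speed turns the remaining Christoffel term
    |w|^2 grad N / (2 N) into grad N / (2 N^2), the acceleration due to the force. *)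
Lemma geodesic_conformal (R : realType) (M U : set 'rV[R]_3) (N : 'rV[R]_3 -> R)
    (h : 'rV[R]_3 -> 'M[R]_3) (s t : R)
    (gam q : R -> 'rV[R]_3) : open U -> M `<=` U ->
  (forall x, U x -> h x = N x *: 1%:M) ->
  (forall x, U x -> differentiable N x) -> (forall x, M x -> 0 < N x) ->
  (forall r, s <= r <= t -> \forall r' \near r,
    [/\ M (gam r'), \sum_j q r' 0 j ^+ 2 = N (gam r'),
        is_derive r' 1 gam ((N (gam r'))^-1 *: q r') &
        is_derive r' 1 q ((N (gam r'))^-1 *: (2^-1 *: grad N (gam r')))]) ->
  is_geodesic M h s t gam.
Proof.
move=> oU MU hE dN N0 H r rst.
have Hr := H r rst; have [Mg qN dg dq] := nbhs_singleton Hr.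
have Ng0 := N0 _ Mg; have Ug := MU _ Mg.
pose w (r' : R) : 'rV[R]_3 := (N (gam r'))^-1 *: q r'.
have gw : \forall r' \near r, w r' = (gam^`())%classic r'.
  by apply: filterS Hr => r' [_ _ []]; rewrite derive1E.
have dw : is_derive r 1 w (\row_k (- (N (gam r))^-1 *
    (\sum_j w r 0 j * partial j N (gam r)) * w r 0 k +
    (N (gam r))^-1 ^+ 2 * 2^-1 * partial k N (gam r))).
  apply: is_derive_row => k; rewrite mxE.
  have dNg := is_derive_comp_curve (dN _ Ug) dg.
  have dNV : is_derive r 1 (fun s => (N (gam s))^-1)
      (- (N (gam r)) ^- 2 * \sum_j w r 0 j * partial j N (gam r)).
    apply: DeriveDef.
      by apply: derivableV; [rewrite gt_eqF|case: dNg].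
    rewrite deriveV; first by case: dNg => _ <-.
      by rewrite gt_eqF.
    by case: dNg.
  have := is_deriveM dNV (is_derive_coord k dq).
  have -> : (fun s => w s 0 k) = (fun s => (N (gam s))^-1) * (fun s => q s 0 k).
    by apply/funext => s'; rewrite /w mxE.
  move=> /is_derive_eq; apply; rewrite /w !mxE /GRing.scale/=.
  by set S := \sum_j _; field; rewrite gt_eqF.
have dgw := near_eq_is_derive gw dw.
split=> //.
- by apply: filterS Hr => r' [_ _ []].
move=> k; rewrite (derive1E (gam^`())%classic); case: dgw => _ ->.
rewrite -!(nbhs_singleton gw).
rewrite !sum_ord3 !(christoffel_conformal oU hE dN)//.
have qw j : q r 0 j = N (gam r) * w r 0 j.
  by rewrite mxE mulrA divff ?mul1r// gt_eqF.
move: qN; rewrite !sum_ord3 !qw.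
set a := w r 0 0; set b := w r 0 1; set c := w r 0 2%:R.
rewrite [X in _ -> X + _ = _]mxE; set A := N (gam r) => qN.
(* Unit speed, N |w|^2 = 1, in the form that eliminates the inverse of N from the geodesic
   equation. *)
have Ai : A^-1 = a ^+ 2 + b ^+ 2 + c ^+ 2.
  apply: (mulfI (lt0r_neq0 Ng0)); rewrite -/A divff ?gt_eqF//.
  apply: (mulfI (lt0r_neq0 Ng0)); rewrite -/A mulr1 -{1}qN; ring.
rewrite !invfM Ai.
move: (partial 0 N _) (partial 1 N _) (partial 2%:R N _) => d0 d1 d2.
by move: k; elim/ord3_ind => /=; rewrite -/a -/b -/c; clearbody a b c; field.
Qed.

Section compact_bounds.
Context {R : realType} {n : nat}.
Local Notation V := 'rV[R]_n.
Variables (M : set V) (f : V -> R).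
Hypothesis cM : compact M.
Hypothesis cf : forall x, M x -> {for x, continuous f}.

Let wcf : {within M, continuous f}.
Proof. by apply: continuous_in_subspaceT => x /[!inE]; exact: cf. Qed.

Lemma compact_upper_bound : exists B, forall x, M x -> f x <= B.
Proof.
have [->|/set0P M0] := eqVneq M set0; first by exists 0.
have [c _ Hc] := EVT_max_rV M0 cM wcf; exists (f c) => x Mx.
by apply: Hc; rewrite inE.
Qed.

Lemma compact_pos_lower_bound : (forall x, M x -> 0 < f x) ->
  exists2 B, 0 < B & forall x, M x -> B <= f x.
Proof.
move=> f0; have [->|/set0P M0] := eqVneq M set0; first by exists 1.
have [c Mc Hc] := EVT_min_rV M0 cM wcf; rewrite inE in Mc.
by exists (f c) => [|x Mx]; [exact: f0|apply: Hc; rewrite inE].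
Qed.

End compact_bounds.

Lemma compact_norm_bound (R : realType) (n m : nat) (M : set 'rV[R]_n)
    (g : 'rV[R]_n -> 'rV[R]_m) : compact M ->
  (forall x, M x -> {for x, continuous g}) ->
  exists B, forall x, M x -> `|g x| <= B.
Proof.
move=> cM cg; apply: (compact_upper_bound (f := fun x => `|g x|)) => // x Mx.
by apply: continuous_comp; [exact: cg|exact: norm_continuous].
Qed.

Lemma continuous_row (R : realType) (n m : nat) (g : 'rV[R]_n -> 'rV[R]_m)
    (x : 'rV[R]_n) :
  (forall j, {for x, continuous (fun y => g y 0 j)}) -> {for x, continuous g}.
Proof.
move=> H; apply: (cvgrPdist_lt (FF := nbhs_filter x) _ _).2 => e e0.
have : \forall y \near x, forall j, `|g x 0 j - g y 0 j| < e.
  apply: (@filter_forall _ _ (fun j y => `|g x 0 j - g y 0 j| < e) _ (nbhs_filter x)) => j.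
  by move/cvgrPdist_lt : (H j); exact.
apply: filterS => y Hy; apply: norm_lt_coord => // j.
by rewrite !mxE.
Qed.

Lemma normr_sum_sqr (R : realType) n (p : 'rV[R]_n) :
  `|p| ^+ 2 <= \sum_j p 0 j ^+ 2.
Proof.
rewrite -ler_sqrt ?sqr_ge0 ?sumr_ge0// => [|i _]; last exact: sqr_ge0.
rewrite sqrtr_sqr normr_id; apply: norm_le_coord; first exact: sqrtr_ge0.
move=> j; rewrite -sqrtr_sqr ler_wsqrtr// (bigD1 j)//= lerDl.
by apply: sumr_ge0 => i _; exact: sqr_ge0.
Qed.

(** * Length covered by discrete trajectories before exit *)

Section exit_bound.
Context {R : realType}.
Local Notation V := 'rV[R]_3.
Variables (M U : set V) (N : V -> R) (h : V -> 'M[R]_3) (D : R).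
Hypothesis cM : compact M.
Hypothesis oU : open U.
Hypothesis MU : M `<=` U.
Hypothesis hE : forall x, U x -> h x = N x *: 1%:M.
Hypothesis sN : Cdiff 1 U N.
Hypothesis N0 : forall x, M x -> 0 < N x.
Hypothesis hD : is_diameter M h D.

Let dN x : U x -> differentiable N x.
Proof. exact: Cdiff_differentiable sN. Qed.

Lemma diameter_ge0 : 0 <= D.
Proof.
have [[s [t [gam [_ _ ->]]]] _] := hD.
by apply: Rintegral_ge0 => x _; exact: sqrtr_ge0.
Qed.

Lemma geodesic_length_le (s t : R) (gam q : R -> V) : s <= t ->
  (forall r, s <= r <= t -> \forall r' \near r,
    [/\ M (gam r'), \sum_j q r' 0 j ^+ 2 = N (gam r'),
        is_derive r' 1 gam ((N (gam r'))^-1 *: q r') &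
        is_derive r' 1 q ((N (gam r'))^-1 *: (2^-1 *: grad N (gam r')))]) ->
  t - s <= D.
Proof.
move=> st H; apply: hD.2; exists s, t, gam; split => //.
  exact: (geodesic_conformal oU MU hE dN N0 H).
rewrite /curve_length -[LHS]mul1r.
transitivity (\int[lebesgue_measure]_(r in `[s, t]) (1 : R)).
  rewrite Rintegral_cst//= lebesgue_measure_itv/= lte_fin.
  move: st; rewrite le_eqVlt => /predU1P[<-|->].
    by rewrite ltxx subrr mul1r.
  by rewrite -EFinB mul1r.
apply: eq_Rintegral => r; rewrite inE/= in_itv/= => /H /nbhs_singleton.
move=> [Mg qN dg _]; have Ng0 := N0 Mg.
rewrite derive1E; case: dg => _ ->.
rewrite /norm_vector /inner_vector hE; last exact: MU.
rewrite (_ : \sum_j _ = 1) ?sqrtr1//.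
transitivity (\sum_j (N (gam r))^-1 * q r 0 j ^+ 2).
  apply: eq_bigr => j _; rewrite (bigD1 j)//= big1 ?addr0; last first.
    by move=> k kj; rewrite !mxE eq_sym (negbTE kj) mulr0 !mul0r.
  by rewrite !mxE eqxx mulr1n; field; rewrite gt_eqF.
by rewrite -mulr_sumr qN mulVf// gt_eqF.
Qed.

Lemma exit_bound L : D < L -> exists2 d, 0 < d & forall e (m : nat)
    (x p : nat -> V), 0 < e < d ->
  (forall i, (i <= m)%N -> M (x i)) ->
  (forall i, (i <= m)%N -> `|\sum_j p i 0 j ^+ 2 - N (x i)| <= d) ->
  (forall i, (i < m)%N -> p i.+1 = p i + e *: (2^-1 *: grad N (x i))) ->
  (forall i, (i < m)%N -> x i.+1 = x i + e *: p i.+1) ->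
  \sum_(i < m) e * N (x i) <= L.
Proof.
(* If no d works, then d = 1 / (k + 1) yields for each k a trajectory longer than L whose step and
   energy error are at most 1 / (k + 1); these are the data of [limit_curve]. *)
move=> DL; apply: contrapT => Hn.
have Hcontra d d0 Hd := Hn (ex_intro2 _ _ d d0 Hd).
have cN x : M x -> {for x, continuous N}.
  by move=> Mx; exact: (Cdiff_continuous sN (MU Mx)).
pose G x : V := 2^-1 *: grad N x.
have cG x : M x -> {for x, continuous G}.
  move=> /MU Ux; apply: continuous_row => j.
  rewrite /G (_ : (fun y => _) = (fun y => 2^-1 * partial j N y)); last first.
    by apply/funext => y; rewrite !mxE.
  exact: (Cdiff_continuous
    (CdiffM oU (Cdiff_cst 0 U 2^-1) (Cdiff_partial j sN)) Ux).
have [B0 B00 HB0] := compact_pos_lower_bound cM cN N0.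
have [B1 HB1] := compact_upper_bound cM cN.
have [G0 HG0] := compact_norm_bound cM cG.
have ex k : exists w : R * nat * (nat -> V) * (nat -> V),
  let: (e, m, x, p) := w in
  [/\ 0 < e < k.+1%:R^-1, forall i, (i <= m)%N -> M (x i),
    forall i, (i <= m)%N -> `|\sum_j p i 0 j ^+ 2 - N (x i)| <= k.+1%:R^-1,
    forall i, (i < m)%N -> p i.+1 = p i + e *: G (x i) /\
       x i.+1 = x i + e *: p i.+1 &
    L < \sum_(i < m) e * N (x i)].
  apply: contrapT => Hk; apply: (Hcontra k.+1%:R^-1); first by rewrite /= invr_gt0.
  move=> e m x p h1 h2 h3 h4 h5; rewrite leNgt; apply/negP => h6; apply: Hk.
  by exists (e, m, x, p); split => // i im; split; [exact: h4|exact: h5].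
have [w Hw] := choice ex.
pose eps k := (w k).1.1.1; pose m k := (w k).1.1.2.
pose x k := (w k).1.2; pose p k := (w k).2.
have {}Hw k : [/\ 0 < eps k < k.+1%:R^-1, forall i, (i <= m k)%N -> M (x k i),
    forall i, (i <= m k)%N ->
      `|\sum_j p k i 0 j ^+ 2 - N (x k i)| <= k.+1%:R^-1,
    forall i, (i < m k)%N -> p k i.+1 = p k i + eps k *: G (x k i) /\
       x k i.+1 = x k i + eps k *: p k i.+1 &
    L < \sum_(i < m k) eps k * N (x k i)].
  by move: (Hw k); rewrite /eps /m /x /p; case: (w k) => [[[]]].
have L0 : 0 < L by exact: le_lt_trans diameter_ge0 DL.
pose del k : R := k.+1%:R^-1.
have del0 : del @ \oo --> 0 by exact: cvg_harmonic.
have eps_gt0 k : 0 < eps k by have [/andP[]] := Hw k.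
have eps0 : eps @ \oo --> 0.
  apply: (squeeze_cvgr _ (cvg_cst 0) del0); apply: nearW => k.
  by have [/andP[h1 h2] _ _ _ _] := Hw k; rewrite !ltW.
(* In the maximum norm |p|^2 <= N + 1 <= B1 + 1, which is less than (B1 + 2)^2. *)
have P0E k i : (i <= m k)%N -> `|p k i| <= B1 + 2.
  move=> im; have [_ /(_ _ im) Mx /(_ _ im) Hp _ _] := Hw k.
  have := HB1 _ Mx; have := N0 Mx; have := normr_sum_sqr (p k i).
  have : k.+1%:R^-1 <= 1 :> R by rewrite invf_le1// ler1n.
  move: Hp; rewrite ler_norml => /andP[_].
  set u := `|p k i|; set S := \sum_j _; set y := N _ => h1 h2 h3 h4 h5.
  rewrite leNgt; apply/negP => h6.
  have : (B1 + 2) * (B1 + 2) <= u * u by rewrite ler_pM// ?ltW//; lra.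
  have : 0 <= B1 * B1 by rewrite mulr_ge0//; lra.
  move: h1 h2 h3; rewrite expr2 mulrDl !mulrDr; set z := _^-1; lra.
have cE : continuous (fun p : V => \sum_j p 0 j ^+ 2).
  move=> v; apply: (@Cdiff_continuous _ _ 0 setT) => //.
  have Hc j : Cdiff 0 setT (fun z : V => z 0 j).
    by split=> // z _; exact: differentiable_coord.
  apply: Cdiff_sum; first exact: openT.
  by move=> j; have := CdiffM openT (Hc j) (Hc j).
have [gam [q Hgam]] := @limit_curve R 3 M N G (B1 + 2) G0 B0 B1 L eps del m x p
  cM cN cG B00 (fun y My => introT andP (conj (HB0 y My) (HB1 y My))) HG0
  eps_gt0 eps0 (fun k => let: And5 _ h _ _ _ := Hw k in h) P0E
  (fun k i im => let: And5 _ _ _ h _ := Hw k in (h i im).1)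
  (fun k i im => let: And5 _ _ _ h _ := Hw k in (h i im).2)
  (fun k => let: And5 _ _ _ _ h := Hw k in h)
  (fun p => \sum_j p 0 j ^+ 2) cE del0
  (fun k => let: And5 _ _ h _ _ := Hw k in h).
have D0 := diameter_ge0.
(* The limit equations hold on the open interval []0, L[] only. Trimming (L - D) / 4 at both ends
   leaves length (L + D) / 2, still more than D. *)
have : (L - (L - D) / 4) - (L - D) / 4 <= D.
  apply: (@geodesic_length_le _ _ gam q); first lra.
  move=> r /andP[r1 r2].
  have : \forall r' \near r, 0 < r' < L.
    have r0 : 0 < r by lra. 
    have rL : r < L by lra.
    by near=> r'; apply/andP; split; near: r'; [exact: lt_nbhsr|exact: lt_nbhsl].
  by apply: filterS => r' r'L; apply: Hgam.
lra.
Unshelve. all: by end_near. Qed.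

End exit_bound.

(** * The discrete Poincare inequality *)

(** Inversion is continuous off 0, and its conventional value at 0 concerns a single point. *)
Lemma measurable_inv (R : realType) : measurable_fun [set: R] (@GRing.inv R).
Proof.
have -> : [set: R] = [set~ 0] `|` [set 0] by rewrite setUC setUv.
apply/measurable_funU; [exact: measurableC|by []|split].
  apply: open_continuous_measurable_fun.
    by apply: closed_openC; exact: closed_eq.
  by move=> x; rewrite inE /= => /eqP; exact: inv_continuous.
exact: measurable_fun_set1.
Qed.

Lemma measurable_funV d (T : measurableType d) (R : realType) (f : T -> R) :
  measurable_fun [set: T] f -> measurable_fun [set: T] (fun x => (f x)^-1).
Proof. by move=> mf; apply: measurableT_comp => //; exact: measurable_inv. Qed.

Section real_integrands.
Context d (T : measurableType d) (R : realType).
Variables (mu : {measure set T -> \bar R}) (A : set T).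
Hypothesis mA : measurable A.
Implicit Types f g : T -> R.

Lemma measurable_fun_EFin f : measurable_fun [set: T] f ->
  measurable_fun A (fun x => (f x)%:E).
Proof. by move=> mf; apply/measurable_EFinP; exact: measurable_funTS. Qed.

Lemma EFin_integral_ge0 f : (forall x, A x -> 0 <= f x) ->
  (0 <= \int[mu]_(x in A) (f x)%:E)%E.
Proof. by move=> f0; apply: integral_ge0 => x /f0; rewrite lee_fin. Qed.

Lemma EFin_integralD f g :
  measurable_fun [set: T] f -> measurable_fun [set: T] g ->
  (forall x, A x -> 0 <= f x) -> (forall x, A x -> 0 <= g x) ->
  (\int[mu]_(x in A) (f x + g x)%:E =
   \int[mu]_(x in A) (f x)%:E + \int[mu]_(x in A) (g x)%:E)%E.
Proof.
move=> mf mg f0 g0; under eq_integral do rewrite EFinD.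
apply: ge0_integralD => //.
- exact: measurable_fun_EFin.
- exact: measurable_fun_EFin.
Qed.

Lemma EFin_integralZl f (k : R) : measurable_fun [set: T] f ->
  (forall x, A x -> 0 <= f x) -> 0 <= k ->
  (\int[mu]_(x in A) (k * f x)%:E = k%:E * \int[mu]_(x in A) (f x)%:E)%E.
Proof.
move=> mf f0 k0; under eq_integral do rewrite EFinM.
apply: ge0_integralZl_EFin => //; exact: measurable_fun_EFin.
Qed.

Lemma EFin_le_integral f g :
  measurable_fun [set: T] f -> measurable_fun [set: T] g ->
  (forall x, A x -> 0 <= f x) -> (forall x, A x -> f x <= g x) ->
  (\int[mu]_(x in A) (f x)%:E <= \int[mu]_(x in A) (g x)%:E)%E.
Proof.
move=> mf mg f0 fg; apply: ge0_le_integral => //.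
- exact: measurable_fun_EFin.
- exact: measurable_fun_EFin.
Qed.

Lemma EFin_integral_fin_num f B : (mu A < +oo)%E ->
  measurable_fun [set: T] f -> (forall x, A x -> 0 <= f x <= B) ->
  (\int[mu]_(x in A) (f x)%:E)%E \is a fin_num.
Proof.
move=> Afin mf fB.
have f0 x : A x -> 0 <= f x by move=> /fB /andP[].
rewrite ge0_fin_numE; last exact: EFin_integral_ge0.
have [/eqP A0|/set0P[x /fB /andP[fx0 /(le_trans fx0) B0]]] := boolP (A == set0).
  by rewrite A0 integral_set0.
apply: (@le_lt_trans _ _ (\int[mu]_(x in A) B%:E)%E).
  by apply: EFin_le_integral => // z /fB /andP[].
by rewrite integral_cst// lte_mul_pinfty.
Qed.

End real_integrands.

Section exit_length.
Context d (T : measurableType d) (R : realType).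
Variables (Phi : T -> T) (A : set T) (N : T -> R) (e N0 L : R).
Hypothesis mPhi : measurable_fun [set: T] Phi.
Hypothesis mA : measurable A.
Hypothesis mN : measurable_fun [set: T] N.
Hypothesis e_gt0 : 0 < e.
Hypothesis N0_gt0 : 0 < N0.
Hypothesis NE : forall z, A z -> N0 <= N z.
Hypothesis exitA : forall m z, (forall i, (i <= m)%N -> A (iter i Phi z)) ->
  \sum_(i < m.+1) e * N (iter i Phi z) <= L.

(** The length left until the orbit leaves A, with m as fuel; the recursion makes measurability a
    plain induction. *)
Fixpoint exit_length m (z : T) : R :=
  if m is m'.+1 then \1_A z * (e * N z + exit_length m' (Phi z)) else 0.

Lemma measurable_exit_length m : measurable_fun [set: T] (exit_length m).
Proof.
elim: m => [|m IH]; first exact: measurable_cst.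
apply: measurable_funM; first exact: measurable_indic.
apply: measurable_funD; first exact: measurable_funM.
exact: measurableT_comp.
Qed.

Lemma exit_lengthE m z : exists k, [/\ (k <= m)%N,
  forall i, (i < k)%N -> A (iter i Phi z),
  exit_length m z = \sum_(i < k) e * N (iter i Phi z) &
  (k < m)%N -> ~ A (iter k Phi z)].
Proof.
elim: m z => [|m IH] z; first by exists 0%N; split => //=; rewrite big_ord0.
have [Az|nAz] := pselect (A z); last first.
  exists 0%N; split=> //=; rewrite big_ord0 indicE memNset// mul0r//.
have [k [km Ak kE nk]] := IH (Phi z).
exists k.+1; split => //.
- by move=> [//|i] ik; rewrite iterSr; exact: Ak.
- rewrite /= indicE mem_set// mul1r kE big_ord_recl/=; congr (_ + _).
  by apply: eq_bigr => i _; rewrite -iterSr.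
- by rewrite ltnS => /nk; rewrite iterSr.
Qed.

Let exit_count k z : (forall i, (i < k)%N -> A (iter i Phi z)) ->
  k%:R * (e * N0) <= \sum_(i < k) e * N (iter i Phi z).
Proof.
move=> Ak; rewrite mulr_natl -[X in _ *+ X]card_ord -sumr_const.
by apply: ler_sum => i _; rewrite ler_pM2l//; apply: NE; exact: Ak.
Qed.

Hypothesis L_ge0 : 0 <= L.

Let sum_le k z : (forall i, (i < k)%N -> A (iter i Phi z)) ->
  \sum_(i < k) e * N (iter i Phi z) <= L.
Proof.
case: k => [|k] Ak; first by rewrite big_ord0.
by apply: exitA => i ik; exact: Ak.
Qed.

Lemma exit_length_bounds m z : 0 <= exit_length m z <= L.
Proof.
have [k [_ Ak -> _]] := exit_lengthE m z; rewrite sum_le// andbT.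
by rewrite (le_trans _ (exit_count Ak))// mulr_ge0// mulr_ge0// ltW.
Qed.

(** Each step inside A costs at least e N0 and the total is at most L, so no orbit stays for m steps
    once m e N0 > L. One m serves all z, and with it the remaining length drops by exactly e N z at
    a step starting in A. *)
Lemma exit_length_stable : exists m, forall z,
  exit_length m z = \1_A z * (e * N z + exit_length m (Phi z)).
Proof.
have eN0 : 0 < e * N0 by exact: mulr_gt0.
pose m := Num.bound `|L / (e * N0)|.
have mL : L < m%:R * (e * N0).
  rewrite -ltr_pdivrMr//; apply: le_lt_trans (ler_norm _) _.
  exact: (archi_boundP (normr_ge0 _)).
exists m => z; rewrite -[RHS]/(exit_length m.+1 z).
have short k : (forall i, (i < k)%N -> A (iter i Phi z)) -> (k < m)%N.
  move=> Ak; rewrite -(ltr_nat R) -(ltr_pM2r eN0).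
  by rewrite (le_lt_trans _ mL)// (le_trans (exit_count Ak))// sum_le.
have [k [_ Ak -> nk]] := exit_lengthE m z.
have [l [_ Al -> nl]] := exit_lengthE m.+1 z.
have kl : (k <= l)%N.
  by rewrite leqNgt; apply/negP => /Ak; apply: nl; rewrite ltnS ltnW// short.
have lk : (l <= k)%N.
  by rewrite leqNgt; apply/negP => /Al; apply: nk; exact: short.
by have -> : k = l by apply/eqP; rewrite eqn_leq kl.
Qed.

End exit_length.

(* Cauchy-Schwarz with the weight psi, psi(s) = s (2 L - s). *)
Lemma weighted_increment (R : realFieldType) (a b s s' k L : R) :
  0 < k -> s = s' + k -> 0 < s' -> s <= L ->
  (2 * L - 2 * s + k) * (a ^+ 2 / (s * (2 * L - s))) <=
  (b - a) ^+ 2 / k + (2 * L - 2 * s' - k) * (b ^+ 2 / (s' * (2 * L - s'))).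
Proof.
move=> k0 sE s'0 sL.
have p0 : 0 < s * (2 * L - s) by apply: mulr_gt0; lra.
have p'0 : 0 < s' * (2 * L - s') by apply: mulr_gt0; lra.
set p := s * _ in p0 *; set p' := s' * _ in p'0 *.
have pp' : p - p' = k * (2 * L - 2 * s + k) by rewrite /p /p' sE; ring.
have -> : 2 * L - 2 * s' - k = 2 * L - 2 * s + k by rewrite sE; ring.
have -> : 2 * L - 2 * s + k = (p - p') / k by rewrite pp'; field; exact: lt0r_neq0.
rewrite -subr_ge0.
have -> : (b - a) ^+ 2 / k + (p - p') / k * (b ^+ 2 / p') -
    (p - p') / k * (a ^+ 2 / p) = (p' * a - p * b) ^+ 2 / (p * p' * k).
  by field; rewrite !lt0r_neq0.
apply: divr_ge0; first exact: sqr_ge0.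
by apply: mulr_ge0; [apply: mulr_ge0|]; exact: ltW.
Qed.

Section discrete_poincare.
Context d (T : measurableType d) (R : realType).
Variable mu : {measure set T -> \bar R}.
Variables (Phi : T -> T) (A : set T) (N f : T -> R).
Variables (e N0 N1 L eta C om : R).
Hypothesis Phi_mu : scales_measure mu 1 Phi.
Hypothesis mA : measurable A.
Hypothesis Afin : (mu A < +oo)%E.
Hypothesis mN : measurable_fun [set: T] N.
Hypothesis mf : measurable_fun [set: T] f.
Hypothesis e_gt0 : 0 < e.
Hypothesis N0_gt0 : 0 < N0.
Hypothesis NE : forall z, A z -> N0 <= N z <= N1.
Hypothesis exitA : forall m z, (forall i, (i <= m)%N -> A (iter i Phi z)) ->
  \sum_(i < m.+1) e * N (iter i Phi z) <= L.
Hypothesis L_ge0 : 0 <= L.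
Hypothesis eN1 : e * N1 <= eta.
Hypothesis eta_gt0 : 0 < eta.
Hypothesis fC : forall z, `|f z| <= C.
Hypothesis fA : forall z, ~ A z -> f z = 0.
Hypothesis om_ge0 : 0 <= om.
Hypothesis Nom : forall z, A z -> A (Phi z) -> N (Phi z) <= N z + om.

Let L' := L + 2 * eta.

(** [g] is the discrete form of f^2 psi' / psi at the remaining length. [weighted_increment] bounds
    2 e N f^2 / psi plus [g] by the squared increment over e N plus [g] after the step, up to the
    variation of N during the step. Invariance of mu cancels the two integrals of [g], and psi <=
    L'^2 gives the factor 2 / L'^2. *)
Lemma discrete_poincare :
  (\int[mu]_(z in A) (2 / L' ^+ 2 * (N z * f z ^+ 2))%:E <=
   \int[mu]_(z in A) (((f (Phi z) - f z) / e) ^+ 2 / N z)%:E +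
   (om * (C ^+ 2 / (eta * L')))%:E * mu A)%E.
Proof.
have mPhi := Phi_mu.1.
have [Lge etage eN1le omge] := And4 L_ge0 eta_gt0 eN1 om_ge0.
have NE0 z : A z -> N0 <= N z by move=> /NE /andP[].
have [m lE] := exit_length_stable e_gt0 N0_gt0 NE0 exitA L_ge0.
pose l := exit_length Phi A N e m.
have l_ge0 z : 0 <= l z <= L.
  exact: (exit_length_bounds e_gt0 N0_gt0 NE0 exitA L_ge0).
have ml : measurable_fun [set: T] l by exact: measurable_exit_length.
have L'0 : 0 < L' by rewrite /L'; lra.
(* The shift by eta keeps psi away from 0 at the exit. As L' = L + 2 eta exceeds s by at least eta,
   [g] is nonnegative although e N is subtracted in it. *)
pose s z := l z + eta; pose psi z := s z * (2 * L' - s z).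
have s_gt0 z : eta <= s z <= L + eta.
  by have /andP[h1 h2] := l_ge0 z; apply/andP; split; rewrite /s; lra.
have psi_ge z : eta * L' <= psi z.
  have /andP[h1 h2] := s_gt0 z.
  by rewrite /psi ler_pM// ?(ltW eta_gt0) ?(ltW L'0)// /L'; lra.
have psi_gt0 z : 0 < psi z by apply: lt_le_trans (psi_ge z); exact: mulr_gt0.
have psi_le z : psi z <= L' ^+ 2.
  by rewrite -subr_ge0 (_ : _ - _ = (L' - s z) ^+ 2) ?sqr_ge0// /psi; ring.
have ms : measurable_fun [set: T] s by exact: measurable_funD.
have mpsi : measurable_fun [set: T] (fun z => f z ^+ 2 / psi z).
  apply: measurable_funM; first exact: measurable_funX.
  apply: measurable_funV; apply: measurable_funM => //.
  by apply: measurable_funB.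
have C0 z : f z ^+ 2 / psi z <= C ^+ 2 / (eta * L').
  rewrite ler_pM ?sqr_ge0 ?invr_ge0 ?(ltW (psi_gt0 z))//.
    by rewrite -[f z ^+ 2]real_normK ?num_real// lerXn2r ?nnegrE// (le_trans _ (fC z)).
  by rewrite lef_pV2 ?posrE ?psi_gt0 ?mulr_gt0//.
pose g z := (2 * L' - 2 * s z - e * N z) * (f z ^+ 2 / psi z).
(* After the step [weighted_increment] has e N z where [g (Phi z)] has e N (Phi z); the term with om
   covers the difference. *)
pose G z := g z + e * om * (f z ^+ 2 / psi z).
have q_ge0 z : 0 <= f z ^+ 2 / psi z by rewrite divr_ge0 ?sqr_ge0// ltW.
have g_ge0 z : 0 <= g z.
  have [Az|/fA f0] := pselect (A z); last by rewrite /g f0 expr0n !mul0r mulr0.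
  apply: mulr_ge0 => //; have /andP[_ h0] := s_gt0 z; have /andP[_ h] := NE Az.
  have : e * N z <= e * N1 by rewrite ler_pM2l.
  by rewrite /L'; lra.
have K_ge0 : 0 <= C ^+ 2 / (eta * L').
  by rewrite divr_ge0 ?sqr_ge0// mulr_ge0// ltW.
have G_ge0 z : 0 <= G z by rewrite addr_ge0// mulr_ge0// mulr_ge0// ltW.
have mg : measurable_fun [set: T] g.
  apply: measurable_funM => //; apply: measurable_funB; last exact: measurable_funM.
  by apply: measurable_funB => //; exact: measurable_funM.
have mG : measurable_fun [set: T] G.
  by apply: measurable_funD => //; exact: measurable_funM.
have pointwise z : A z -> 2 * (e * N z) * (f z ^+ 2 / psi z) + g z <=
    (f (Phi z) - f z) ^+ 2 / (e * N z) + G (Phi z).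
  move=> Az; have /andP[N0z _] := NE Az.
  have k0 : 0 < e * N z by rewrite mulr_gt0// (lt_le_trans N0_gt0).
  have sE : s z = s (Phi z) + e * N z.
    have lz : l z = e * N z + l (Phi z).
      by rewrite {1}/l lE indicE mem_set// mul1r.
    by rewrite /s lz; ring.
  have s'0 : 0 < s (Phi z).
    by have /andP[h1 _] := s_gt0 (Phi z); exact: lt_le_trans h1.
  have sL : s z <= L' by have /andP[_ h2] := s_gt0 z; rewrite /L'; lra.
  have := weighted_increment (f z) (f (Phi z)) k0 sE s'0 sL.
  rewrite -/(psi z) -/(psi (Phi z)).
  have -> : 2 * (e * N z) * (f z ^+ 2 / psi z) + g z =
     (2 * L' - 2 * s z + e * N z) * (f z ^+ 2 / psi z) by rewrite /g; ring.
  move=> /le_trans; apply; rewrite lerD2l /G /g -mulrDl.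
  have [APz|/fA ->] := pselect (A (Phi z)); last first.
    by rewrite expr0n/= mul0r !mulr0.
  rewrite ler_wpM2r//.
  have : e * N (Phi z) <= e * (N z + om) by rewrite ler_pM2l// Nom.
  by rewrite mulrDr; lra.
have mD : measurable_fun [set: T] (fun z => (f (Phi z) - f z) ^+ 2 / (e * N z)).
  apply: measurable_funM.
    apply: measurable_funX; apply: measurable_funB => //.
    exact: measurableT_comp.
  by apply: measurable_funV; exact: measurable_funM.
have mGP : measurable_fun [set: T] (fun z => G (Phi z)).
  exact: measurableT_comp.
have mEA h : measurable_fun [set: T] h ->
    measurable_fun A (fun z => (h z)%:E : \bar R).
  by move=> mh; apply/measurable_EFinP; exact: measurable_funTS.
have N_ge0 z : A z -> 0 <= N z.
  by move=> /NE /andP[h _]; rewrite ltW// (lt_le_trans N0_gt0).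
have e0 : 0 <= e by exact: ltW.
have mPf : measurable_fun [set: T] (fun z => 2 * (e * N z) * (f z ^+ 2 / psi z)).
  apply: measurable_funM => //; apply: measurable_funM => //.
  exact: measurable_funM.
have Pf0 z : A z -> 0 <= 2 * (e * N z) * (f z ^+ 2 / psi z).
  by move=> /N_ge0 Nz; rewrite mulr_ge0// mulr_ge0// mulr_ge0.
have Df0 z : A z -> 0 <= (f (Phi z) - f z) ^+ 2 / (e * N z).
  by move=> /N_ge0 Nz; rewrite divr_ge0 ?sqr_ge0// mulr_ge0.
pose K := e * om * (C ^+ 2 / (eta * L')).
have K0 : 0 <= K by rewrite /K mulr_ge0// mulr_ge0.
have intPhi : (\int[mu]_(z in A) (G (Phi z))%:E <=
    \int[mu]_(z in A) (g z)%:E + K%:E * mu A)%E.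
  apply: (@le_trans _ _ (\int[mu]_z (G (Phi z))%:E)%E).
    apply: ge0_subset_integral => //.
      by apply/measurable_EFinP.
    by move=> z _; rewrite lee_fin.
  have := ge0_integral_scales_measure (f := fun z => (G z)%:E) Phi_mu.
  move=> ->; [|exact/measurable_EFinP|by move=> z; rewrite lee_fin].
  have -> : (\int[mu]_z (G z)%:E = \int[mu]_(z in A) (G z)%:E)%E.
    rewrite [RHS]integral_mkcond; apply: eq_integral => z _.
    rewrite /patch; case: ifPn => //; rewrite notin_setE => /fA f0.
    by rewrite /G /g f0 expr0n/= mul0r !mulr0 addr0.
  rewrite -integral_cst// -EFin_integralD//.
  apply: EFin_le_integral => //; first exact: measurable_funD.
  by move=> z _; rewrite lerD2l ler_wpM2l// mulr_ge0// ltW.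
(* Finiteness is what allows the integral of [g] to be cancelled from both sides in the extended
   reals. *)
have gfin : (\int[mu]_(z in A) (g z)%:E)%E \is a fin_num.
  apply: (@EFin_integral_fin_num _ _ _ _ _ mA _ (2 * L' * (C ^+ 2 / (eta * L')))) => //.
  move=> z Az; rewrite g_ge0/= /g.
  rewrite (@le_trans _ _ (2 * L' * (f z ^+ 2 / psi z)))//.
    rewrite ler_wpM2r//; have /andP[h1 _] := s_gt0 z.
    have : 0 <= e * N z by rewrite mulr_ge0 ?N_ge0// ltW.
    lra.
  by rewrite ler_wpM2l// mulr_ge0// ltW.
have main : (\int[mu]_(z in A) (2 * (e * N z) * (f z ^+ 2 / psi z))%:E +
    \int[mu]_(z in A) (g z)%:E <=
    \int[mu]_(z in A) ((f (Phi z) - f z) ^+ 2 / (e * N z))%:E +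
    (\int[mu]_(z in A) (g z)%:E + K%:E * mu A))%E.
  rewrite -EFin_integralD//.
  apply: (@le_trans _ _ (\int[mu]_(z in A)
    ((f (Phi z) - f z) ^+ 2 / (e * N z) + G (Phi z))%:E)%E).
    apply: EFin_le_integral => //.
    - exact: measurable_funD.
    - exact: measurable_funD.
    - by move=> z Az; rewrite addr_ge0// Pf0.
  rewrite EFin_integralD//; exact: leeD2l.
have {}main : (\int[mu]_(z in A) (2 * (e * N z) * (f z ^+ 2 / psi z))%:E <=
    \int[mu]_(z in A) ((f (Phi z) - f z) ^+ 2 / (e * N z))%:E + K%:E * mu A)%E.
  by move: main; rewrite addeCA addeC leeD2lE.
have -> : (om * (C ^+ 2 / (eta * L')))%:E = (e^-1%:E * K%:E)%E.
  by rewrite -EFinM /K; congr EFin; field; rewrite !lt0r_neq0.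
have -> : (\int[mu]_(z in A) (((f (Phi z) - f z) / e) ^+ 2 / N z)%:E =
    e^-1%:E * \int[mu]_(z in A) ((f (Phi z) - f z) ^+ 2 / (e * N z))%:E)%E.
  rewrite -EFin_integralZl ?invr_ge0//.
  apply: eq_integral => z; rewrite inE => Az; congr EFin.
  have /andP[N0z _] := NE Az.
  by field; rewrite !lt0r_neq0// (lt_le_trans N0_gt0).
rewrite -muleA -muleDr//; last first.
  apply: ge0_adde_def; rewrite inE; first exact: EFin_integral_ge0.
  by rewrite mule_ge0// lee_fin.
apply: le_trans (lee_wpmul2l _ main); last by rewrite lee_fin invr_ge0.
rewrite -EFin_integralZl ?invr_ge0//.
apply: EFin_le_integral => //.
- apply: measurable_funM => //; apply: measurable_funM => //.
  exact: measurable_funX.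
- exact: measurable_funM.
- move=> z /N_ge0 Nz; apply: mulr_ge0; last by rewrite mulr_ge0 ?sqr_ge0.
  by rewrite divr_ge0 ?exprn_ge0 ?(ltW L'0).
move=> z Az.
have -> : e^-1 * (2 * (e * N z) * (f z ^+ 2 / psi z)) =
    2 * (N z * f z ^+ 2) / psi z by field; rewrite !lt0r_neq0.
rewrite mulrAC; apply: ler_wpM2l.
  by rewrite mulr_ge0// mulr_ge0 ?N_ge0 ?sqr_ge0.
by rewrite lef_pV2 ?posrE ?psi_gt0 ?exprn_gt0//.
Qed.

End discrete_poincare.

(** * Extension by zero of functions vanishing on the boundary *)

Section extension_by_zero.
Context {R : realType} {n : nat}.
Local Notation V := 'rV[R]_n.
Variables (M U : set V).
Hypothesis cM : compact M.
Hypothesis oU : open U.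
Hypothesis MU : M `<=` U.

Lemma is_derive_line (x d : V) (s : R) : is_derive s 1 (fun s => x + s *: d) d.
Proof.
apply: is_derive_row => j.
rewrite (_ : (fun s => _) = (fun s => x 0 j + s * d 0 j)); last first.
  by apply/funext => s'; rewrite !mxE.
have := is_deriveD (is_derive_cst (x 0 j) s (1 : R))
  (is_deriveM (is_derive_id s (1 : R)) (is_derive_cst (d 0 j) s (1 : R))).
move=> /is_derive_eq; apply.
by rewrite /GRing.scale/= mulr0 mulr1 !add0r.
Qed.

Lemma uniform_modulus (f : V -> R) (w : R) :
  (forall x, M x -> {for x, continuous f}) -> 0 < w ->
  exists2 r, 0 < r & forall x y, M x -> M y -> `|y - x| < r ->
    `|f y - f x| < w.
Proof.
move=> cf w0.
have w2 : 0 < w / 2 by exact: divr_gt0.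
pose P (r : R) (x : V) := forall y, M y -> `|y - x| < r -> `|f y - f x| < w.
have : \forall r \near 0^'+, M `<=` P r.
  move/compact_near_coveringP : cM; apply => x Mx.
  have /cvgrPdist_lt/(_ _ w2)/nbhs_ballP[e /= e0 He] := cf _ Mx.
  have e2 : 0 < e / 2 by exact: divr_gt0.
  exists (ball x (e / 2), [set r | r < e / 2]).
    by split => /=; [exact: nbhsx_ballx|exact: nbhs_right_lt].
  move=> [x' r] [/= xx' re] y My yx'.
  have h1 : `|f x - f x'| < w / 2.
    by apply: He; apply: le_ball xx'; rewrite ler_pdivrMr// ler_peMr ?ler1n// ltW.
  have h2 : `|f x - f y| < w / 2.
    apply: He; move: xx'; rewrite -!ball_normE /ball_/= => xx'.
    rewrite -(subrK x' x) -addrA (le_lt_trans (ler_normD _ _))//.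
    by rewrite (splitr e) ltrD// distrC (lt_trans yx').
  rewrite -(subrK (f x) (f y)) -addrA (le_lt_trans (ler_normD _ _))//.
  by rewrite (splitr w) ltrD// distrC.
move=> H; near (0 : R)^'+ => r.
exists r => // x y Mx My yx.
by move: x Mx y My yx; near: r.
Unshelve. all: by end_near. Qed.

Section lipschitz.
Variables (F : V -> R) (B : R).
Hypothesis dF : forall x, U x -> differentiable F x.
Hypothesis FB : forall x j, M x -> `|partial j F x| <= B.

Lemma segment_mvt (x d : V) t : 0 <= t ->
  (forall s, 0 <= s <= t -> M (x + s *: d)) ->
  `|F (x + t *: d) - F x| <= n%:R * B * (t * `|d|).
Proof.
move=> t0 Mline; pose gam s := x + s *: d.
have dFl s : 0 <= s <= t -> is_derive s 1 (F \o gam)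
    (\sum_j d 0 j * partial j F (gam s)).
  move=> /Mline /MU Us; apply: is_derive_comp_curve; first exact: dF.
  exact: is_derive_line.
have cFl : {within `[0, t], continuous (F \o gam)}.
  by apply: derivable_within_continuous => s; rewrite in_itv/= => /dFl [].
have [s|c] := MVT_segment (f := F \o gam)
    (df := fun s => \sum_j d 0 j * partial j F (gam s)) t0 _ cFl.
  by rewrite in_itv/= => /andP[s0 st]; apply: dFl; rewrite !ltW.
rewrite in_itv/= => /Mline Mc; rewrite /gam/= scale0r addr0 subr0 => ->.
rewrite normrM (ger0_norm t0) mulrC [leRHS]mulrCA ler_wpM2l//.
rewrite (le_trans (ler_norm_sum _ _ _))//.
rewrite -mulrA mulr_natl -[X in _ *+ X]card_ord -sumr_const.
apply: ler_sum => j _; rewrite normrM mulrC ler_pM//; first exact: FB.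
exact: coord_le_norm.
Qed.

Hypothesis F0 : forall x, bdry M x -> F x = 0.
Local Notation O := (interior M).

(** The times in [0, t] at which the line is outside the interior form a compact set. Its least
    element is the exit time, and the point reached then is a limit of interior points. *)
Lemma first_exit (x d : V) t : O x -> 0 <= t -> ~ O (x + t *: d) ->
  exists2 s, 0 <= s <= t & bdry M (x + s *: d) /\
    forall r, 0 <= r <= s -> M (x + r *: d).
Proof.
move=> Ox t0 nO; pose gam s := x + s *: d.
have cgam : continuous gam.
  move=> s; apply: differentiable_continuous.
  by apply/derivable1_diffP; case: (is_derive_line x d s).
pose E := `[0, t]%classic `&` gam @^-1` (~` O).
have cE : compact E.
  apply: (subclosed_compact _ (@segment_compact _ 0 t)); last by move=> s [].
  apply: closedI; first exact: itv_closed.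
  apply: closed_comp => [s _|]; first exact: cgam.
  by apply: open_closedC; exact: open_interior.
have E0 : E !=set0 by exists t; split => //=; rewrite in_itv/= t0 lexx.
have [s] : exists2 s, s \in E & forall r, r \in E -> id s <= id r.
  apply: compact_EVT_min => //; apply: continuous_subspaceT.
  by move=> r; exact: cvg_id.
move=> /set_mem[/= +] nOs Hs; rewrite in_itv/= => /andP[s0 st].
have before r : 0 <= r < s -> O (gam r).
  move=> /andP[r0 rs]; apply: contrapT => nOr.
  have : s <= r.
    by apply: Hs; rewrite inE; split => //=; rewrite in_itv/= r0 (le_trans (ltW rs)).
  by rewrite leNgt rs.
have s_gt0 : 0 < s.
  rewrite lt_neqAle s0 andbT; apply/eqP => s0'.
  by apply: nOs; rewrite /gam -s0' scale0r addr0.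
have cls : closure M (gam s).
  move=> A As.
  have /nbhs_ballP[e /= e0 He] := cgam s _ As.
  pose r := Num.max 0 (s - e / 2).
  have rs : 0 <= r < s by rewrite /r le_max lexx/= gt_max s_gt0 ltrBlDr ltrDl divr_gt0.
  exists (gam r); split; first exact: interior_subset (before _ rs).
  apply: He; rewrite -ball_normE /ball_/= ger0_norm; last by
    rewrite subr_ge0 ltW//; case/andP: rs.
  rewrite ltrBlDr -ltrBlDl (@lt_le_trans _ _ (s - e / 2))//.
    by rewrite ltrD2l ltrN2 ltr_pdivrMr// ltr_pMr// ltr1n.
  by rewrite /r le_max lexx orbT.
have Mgs : M (gam s).
  by have /closure_id -> := compact_closed (@norm_hausdorff _ _) cM.
exists s; first by rewrite s0.
split; first by split.
move=> r /andP[r0]; rewrite le_eqVlt => /predU1P[->//|rs].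
by apply: (interior_subset (before _ _)); rewrite r0.
Qed.

(** The segment from x to y may leave M; it is then followed only up to the first exit, where F
    vanishes. In that case even the sum of the two absolute values is bounded, which controls
    products of F with factors that jump at the boundary. *)
Lemma patch_lipschitz_in x y : O x ->
  `|(F \_ O) y - (F \_ O) x| <= n%:R * B * `|y - x| /\
  ((exists2 s, 0 <= s <= 1 & ~ O (x + s *: (y - x))) ->
   `|(F \_ O) y| + `|(F \_ O) x| <= n%:R * B * `|y - x|).
Proof.
move=> Ox.
have FO z : O z -> (F \_ O) z = F z by move=> Oz; rewrite /patch mem_set.
have F0O z : ~ O z -> (F \_ O) z = 0 by move=> Oz; rewrite /patch memNset.
have exit z (d : V) t : O z -> 0 <= t -> ~ O (z + t *: d) ->
    `|F z| <= n%:R * B * (t * `|d|).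
  move=> Oz t0 nO; have [s /andP[s0 st] [bs Ms]] := first_exit Oz t0 nO.
  have -> : `|F z| = `|F (z + s *: d) - F z| by rewrite (F0 bs) sub0r normrN.
  rewrite (le_trans (segment_mvt s0 Ms))//.
  have B0 : 0 <= n%:R * B.
    case: (posnP n) => [n0|n0]; first by rewrite [n%:R](_ : _ = 0) ?mul0r// n0.
    rewrite mulr_ge0// (le_trans _ (FB (Ordinal n0) (interior_subset Oz)))//.
  by rewrite ler_wpM2l// ler_wpM2r.
have ex : (exists2 s, 0 <= s <= 1 & ~ O (x + s *: (y - x))) ->
   `|(F \_ O) y| + `|(F \_ O) x| <= n%:R * B * `|y - x|.
  move=> [s /andP[s0 s1] nO]; rewrite (FO _ Ox).
  have Fx := exit _ _ _ Ox s0 nO.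
  have [Oy|nOy] := pselect (O y).
    (* The first exits seen from x and from y both occur no later than the point x + s (y - x), so
       the two estimates share the length |y - x|. *)
    rewrite FO// (_ : `|y - x| = (1 - s) * `|x - y| + s * `|y - x|); last first.
      by rewrite (distrC x) -mulrDl subrK mul1r.
    rewrite mulrDr; apply: lerD; last exact: Fx.
    apply: exit; [exact: Oy|by rewrite subr_ge0|].
    suff -> : y + (1 - s) *: (x - y) = x + s *: (y - x) by [].
    by apply/rowP => j; rewrite !mxE; ring.
  rewrite (F0O _ nOy) normr0 add0r -[`|y - x|]mul1r.
  by apply: exit; [exact: Ox|exact: ler01|rewrite scale1r addrC subrK].
split=> //.
have [/ex|nex] := pselect (exists2 s, 0 <= s <= 1 & ~ O (x + s *: (y - x))).
  by apply: le_trans; exact: ler_normB.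
have inO s : 0 <= s <= 1 -> O (x + s *: (y - x)).
  by move=> s01; apply: contrapT => h; apply: nex; exists s.
have yE : y = x + 1 *: (y - x) by rewrite scale1r addrC subrK.
have Oy : O y by rewrite yE; apply: inO; rewrite ler01 lexx.
rewrite !FO// {1}yE -[`|y - x|]mul1r; apply: segment_mvt => // s s01.
by apply: interior_subset; exact: inO.
Qed.

End lipschitz.
End extension_by_zero.

(** * Phase space *)

Section triples.
Context {R : realType}.

Definition triple (v : 'rV[R]_3) : R3 R := (v 0 0, v 0 1, v 0 2%:R).

Lemma row3K (v : 'rV[R]_3) : row3 (triple v) = v.
Proof. by apply/rowP; elim/ord3_ind; rewrite mxE. Qed.

Lemma measurable_row3 j : measurable_fun [set: R3 R] (fun t => row3 t 0 j).
Proof.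
move: j; elim/ord3_ind; under eq_fun do rewrite mxE/=.
- by apply: measurableT_comp.
- by apply: measurableT_comp.
- exact: measurable_snd.
Qed.

Lemma measurable_cube (B : R) :
  measurable [set t : R3 R | forall j, `|row3 t 0 j| <= B].
Proof.
have -> : [set t : R3 R | forall j, `|row3 t 0 j| <= B] =
    \bigcap_(j in [set: 'I_3])
    (setT `&` (fun t : R3 R => row3 t 0 j) @^-1` `[- B, B]).
  apply/seteqP; split => t /= H j; first by split=> //=;
    rewrite in_itv/= -ler_norml; exact: H.
  by have [_ /=] := H j I; rewrite in_itv/= -ler_norml.
apply: fin_bigcap_measurable => // j _.
by apply: measurable_row3 => //; exact: measurable_itv.
Qed.

Lemma measurable_triple d (T : measurableType d) (g : T -> 'rV[R]_3) :
  (forall j, measurable_fun [set: T] (fun t => g t 0 j)) ->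
  measurable_fun [set: T] (fun t => triple (g t)).
Proof.
move=> mg; apply: measurable_fun_pair; last exact: mg.
by apply: measurable_fun_pair; exact: mg.
Qed.

Lemma lebesgue3_translation_row (b : 'rV[R]_3) :
  scales_measure (@lebesgue3 R) 1 (fun t : R3 R => triple (row3 t + b)).
Proof.
have := lebesgue3_translation (triple b).
set f := (X in scales_measure _ _ X).
suff -> : (fun t : R3 R => triple (row3 t + b)) = f by [].
by apply/funext => t; rewrite /f /triple !mxE.
Qed.

Definition lebesgue6 : set (R3 R * R3 R) -> \bar R := (@lebesgue3 R \x @lebesgue3 R)%E.
HB.instance Definition _ := Measure.on lebesgue6.

Lemma lebesgue3_cube_fin (B : R) :
  (lebesgue3 [set t : R3 R | forall j, (`|row3 t 0 j| <= B)%R] < +oo)%E.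
Proof.
have [B0|B0] := leP 0 B; last first.
  rewrite (_ : [set t | _] = set0) ?measure0//.
  apply/seteqP; split => // t /(_ 0) /(le_trans (normr_ge0 _)).
  by rewrite leNgt B0.
pose I : set (measurableTypeR R) := `[-B, B]%classic.
have mI : measurable I by exact: measurable_itv.
rewrite (_ : [set t | _] = (I `*` I) `*` I); last first.
  apply/seteqP; split => t /=.
    move=> H; have := H 0; have := H 1; have := H 2%:R.
    by rewrite !mxE/= /I /= !in_itv/= !ler_norml => -> -> ->.
  rewrite /I /= !in_itv/= -!ler_norml => -[[h0 h1] h2].
  by elim/ord3_ind; rewrite mxE.
have Ifin : (lebesgue_measure I < +oo)%E.
  by rewrite /I lebesgue_measure_itv/=; case: ifPn; rewrite // -EFinB ltry.
rewrite /lebesgue3 product_measure1E//=; last exact: measurableX.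
rewrite lte_mul_pinfty//.
  by rewrite ge0_fin_numE// /lebesgue2 product_measure1E//= lte_mul_pinfty// ge0_fin_numE.
Qed.

End triples.

Section phase_space.
Context {R : realType}.
Local Notation V := 'rV[R]_3.
Local Notation R6 := (R3 R * R3 R)%type.
Variables (M U : set V) (N : V -> R) (w : 'I_3 -> V -> R).
Hypothesis cM : compact M.
Hypothesis oU : open U.
Hypothesis MU : M `<=` U.
Hypothesis sN : Cdiff 2 U N.
Hypothesis N_gt0 : forall x, M x -> 0 < N x.
Hypothesis sw : forall j, Cdiff 1 U (w j).
Hypothesis w0 : forall j x, bdry M x -> w j x = 0.
Local Notation O := (interior M).

Let oO : open O. Proof. exact: open_interior. Qed.
Let OM (x : V) : O x -> M x. Proof. exact: interior_subset. Qed.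
Let OU (x : V) : O x -> U x. Proof. by move=> /OM /MU. Qed.

(** Patching by zero gives functions measurable on the whole space, so that [step] is a total map. N
    jumps at the boundary, but the phase function stays under control because w vanishes there. *)
Let NO : V -> R := N \_ O.
Let WO j : V -> R := w j \_ O.
Let DW j k : V -> R := partial k (w j) \_ O.
Let GO j : V -> R := (fun x => 2^-1 * partial j N x) \_ O.

Definition energy (z : R6) : R := \sum_j row3 z.2 0 j ^+ 2 - NO (row3 z.1).

Definition shell (d : R) : set R6 := [set z | O (row3 z.1) /\ `|energy z| < d].

(** Applied to the energy, it vanishes continuously at the edge of the shell and is constant along
    the flow. *)
Definition cutoff (d s : R) : R := Num.max 0 (d ^+ 2 - s ^+ 2).

(** With w = v / N the sum is the value of v on p / N, the velocity in length parametrization. *)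
Definition phase_fun (d : R) (z : R6) : R :=
  (\sum_j WO j (row3 z.1) * row3 z.2 0 j) * cutoff d (energy z).

(** The derivative of [phase_fun] along x' = p, p' = grad N / 2; the cutoff is not differentiated,
    since this flow conserves the energy. *)
Definition phase_derivative (d : R) (z : R6) : R :=
  (\sum_j (\sum_k DW j k (row3 z.1) * row3 z.2 0 k) * row3 z.2 0 j +
   \sum_j WO j (row3 z.1) * GO j (row3 z.1)) * cutoff d (energy z).

Let Gv (x : V) : V := \row_j GO j x.

(* One step of the symplectic Euler scheme for x'' = grad N / 2; the
   trajectories of energy 0 are the geodesics of N times the Euclidean metric. *)
Definition step (e : R) (z : R6) : R6 :=
  let p := row3 z.2 + e *: Gv (row3 z.1) in
  (triple (row3 z.1 + e *: p), triple p).

Let mpatch (F : V -> R) (G : R6 -> R3 R) : (forall x, U x -> {for x, continuous F}) ->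
  measurable_fun [set: R6] G ->
  measurable_fun [set: R6] (fun z : R6 => (F \_ O) (row3 (G z))).
Proof.
move=> cF mG.
have := measurableT_comp (measurable_row3_patch oO (fun x Ox => cF x (OU Ox))) mG.
exact.
Qed.

Let mNO : measurable_fun [set: R6] (fun z : R6 => NO (row3 z.1)).
Proof. by apply: mpatch => // x Ux; exact: (Cdiff_continuous sN). Qed.

Let mWO j : measurable_fun [set: R6] (fun z : R6 => WO j (row3 z.1)).
Proof. by apply: mpatch => // x Ux; exact: (Cdiff_continuous (sw j)). Qed.

Let mDW j k : measurable_fun [set: R6] (fun z : R6 => DW j k (row3 z.1)).
Proof.
by apply: mpatch => // x Ux; exact: (Cdiff_continuous (Cdiff_partial k (sw j))).
Qed.

Let mGO j : measurable_fun [set: R6] (fun z : R6 => GO j (row3 z.1)).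
Proof.
apply: mpatch => // x Ux; apply: (@Cdiff_continuous _ _ 1 U) => //.
by apply: CdiffM => //; [exact: Cdiff_cst|exact: Cdiff_partial].
Qed.

Let mp j : measurable_fun [set: R6] (fun z : R6 => row3 z.2 0 j).
Proof.
by have := measurableT_comp (measurable_row3 j) (@measurable_snd _ _ (R3 R) (R3 R)).
Qed.

Let mx j : measurable_fun [set: R6] (fun z : R6 => row3 z.1 0 j).
Proof.
by have := measurableT_comp (measurable_row3 j) (@measurable_fst _ _ (R3 R) (R3 R)).
Qed.

Lemma measurable_energy : measurable_fun [set: R6] energy.
Proof.
apply: measurable_funB => //; apply: measurable_sum => j.
exact: measurable_funX.
Qed.

Lemma measurable_shell d : measurable (shell d).
Proof.
have -> : shell d = (fst @^-1` (row3 @^-1` O)) `&`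
    (setT `&` (fun z => `|energy z|) @^-1` `]-oo, d[).
  by apply/seteqP; split=> z /=; rewrite in_itv/=; [move=> []|move=> [? []]].
apply: measurableI.
  rewrite -[X in measurable X]setTI; apply: measurable_fst => //.
  exact: measurable_row3_open.
by apply: (measurableT_comp (@normr_measurable R setT) measurable_energy) => //;
  exact: measurable_itv.
Qed.

Let mcut d : measurable_fun [set: R6] (fun z => cutoff d (energy z)).
Proof.
apply: measurable_maxr => //; apply: measurable_funB => //.
by apply: measurable_funX; exact: measurable_energy.
Qed.

Lemma measurable_phase_fun d : measurable_fun [set: R6] (phase_fun d).
Proof.
apply: measurable_funM => //; apply: measurable_sum => j.
exact: measurable_funM.
Qed.

Lemma measurable_phase_derivative d :
  measurable_fun [set: R6] (phase_derivative d).
Proof.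
apply: measurable_funM => //; apply: measurable_funD.
  apply: measurable_sum => j; apply: measurable_funM => //.
  by apply: measurable_sum => k; exact: measurable_funM.
by apply: measurable_sum => j; exact: measurable_funM.
Qed.

(** A kick of the momentum followed by a drift of the position, each a translation in its own
    fibre. *)
Lemma step_preserves e : scales_measure lebesgue6 1 (step e).
Proof.
pose kick (x p : R3 R) : R3 R := triple (row3 p + e *: Gv (row3 x)).
pose drift (p x : R3 R) : R3 R := triple (row3 x + e *: row3 p).
have mkick : measurable_fun setT (fun z : R6 => kick z.1 z.2).
  apply: measurable_triple => j; under eq_fun do rewrite !mxE.
  apply: measurable_funD; last exact: measurable_funM.
  by have := mp j; under eq_fun do rewrite mxE.
have mdrift : measurable_fun setT (fun z : R6 => drift z.2 z.1).
  apply: measurable_triple => j; under eq_fun do rewrite mxE [X in _ + X]mxE.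
  by apply: measurable_funD => //; exact: measurable_funM.
have Hk : scales_measure lebesgue6 1 (fun z : R6 => (z.1, kick z.1 z.2)).
  apply: scales_measure_skewr => // x; exact: lebesgue3_translation_row.
have Hd : scales_measure lebesgue6 1 (fun z : R6 => (drift z.2 z.1, z.2)).
  apply: scales_measure_skewl => // x; exact: lebesgue3_translation_row.
have := scales_measure_comp Hk Hd; rewrite mulr1.
set f := (X in scales_measure _ _ X); suff -> : step e = f by [].
by apply/funext => z; rewrite /f /step /= /drift row3K.
Qed.

End phase_space.

Lemma is_derive_seq (R : realType) (g : R -> R) (D : R) (e : R^nat) :
  is_derive (0 : R) 1 g D -> (forall k, 0 < e k) -> e @ \oo --> 0 ->
  (g (e k) - g 0) / e k @[k --> \oo] --> D.
Proof.
move=> [dg gE] e0 ecvg.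
have : (h^-1 *: (g (h *: 1 + 0) - g 0)) @[h --> 0^'] --> D.
  by rewrite -gE; exact: dg.
move=> /cvgrPdist_lt H; apply/cvgrPdist_lt => r r0.
have /nbhs_ballP[q /= q0 Hq] := H _ r0.
move/cvgrPdist_lt : ecvg => /(_ _ q0); apply: filterS => k ek.
have := Hq (e k); rewrite -ball_normE /ball_/= => /(_ ek).
rewrite addr0 [e k *: 1]mulr1 [_ *: _]mulrC; apply.
by rewrite gt_eqF.
Qed.

Lemma fin_common_bound (R : realType) (V : Type) (I : finType) (M : set V)
    (F : I -> V -> R) :
  (forall i, exists B, forall x, M x -> F i x <= B) ->
  exists2 B, 0 <= B & forall i x, M x -> F i x <= B.
Proof.
move=> /choice[f Hf]; exists (\sum_i `|f i|); first exact: sumr_ge0.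
move=> i x Mx; rewrite (le_trans (Hf i x Mx))// (bigD1 i)//= ler_wpDr//.
  exact: sumr_ge0.
exact: ler_norm.
Qed.

Lemma cutoff_bounds (R : realType) (d s : R) : 0 <= cutoff d s <= d ^+ 2.
Proof.
rewrite /cutoff le_max lexx/= ge_max sqr_ge0/= lerBlDr lerDl sqr_ge0.
by [].
Qed.

Lemma cutoff_lipschitz (R : realType) (d s s' : R) :
  `|cutoff d s' - cutoff d s| <= `|s' ^+ 2 - s ^+ 2|.
Proof.
rewrite /cutoff; set a := d ^+ 2 - s' ^+ 2; set b := d ^+ 2 - s ^+ 2.
have -> : s' ^+ 2 - s ^+ 2 = b - a by rewrite /a /b; ring.
rewrite distrC; case: (leP 0 a) => ha; case: (leP 0 b) => hb.
- by rewrite lexx.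
- by rewrite sub0r normrN (ger0_norm ha) ler0_norm; lra.
- by rewrite subr0 (ger0_norm hb) ger0_norm; lra.
- by rewrite subrr normr0.
Qed.

Lemma cutoff_out (R : realType) (d s : R) : 0 < d -> d <= `|s| -> cutoff d s = 0.
Proof.
move=> d0 ds; rewrite /cutoff max_l// subr_le0 -[s ^+ 2]real_normK ?num_real//.
by rewrite lerXn2r// nnegrE ltW.
Qed.

Lemma product3_increment (R : realDomainType) (a b c a' b' c' : R) :
  `|a' * b' * c' - a * b * c| <= `|a' - a| * `|b'| * `|c'| +
    `|a| * `|b' - b| * `|c'| + `|a| * `|b| * `|c' - c|.
Proof.
have -> : a' * b' * c' - a * b * c = (a' - a) * b' * c' + a * (b' - b) * c' +
  a * b * (c' - c) by ring.
rewrite (le_trans (ler_normD _ _))// lerD//; last by rewrite !normrM.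
by rewrite (le_trans (ler_normD _ _))// !normrM.
Qed.

(** * First-order behaviour of one step *)

Section phase_estimates.
Context {R : realType}.
Local Notation V := 'rV[R]_3.
Local Notation R6 := (R3 R * R3 R)%type.
Variables (M U : set V) (N : V -> R) (w : 'I_3 -> V -> R).
Hypothesis cM : compact M.
Hypothesis oU : open U.
Hypothesis MU : M `<=` U.
Hypothesis sN : Cdiff 2 U N.
Hypothesis N_gt0 : forall x, M x -> 0 < N x.
Hypothesis sw : forall j, Cdiff 1 U (w j).
Hypothesis w0 : forall j x, bdry M x -> w j x = 0.
Local Notation O := (interior M).

Let OM (x : V) : O x -> M x. Proof. exact: interior_subset. Qed.
Let OU (x : V) : O x -> U x. Proof. by move=> /OM /MU. Qed.

Lemma triple_row3 (t : R3 R) : triple (row3 t) = t.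
Proof. by case: t => [[a b] c]; rewrite /triple !mxE. Qed.

Lemma step_momentum e z j : O (row3 z.1) ->
  row3 (step M N e z).2 0 j = row3 z.2 0 j + e * (2^-1 * partial j N (row3 z.1)).
Proof. by move=> Oz; rewrite /step/= row3K !mxE /patch mem_set. Qed.

Lemma step_position e z :
  row3 (step M N e z).1 = row3 z.1 + e *: row3 (step M N e z).2.
Proof. by rewrite /step/= !row3K. Qed.

Let dN x : U x -> differentiable N x.
Proof. exact: (Cdiff_differentiable sN). Qed.

Let dw j x : U x -> differentiable (w j) x.
Proof. exact: (Cdiff_differentiable (sw j)). Qed.

Lemma phase_fun_cvg d z (e : R^nat) : shell M N d z ->
  (forall k, 0 < e k) -> e @ \oo --> 0 ->
  (phase_fun M N w d (step M N (e k) z) - phase_fun M N w d z) / e k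
    @[k --> \oo] --> phase_derivative M N w d z.
Proof.
move=> [Oz sz] e0 ecvg.
set x := row3 z.1 in Oz *; set p := row3 z.2.
pose G : V := \row_j (2^-1 * partial j N x).
have GE j : G 0 j = 2^-1 * partial j N x by rewrite mxE.
pose xe (r : R) : V := x + r *: (p + r *: G).
pose pe (r : R) : V := p + r *: G.
pose se (r : R) := \sum_j pe r 0 j * pe r 0 j - N (xe r).
pose phi (r : R) := (\sum_j w j (xe r) * pe r 0 j) * (d ^+ 2 - se r * se r).
have xe0 : xe 0 = x by rewrite /xe scale0r addr0.
have pe0 : pe 0 = p by rewrite /pe scale0r addr0.
have dpe : is_derive (0 : R) 1 pe G := is_derive_line p G 0.
have dpej j : is_derive (0 : R) 1 (fun r => pe r 0 j) (G 0 j).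
  exact: is_derive_coord dpe.
have dxe : is_derive (0 : R) 1 xe p.
  apply: is_derive_row => j.
  have := is_deriveD (is_derive_cst (x 0 j) (0 : R) (1 : R))
    (is_deriveM (is_derive_id (0 : R) (1 : R)) (dpej j)).
  have -> : (fun r => xe r 0 j) = cst (x 0 j) + id * (fun r => pe r 0 j).
    by apply/funext => r; rewrite !fctE /xe /pe !mxE.
  move=> /is_derive_eq; apply.
  by rewrite /GRing.scale/= pe0 mul0r mulr1 !add0r.
have dNx : is_derive (0 : R) 1 (N \o xe) (\sum_j p 0 j * partial j N x).
  have := @is_derive_comp_curve _ _ N xe 0 p; rewrite xe0; apply=> //.
  exact: dN (OU Oz).
have dwx j : is_derive (0 : R) 1 (w j \o xe) (\sum_k p 0 k * partial k (w j) x).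
  have := @is_derive_comp_curve _ _ (w j) xe 0 p; rewrite xe0; apply=> //.
  exact: dw (OU Oz).
(* First-order conservation of energy: the kick changes |p|^2 at the rate p . grad N, and the drift
   changes N at the same rate. *)
have dse : is_derive (0 : R) 1 se 0.
  have := is_deriveB (is_derive_sum (fun j => is_deriveM (dpej j) (dpej j))) dNx.
  have -> : \sum_j (fun r => pe r 0 j) * (fun r => pe r 0 j) - (N \o xe) = se.
    by apply/funext => r; rewrite /se !fctE fct_sumE.
  move=> /is_derive_eq; apply; rewrite -sumrB big1// => j _.
  by rewrite pe0 GE /GRing.scale/=; field.
have se0 : se 0 = energy M N z.
  by rewrite /se /energy xe0 pe0 /patch mem_set.
have dphi : is_derive (0 : R) 1 phi (phase_derivative M N w d z).
  have := is_deriveM (is_derive_sum (fun j => is_deriveM (dwx j) (dpej j)))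
    (is_deriveB (is_derive_cst (d ^+ 2) (0 : R) (1 : R)) (is_deriveM dse dse)).
  have -> : (\sum_j (w j \o xe) * (fun r => pe r 0 j)) *
      (cst (d ^+ 2) - se * se) = phi.
    by apply/funext => r; rewrite /phi !fctE fct_sumE.
  move=> /is_derive_eq; apply; rewrite !scaler0 addr0 subrr scaler0 add0r.
  rewrite /phase_derivative /cutoff -se0 /GRing.scale/= mulrC; congr (_ * _).
    rewrite -big_split/=; apply: eq_bigr => j _.
    have PO (F : V -> R) : (F \_ O) x = F x by rewrite /patch mem_set.
    rewrite ?fctE /= xe0 pe0 GE !PO addrC; congr (_ + _).
      by rewrite mulrC; congr (_ * _); apply: eq_bigr => k _; rewrite PO mulrC.
  rewrite !fctE max_r ?expr2// subr_ge0 -!expr2 se0.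
  rewrite -[energy _ _ _ ^+ 2]real_normK ?num_real// lerXn2r// ?nnegrE//.
    by rewrite (le_trans _ (ltW sz)).
  exact: ltW.
(* For small r the moved point is still in the interior and in the shell, both being open
   conditions; there the patches and the maximum in the cutoff are inactive. *)
have near_phi : \forall r \near (0 : R),
    phi r = phase_fun M N w d (step M N r z).
  have Oxe : \forall r \near (0 : R), O (xe r).
    have cxe : {for 0, continuous xe}.
      by apply: differentiable_continuous; apply/derivable1_diffP; case: dxe.
    apply: cxe; rewrite xe0; apply: open_nbhs_nbhs; split => //.
    exact: open_interior.
  have sed : \forall r \near (0 : R), `|se r| < d.
    have cse : {for 0, continuous se}.
      by apply: differentiable_continuous; apply/derivable1_diffP; case: dse.
    move: sz; rewrite -se0 => sed0; exact: (cvgr_norm_lt _ cse).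
  near=> r.
  have Oxr : O (xe r) by near: r.
  have ser : `|se r| < d by near: r.
  have Gp : row3 (step M N r z).2 = pe r.
    by apply/rowP => j; rewrite (step_momentum _ _ Oz) !mxE.
  have Gx : row3 (step M N r z).1 = xe r by rewrite step_position Gp.
  have Es : energy M N (step M N r z) = se r.
    by rewrite /energy Gx Gp /patch mem_set.
  rewrite /phase_fun /phi Es Gx Gp; congr (_ * _).
    by apply: eq_bigr => j _; rewrite /patch mem_set.
  rewrite /cutoff max_r ?expr2// subr_ge0 -!expr2.
  rewrite -[se r ^+ 2]real_normK ?num_real// lerXn2r// ?nnegrE//.
    by rewrite (le_trans _ (ltW ser)).
  exact: ltW.
have := is_derive_seq (near_eq_is_derive near_phi dphi) e0 ecvg.
have -> // : step M N 0 z = z.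
rewrite /step !scale0r !addr0 !triple_row3; by case: (z).
Unshelve. all: by end_near. Qed.

End phase_estimates.

Section phase_bounds.
Context {R : realType}.
Local Notation V := 'rV[R]_3.
Local Notation R6 := (R3 R * R3 R)%type.
Variables (M U : set V) (N : V -> R) (w : 'I_3 -> V -> R).
Hypothesis cM : compact M.
Hypothesis oU : open U.
Hypothesis MU : M `<=` U.
Hypothesis sN : Cdiff 2 U N.
Hypothesis N_gt0 : forall x, M x -> 0 < N x.
Hypothesis sw : forall j, Cdiff 1 U (w j).
Hypothesis w0 : forall j x, bdry M x -> w j x = 0.
Local Notation O := (interior M).

Let OM (x : V) : O x -> M x. Proof. exact: interior_subset. Qed.

Let bounded_coeff k (F : V -> R) : Cdiff k U F ->
  exists B, forall x, M x -> `|F x| <= B.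
Proof.
move=> sF; apply: (@compact_upper_bound _ _ M (fun x => `|F x|)) => // x Mx.
apply: continuous_comp; last exact: norm_continuous.
exact: (Cdiff_continuous sF (MU Mx)).
Qed.

Lemma common_bound : exists2 B, 1 <= B & forall x, M x ->
  [/\ N x <= B, forall j, `|partial j N x| <= B, forall j, `|w j x| <= B &
      forall j k, `|partial k (w j) x| <= B].
Proof.
have [B1 HB1] := bounded_coeff sN.
have [B2 B20 HB2] := fin_common_bound
  (fun j => bounded_coeff (Cdiff_partial j sN)).
have [B3 B30 HB3] := fin_common_bound (fun j => bounded_coeff (sw j)).
have [B4 B40 HB4] := fin_common_bound
  (fun jk : 'I_3 * 'I_3 => bounded_coeff (Cdiff_partial jk.2 (sw jk.1))).
exists (1 + `|B1| + B2 + B3 + B4).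
  by rewrite -!addrA lerDl !addr_ge0.
move=> x Mx; have B1x := le_trans (HB1 x Mx) (ler_norm B1).
have B10 := normr_ge0 B1.
split.
- by have := ler_norm (N x); lra.
- by move=> j; have := HB2 j x Mx; lra.
- by move=> j; have := HB3 j x Mx; lra.
- by move=> j k; have := HB4 (j, k) x Mx => /=; lra.
Qed.

Lemma phase_fun_out d z : 0 < d -> ~ shell M N d z -> phase_fun M N w d z = 0.
Proof.
move=> d0 nz; rewrite /phase_fun.
have [Oz|nOz] := pselect (O (row3 z.1)).
  rewrite cutoff_out ?mulr0// leNgt; apply/negP => sz; exact: nz.
by rewrite big1 ?mul0r// => j _; rewrite /patch memNset// mul0r.
Qed.

Lemma phase_derivative_out d z : 0 < d -> ~ shell M N d z ->
  phase_derivative M N w d z = 0.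
Proof.
move=> d0 nz; rewrite /phase_derivative.
have [Oz|nOz] := pselect (O (row3 z.1)).
  rewrite cutoff_out ?mulr0// leNgt; apply/negP => sz; exact: nz.
rewrite !big1 ?addr0 ?mul0r// => j _; first by rewrite /patch memNset// mul0r.
by rewrite big1 ?mul0r// => k _; rewrite /patch memNset// mul0r.
Qed.

Lemma shell_momentum B d z j : d <= 1 -> (forall x, M x -> N x <= B) ->
  1 <= B -> shell M N d z -> `|row3 z.2 0 j| <= B + 1.
Proof.
move=> d1 NB B1 [Oz]; rewrite /energy /patch mem_set// => sz.
have h1 : `|row3 z.2 0 j| ^+ 2 <= \sum_i row3 z.2 0 i ^+ 2.
  apply: le_trans (normr_sum_sqr _); rewrite lerXn2r ?nnegrE//.
  exact: coord_le_norm.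
have h2 := NB _ (OM Oz).
have h3 : \sum_i row3 z.2 0 i ^+ 2 <= B + 1.
  by move: sz; rewrite ltr_norml => /andP[_]; lra.
rewrite -(@ler_pXn2r _ 2) ?nnegrE//; last lra.
rewrite (le_trans h1)// (le_trans h3)// expr2 ler_peMr//; lra.
Qed.

Lemma shell_fin d : d <= 1 -> (lebesgue6 (shell M N d) < +oo)%E.
Proof.
move=> d1; have [B B1 HB] := common_bound.
have [X HX] : exists X, forall x, M x -> `|x| <= X.
  by apply: (@compact_norm_bound _ _ _ _ id) => // x _; exact: cvg_id.
pose cube (b : R) : set (R3 R) := [set t | forall j, `|row3 t 0 j| <= b].
have mcube b : measurable (cube b) by exact: measurable_cube.
have sub : shell M N d `<=` cube X `*` cube (B + 1).
  move=> z sz; split => j /=.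
    rewrite (le_trans (coord_le_norm _ _))// HX//; apply: OM.
    by case: sz.
  by apply: (@shell_momentum B d) => // x /HB [].
apply: (@le_lt_trans _ _ (lebesgue6 (cube X `*` cube (B + 1)))).
  apply: le_measure => //; rewrite inE.
    exact: (measurable_shell MU sN).
  exact: measurableX.
rewrite /lebesgue6 product_measure1E//=.
by rewrite lte_mul_pinfty ?lebesgue3_cube_fin// ge0_fin_numE// lebesgue3_cube_fin.
Qed.

(** The bound on the values enters the error term of [discrete_poincare]; the bound on the
    increments dominates the difference quotients as the step tends to 0. *)
Lemma phase_fun_bounds : exists2 C, 0 <= C & forall d, 0 < d <= 1 ->
  (forall z, `|phase_fun M N w d z| <= C) /\
  (forall z e, shell M N d z -> 0 < e <= 1 ->
   `|phase_fun M N w d (step M N e z) - phase_fun M N w d z| <= C * e).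
Proof.
have [B B1 HB] := common_bound.
(* Q bounds the momentum coordinates before and after a step of size at most 1. C1 bounds the
   values, C2 the increment when the segment leaves the interior, and C3 collects the three terms of
   [product3_increment]. *)
pose Q := 2 * B + 1.
have BQ : B + 1 <= Q by rewrite /Q; lra.
have B0 : 0 <= B by lra.
have Q0 : 0 <= Q by lra.
pose C1 := 3 * (B * Q).
pose C2 := 3 * (6 * (B * Q) * Q).
pose C3 := 3 * (3 * (B * Q) * Q + B * B + B * Q * (9 * (B * Q) * (2 + 9 * (B * Q)))).
have C10 : 0 <= C1 by rewrite /C1 !mulr_ge0.
have BQ0 : 0 <= B * Q by rewrite mulr_ge0.
have C20 : 0 <= C2 by rewrite /C2 !mulr_ge0.
have C30 : 0 <= C3 by rewrite /C3 mulr_ge0// !addr_ge0// !mulr_ge0// addr_ge0// mulr_ge0.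
exists (C1 + C2 + C3); first by rewrite !addr_ge0.
move=> d /andP[d0 d1].
have cut1 s : 0 <= cutoff d s <= 1.
  have /andP[h1 h2] := cutoff_bounds d s; rewrite h1 (le_trans h2)//.
  by rewrite expr_le1// ltW.
have normcut s : `|cutoff d s| <= 1.
  by have /andP[h1 h2] := cut1 s; rewrite ger0_norm.
have WB j x : `|(w j \_ O) x| <= B.
  rewrite /patch; case: ifPn => [|_]; last by rewrite normr0.
  by rewrite inE => /OM /HB [].
have NB x : M x -> N x <= B by move=> /HB [].
have fbound z q b : 0 <= b -> (forall j, `|row3 z.2 0 j| <= q) ->
    (forall j, `|(w j \_ O) (row3 z.1)| <= b) ->
    `|phase_fun M N w d z| <= 3 * (b * q).
  move=> b0 Hq Hb; rewrite /phase_fun normrM -[leRHS]mulr1 ler_pM//.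
  rewrite (le_trans (ler_norm_sum _ _ _))// mulr_natl -[X in _ *+ X]card_ord.
  rewrite -sumr_const; apply: ler_sum => j _; rewrite normrM ler_pM//.
have fC1 z : shell M N d z -> `|phase_fun M N w d z| <= C1.
  move=> sz; rewrite /C1; apply: fbound => // j.
  by rewrite (le_trans (shell_momentum _ d1 NB B1 sz)).
split=> [z|z e sz /andP[e0 e1]].
  have [sz|nsz] := pselect (shell M N d z).
    by rewrite (le_trans (fC1 _ sz))// -addrA lerDl addr_ge0.
  by rewrite phase_fun_out// normr0 !addr_ge0.
have e0' : 0 <= e by exact: ltW.
set z' := step M N e z.
have Oz : O (row3 z.1) by case: sz.
have pB j : `|row3 z.2 0 j| <= B + 1 by exact: shell_momentum NB B1 sz.
have dpB j : `|row3 z'.2 0 j - row3 z.2 0 j| <= e * B.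
  rewrite step_momentum// addrC addKr normrM (gtr0_norm e0) ler_pM2l//.
  rewrite normrM gtr0_norm ?invr_gt0//.
  have [_ /(_ j) h _ _] := HB _ (OM Oz).
  by rewrite mulrC ler_pdivrMr// (le_trans h)//; lra.
have p'B j : `|row3 z'.2 0 j| <= Q.
  rewrite -(subrK (row3 z.2 0 j) (row3 z'.2 0 j)) (le_trans (ler_normD _ _))//.
  have := dpB j; have := pB j; have : e * B <= 1 * B by rewrite ler_wpM2r.
  by rewrite /Q; lra.
have dxB : `|row3 z'.1 - row3 z.1| <= e * Q.
  rewrite step_position addrC addKr normrZ (gtr0_norm e0) ler_pM2l//.
  exact: norm_le_coord.
have lipw j := @patch_lipschitz_in _ _ M U cM MU (w j) B
  (fun x => @Cdiff_differentiable _ _ 1 U (w j) x (sw j))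
  (fun x k Mx => let: And4 _ _ _ h := HB x Mx in h j k) (w0 j)
  (row3 z.1) (row3 z'.1) Oz.
have lipw' : 3%:R * B * `|row3 z'.1 - row3 z.1| <= 3 * (B * Q) * e.
  have -> : 3 * (B * Q) * e = 3 * B * (e * Q) by ring.
  by rewrite ler_wpM2l// mulr_ge0.
(* If the segment leaves the interior, N and the cutoff may jump, but w is of order e at both ends,
   hence so are both values of the phase function. *)
have [ex|nex] := pselect (exists2 s, 0 <= s <= 1 &
    ~ O (row3 z.1 + s *: (row3 z'.1 - row3 z.1))).
  have Wsmall j : `|(w j \_ O) (row3 z'.1)| <= 3 * (B * Q) * e /\
      `|(w j \_ O) (row3 z.1)| <= 3 * (B * Q) * e.
    have := le_trans ((lipw j).2 ex) lipw'.
    have := normr_ge0 ((w j \_ O) (row3 z'.1)).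
    have := normr_ge0 ((w j \_ O) (row3 z.1)).
    by move=> *; split; lra.
  have b0 : 0 <= 3 * (B * Q) * e by rewrite !mulr_ge0.
  have f1 := fbound z' _ _ b0 p'B (fun j => (Wsmall j).1).
  have f2 := fbound z _ _ b0 (fun j => le_trans (pB j) BQ) (fun j => (Wsmall j).2).
  rewrite (le_trans (ler_normB _ _))//.
  have -> : (C1 + C2 + C3) * e = (C1 + C3) * e +
      (3 * (3 * (B * Q) * e * Q) + 3 * (3 * (B * Q) * e * Q)).
    by rewrite /C2; ring.
  by rewrite ler_wpDl ?mulr_ge0 ?addr_ge0// lerD.
have inO s : 0 <= s <= 1 -> O (row3 z.1 + s *: (row3 z'.1 - row3 z.1)).
  by move=> s01; apply: contrapT => h; apply: nex; exists s.
have Oz' : O (row3 z'.1).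
  have h1 : 0 <= (1 : R) <= 1 by rewrite ler01 lexx.
  by have := inO 1 h1; rewrite scale1r addrC subrK.
have dNB : `|N (row3 z'.1) - N (row3 z.1)| <= 3 * (B * Q) * e.
  have := @segment_mvt _ _ M U MU N B
    (fun x => @Cdiff_differentiable _ _ 2 U N x sN)
    (fun x k Mx => let: And4 _ h _ _ := HB x Mx in h k)
    (row3 z.1) (row3 z'.1 - row3 z.1) 1 ler01 (fun s s01 => OM (inO s s01)).
  rewrite scale1r [_ + (_ - _)]addrC subrK mul1r => /le_trans; apply.
  exact: lipw'.
set s := energy M N z; set s' := energy M N z'.
have s1 : `|s| <= 1 by case: sz => _ /ltW /le_trans; apply.
have dsB : `|s' - s| <= 9 * (B * Q) * e.
  rewrite /s' /s /energy /patch !mem_set//.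
  set S' := \sum_j _; set S := \sum_j _.
  have hS : `|S' - S| <= 6 * (B * Q) * e.
    rewrite /S' /S -sumrB (le_trans (ler_norm_sum _ _ _))//.
    have -> : 6 * (B * Q) * e = 3 * (e * B * (2 * Q)) by ring.
    rewrite mulr_natl -[X in _ *+ X]card_ord -sumr_const.
    apply: ler_sum => j _; rewrite subr_sqr normrM ler_pM//.
    rewrite (le_trans (ler_normD _ _))//.
    by have := p'B j; have := pB j; lra.
  rewrite (_ : _ - _ = (S' - S) - (N (row3 z'.1) - N (row3 z.1))); last by lra.
  rewrite (le_trans (ler_normB _ _))//; lra.
have dcB : `|cutoff d s' - cutoff d s| <= 9 * (B * Q) * (2 + 9 * (B * Q)) * e.
  rewrite (le_trans (cutoff_lipschitz _ _ _))// subr_sqr normrM.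
  rewrite mulrAC ler_pM//.
  rewrite (_ : s' + s = (s' - s) + (s + s)); last by lra.
  rewrite (le_trans (ler_normD _ _))// [leRHS]addrC lerD//.
    rewrite (le_trans dsB)// -[leRHS]mulr1 ler_wpM2l// !mulr_ge0//.
  by rewrite (le_trans (ler_normD _ _))//; lra.
rewrite /phase_fun -/s -/s' !mulr_suml -sumrB.
rewrite (le_trans (ler_norm_sum _ _ _))//.
have -> : (C1 + C2 + C3) * e = (C1 + C2) * e + 3 * (3 * (B * Q) * Q * e +
   B * B * e + B * Q * (9 * (B * Q) * (2 + 9 * (B * Q)) * e)).
  by rewrite /C3; ring.
rewrite ler_wpDl ?mulr_ge0 ?addr_ge0//.
rewrite [leRHS]mulr_natl -[X in _ *+ X]card_ord -sumr_const.
apply: ler_sum => j _; rewrite (le_trans (product3_increment _ _ _ _ _ _))//.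
apply: lerD; [apply: lerD|].
- rewrite -[leRHS]mulr1 ler_pM// (mulrAC _ Q).
  by rewrite ler_pM// (le_trans (lipw j).1).
- rewrite -[leRHS]mulr1 ler_pM// -mulrA (mulrC B e) ler_pM//.
- by rewrite ler_pM// ler_pM// (le_trans (pB j)).
Qed.

End phase_bounds.

(** * Poincare inequality in the energy shell *)

Section phase_poincare.
Context {R : realType}.
Local Notation V := 'rV[R]_3.
Local Notation R6 := (R3 R * R3 R)%type.
Variables (M U : set V) (N : V -> R) (w : 'I_3 -> V -> R).
Variables (h : V -> 'M[R]_3) (D : R).
Hypothesis cM : compact M.
Hypothesis oU : open U.
Hypothesis MU : M `<=` U.
Hypothesis sN : Cdiff 2 U N.
Hypothesis N_gt0 : forall x, M x -> 0 < N x.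
Hypothesis sw : forall j, Cdiff 1 U (w j).
Hypothesis w0 : forall j x, bdry M x -> w j x = 0.
Hypothesis hE : forall x, U x -> h x = N x *: 1%:M.
Hypothesis hD : is_diameter M h D.
Local Notation O := (interior M).

Let OM (x : V) : O x -> M x. Proof. exact: interior_subset. Qed.

Lemma phase_poincare L : D < L -> exists2 d0, 0 < d0 & forall d, 0 < d <= d0 ->
  (\int[lebesgue6]_(z in shell M N d)
     (2 / L ^+ 2 * ((N \_ O) (row3 z.1) * phase_fun M N w d z ^+ 2))%:E <=
   \int[lebesgue6]_(z in shell M N d)
     (phase_derivative M N w d z ^+ 2 / (N \_ O) (row3 z.1))%:E)%E.
Proof.
move=> DL.
have D0 : 0 <= D by exact: (diameter_ge0 hD).
(* One eta is the margin of [exit_bound], one pays for the last step, and two for the shift in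
   [discrete_poincare]; thus L' = D + 4 eta = (D + L) / 2. *)
pose eta := (L - D) / 8.
have eta0 : 0 < eta by rewrite /eta; lra.
have sN1 : Cdiff 1 U N by exact: CdiffW.
have DLe : D < D + eta by lra.
have [d1 d10 Hexit] := exit_bound cM oU MU hE sN1 N_gt0 hD DLe.
have [B B1 HB] := common_bound cM MU sN sw.
have [C C0 HC] := phase_fun_bounds cM MU sN sw w0.
have cN x : M x -> {for x, continuous N}.
  by move=> Mx; exact: (Cdiff_continuous sN (MU Mx)).
have [N0 N00 HN0] := compact_pos_lower_bound cM cN N_gt0.
exists (Num.min d1 1); first by rewrite lt_min d10 ltr01.
move=> d /andP[d0]; rewrite le_min => /andP[dd1 d1'].
pose A := shell M N d.
have mA : measurable A by exact: (measurable_shell MU sN).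
have Afin : (lebesgue6 A < +oo)%E by exact: (shell_fin cM MU sN sw).
pose Nz (z : R6) := (N \_ O) (row3 z.1).
have mNz : measurable_fun [set: R6] Nz.
  have mO := measurable_row3_patch (@open_interior _ M)
    (fun x Ox => cN x (OM Ox)).
  by have := measurableT_comp mO (@measurable_fst _ _ (R3 R) (R3 R)).
have NzE z : A z -> Nz z = N (row3 z.1).
  by move=> [Oz _]; rewrite /Nz /patch mem_set.
have NzB z : A z -> N0 <= Nz z <= B.
  move=> Az; rewrite NzE//; have [/OM Mz _] := Az.
  by rewrite HN0//=; case: (HB _ Mz).
pose f := phase_fun M N w d.
have mf : measurable_fun [set: R6] f by exact: (measurable_phase_fun MU sN sw).
have [fC fL] := HC d (introT andP (conj d0 d1')).
pose es := Num.min (Num.min 1 (d1 / 2)) (eta / B).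
have B0 : 0 < B by lra.
have es0 : 0 < es by rewrite /es !lt_min ltr01 (divr_gt0 d10)// (divr_gt0 eta0).
pose e k : R := es * k.+1%:R^-1.
have e0 k : 0 < e k by rewrite mulr_gt0 ?invr_gt0.
have ees k : e k <= es.
  by rewrite /e ler_piMr ?(ltW es0)// invf_le1// ler1n.
have ecvg : e @ \oo --> 0.
  rewrite -(mulr0 es); apply: cvgM; [exact: cvg_cst|exact: cvg_harmonic].
have e1 k : e k <= 1.
  by rewrite (le_trans (ees k))// /es !ge_min lexx.
have ed1 k : e k < d1.
  rewrite (le_lt_trans (ees k))// /es !gt_min; apply/orP; left; apply/orP; right.
  by rewrite ltr_pdivrMr// ltr_pMr// ltr1n.
have eB k : e k * B <= eta.
  by rewrite -ler_pdivlMr// (le_trans (ees k))// /es ge_min lexx orbT.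
pose Phi k := step M N (e k).
(* [exit_bound] counts m moves, while this sum runs over m + 1 points; the extra term is at most e B
   <= eta. *)
have exitA k m z : (forall i, (i <= m)%N -> A (iter i (Phi k) z)) ->
    \sum_(i < m.+1) e k * Nz (iter i (Phi k) z) <= D + 2 * eta.
  move=> HA.
  have := Hexit (e k) m (fun i => row3 (iter i (Phi k) z).1)
    (fun i => row3 (iter i (Phi k) z).2).
  rewrite e0 ed1 => /(_ isT) Hx.
  have {Hx} : \sum_(i < m) e k * N (row3 (iter i (Phi k) z).1) <= D + eta.
    apply: Hx.
    - by move=> i im; have [/OM] := HA i im.
    - move=> i im; have [Oi] := HA i im.
      by rewrite /energy /patch mem_set// => /ltW /le_trans; apply.
    - move=> i im; have [Oi _] := HA i (ltnW im).
      by apply/rowP => j; rewrite /= step_momentum// !mxE.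
    - by move=> i im; rewrite /= step_position.
  rewrite big_ord_recr/=.
  have -> : \sum_(i < m) e k * Nz (iter i (Phi k) z) =
      \sum_(i < m) e k * N (row3 (iter i (Phi k) z).1).
    by apply: eq_bigr => i _; rewrite NzE//; apply: HA; exact: ltnW.
  have /andP[_ hB] := NzB _ (HA m (leqnn m)).
  have : e k * Nz (iter m (Phi k) z) <= e k * B by rewrite ler_pM2l.
  by have := eB k; lra.
have A0E : forall z, ~ A z -> f z = 0.
  by move=> z nz; exact: phase_fun_out.
pose F k z := ((f (Phi k z) - f z) / e k) ^+ 2 / Nz z.
pose Finf z := phase_derivative M N w d z ^+ 2 / Nz z.
have mF k : measurable_fun [set: R6] (F k).
  apply: measurable_funM; last exact: measurable_funV.
  apply: measurable_funX; apply: measurable_funM => //.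
  apply: measurable_funB => //; apply: measurableT_comp => //.
  exact: (step_preserves oU MU sN (e k)).1.
have Fcvg : (\int[lebesgue6]_(z in A) (F k z)%:E)%E @[k --> \oo] -->
    (\int[lebesgue6]_(z in A) (Finf z)%:E)%E.
  apply: (@dominated_cvg _ _ _ _ _ mA _ _ (fun=> (C ^+ 2 / N0)%:E)).
  - by move=> k; exact: measurable_fun_EFin.
  - move=> z Az; apply: cvg_EFin; first by apply: nearW.
    have H := phase_fun_cvg MU sN sw Az e0 ecvg.
    have H2 := cvgM (cvgM H H) (cvg_cst (Nz z)^-1).
    rewrite /Finf expr2.
    have E : (fun k => F k z) = (fun k => (f (Phi k z) - f z) / e k *
       ((f (Phi k z) - f z) / e k) / Nz z) by apply/funext => k; rewrite /F expr2.
    rewrite -[X in X @ _](_ : (fun k => F k z) = _)//.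
    by rewrite E; exact: H2.
  - by move=> z _.
  - apply/integrableP; split; first exact: measurable_cst.
    rewrite integral_cst//= lte_mul_pinfty// ?lee_fin//.
  - move=> k z Az; rewrite abse_EFin lee_fin.
    have /andP[hN0 _] := NzB _ Az.
    rewrite /F normrM ler_pM//.
      rewrite normrX lerXn2r ?nnegrE// normrM normfV (gtr0_norm (e0 k)).
      by rewrite ler_pdivrMr// fL// e0 e1.
    rewrite normfV lef_pV2 ?posrE// ?normr_gt0 ?gt_eqF// ?(lt_le_trans N00)//.
    by rewrite (le_trans hN0)// ler_norm.
pose L0 := D + 2 * eta.
pose L' := L0 + 2 * eta.
have L'L : L' <= L by rewrite /L' /L0 /eta; lra.
have L'0 : 0 < L' by rewrite /L' /L0; lra.
pose K := C ^+ 2 / (eta * L').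
have K0 : 0 <= K by rewrite divr_ge0 ?sqr_ge0// mulr_ge0// ltW.
have LHS : (\int[lebesgue6]_(z in A) (2 / L ^+ 2 * (Nz z * f z ^+ 2))%:E <=
    \int[lebesgue6]_(z in A) (2 / L' ^+ 2 * (Nz z * f z ^+ 2))%:E)%E.
  have mint c : measurable_fun [set: R6] (fun z => c * (Nz z * f z ^+ 2)).
    by apply: measurable_funM => //; apply: measurable_funM => //;
      exact: measurable_funX.
  have Nz0 z : A z -> 0 <= Nz z.
    by move=> /NzB /andP[+ _]; apply: le_trans; exact: ltW.
  apply: EFin_le_integral => //.
    move=> z /Nz0 hz; apply: mulr_ge0; last by rewrite mulr_ge0 ?sqr_ge0.
    by rewrite divr_ge0 ?sqr_ge0.
  move=> z /Nz0 hz; apply: ler_wpM2r; first by rewrite mulr_ge0 ?sqr_ge0.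
  rewrite ler_pM2l// lef_pV2 ?posrE ?exprn_gt0 ?(lt_le_trans L'0)//.
  by rewrite lerXn2r ?nnegrE ?(le_trans (ltW L'0))// ltW.
have fin_K : (K%:E * lebesgue6 A)%E \is a fin_num.
  by rewrite fin_numM// ge0_fin_numE.
apply: (le_trans LHS); apply/lee_addgt0Pr => om om0.
(* Scaled so that the error term of [discrete_poincare] is at most om; the modulus of continuity of
   N then decides how small the step has to be. *)
pose om' := om / (fine (K%:E * lebesgue6 A) + 1).
have KA0 : 0 <= fine (K%:E * lebesgue6 A).
  by apply: fine_ge0; rewrite mule_ge0.
have om'0 : 0 < om' by rewrite divr_gt0// ltr_wpDl.
have [r r0 Hr] := uniform_modulus cM cN om'0.
have step_small : \forall k \near \oo,
    (\int[lebesgue6]_(z in A) (2 / L' ^+ 2 * (Nz z * f z ^+ 2))%:E <=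
     \int[lebesgue6]_(z in A) (F k z)%:E + om%:E)%E.
  have er : 0 < r / (2 * B + 1) by rewrite divr_gt0//; lra.
  move/cvgrPdist_lt : ecvg => /(_ _ er); apply: filterS => k.
  rewrite sub0r normrN (gtr0_norm (e0 k)) => ekr.
  have Nom z : A z -> A (Phi k z) -> Nz (Phi k z) <= Nz z + om'.
    move=> Az APz; rewrite !NzE//.
    have [Oz _] := Az; have [OPz _] := APz.
    have pB j : `|row3 z.2 0 j| <= B + 1.
      by apply: (shell_momentum j d1' (fun x Mx => let: And4 h _ _ _ := HB x Mx in h) B1 Az).
    have : `|N (row3 (Phi k z).1) - N (row3 z.1)| < om'.
      apply: Hr; [exact: (OM Oz)|exact: (OM OPz)|].
      rewrite step_position addrC addKr normrZ (gtr0_norm (e0 k)).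
      apply: (@le_lt_trans _ _ (e k * (2 * B + 1))); last first.
        by rewrite -ltr_pdivlMr//; lra.
      rewrite ler_pM2l//; apply: norm_le_coord; first lra.
      move=> j; rewrite step_momentum// (le_trans (ler_normD _ _))//.
      have [_ /(_ j) hG _ _] := HB _ (OM Oz).
      have : `|e k * (2^-1 * partial j N (row3 z.1))| <= 1 * (1 * B).
        rewrite normrM ler_pM//; first by rewrite gtr0_norm.
        rewrite normrM ler_pM// gtr0_norm ?invr_gt0// invf_le1// ler1n//.
      by have := pB j; lra.
    by rewrite ltr_norml => /andP[_]; lra.
  have DP := @discrete_poincare _ _ _ lebesgue6 (Phi k) A Nz f (e k) N0 B L0 eta
    C om' (step_preserves oU MU sN (e k)) mA Afin mNz mf (e0 k) N00 NzB
    (exitA k).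
  apply: (le_trans (DP _ (eB k) eta0 fC A0E (ltW om'0) Nom)).
    by rewrite /L0 addr_ge0// mulr_ge0// ltW.
  rewrite leeD2l// -/L' -/K EFinM -muleA -[X in (_ * X)%E]fineK// -EFinM lee_fin.
  rewrite /om' mulrAC ler_pdivrMr ?ltr_wpDl// ler_wpM2l ?(ltW om0)//.
  by rewrite lerDl.
have cvgom : (\int[lebesgue6]_(z in A) (F k z)%:E + om%:E)%E @[k --> \oo] -->
    (\int[lebesgue6]_(z in A) (Finf z)%:E + om%:E)%E.
  by apply: cvgeD => //; [rewrite fin_num_adde_defl|exact: cvg_cst].
by apply: (cvge_to_ge cvgom).
Qed.

End phase_poincare.

(** * Integration over the momenta *)

Section radial.
Context {R : realType}.
Implicit Types (k : R -> R) (F : R3 R -> R).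
Local Notation mu := (@lebesgue3 R).

Definition sqnorm3 (p : R3 R) : R := \sum_j row3 p 0 j ^+ 2.

Lemma sqnorm3E p : sqnorm3 p = p.1.1 ^+ 2 + p.1.2 ^+ 2 + p.2 ^+ 2.
Proof. by rewrite /sqnorm3 sum_ord3 !mxE. Qed.

Lemma sqnorm3_ge0 p : 0 <= sqnorm3 p.
Proof. by apply: sumr_ge0 => j _; exact: sqr_ge0. Qed.

Lemma measurable_sqnorm3 : measurable_fun [set: R3 R] sqnorm3.
Proof.
by apply: measurable_sum => j; apply: measurable_funX; exact: measurable_row3.
Qed.

Let mk k : measurable_fun [set: R] k ->
  measurable_fun [set: R3 R] (fun p => k (sqnorm3 p)).
Proof. by move=> mk; apply: measurableT_comp => //; exact: measurable_sqnorm3. Qed.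

Let rotate k F (T : R3 R -> R3 R) : measurable_fun [set: R] k ->
  (forall s, 0 <= k s) -> measurable_fun [set: R3 R] F -> (forall p, 0 <= F p) ->
  scales_measure mu 1 T -> (forall p, sqnorm3 (T p) = sqnorm3 p) ->
  (\int[mu]_p (F (T p) * k (sqnorm3 p))%:E = \int[mu]_p (F p * k (sqnorm3 p))%:E)%E.
Proof.
move=> mk' k0 mF F0 sT qT.
rewrite -[RHS](ge0_integral_scales_measure sT)//.
- by apply: eq_integral => p _; rewrite qT.
- by apply: measurable_fun_EFin; apply: measurable_funM => //; exact: mk.
- by move=> p; rewrite lee_fin mulr_ge0.
Qed.

(** T preserves both the measure and the radial weight, so F may be replaced by its mean with F o
    T. *)
Let average k F G (T : R3 R -> R3 R) : measurable_fun [set: R] k ->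
  (forall s, 0 <= k s) -> measurable_fun [set: R3 R] F -> (forall p, 0 <= F p) ->
  scales_measure mu 1 T -> (forall p, sqnorm3 (T p) = sqnorm3 p) ->
  (forall p, G p = 2^-1 * F p + 2^-1 * F (T p)) ->
  (\int[mu]_p (F p * k (sqnorm3 p))%:E = \int[mu]_p (G p * k (sqnorm3 p))%:E)%E.
Proof.
move=> mk' k0 mF F0 sT qT GE.
have m1 : measurable_fun setT (fun p => F p * k (sqnorm3 p)).
  by apply: measurable_funM => //; exact: mk.
have m2 : measurable_fun setT (fun p => F (T p) * k (sqnorm3 p)).
  by apply: measurable_funM; [exact: (measurableT_comp mF sT.1)|exact: mk].
have -> : (\int[mu]_p (G p * k (sqnorm3 p))%:E = \int[mu]_p
    (2^-1 * (F p * k (sqnorm3 p)) + 2^-1 * (F (T p) * k (sqnorm3 p)))%:E)%E.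
  by apply: eq_integral => p _; rewrite GE mulrDl !mulrA.
rewrite EFin_integralD//; [|exact: measurable_funM|exact: measurable_funM
  |by move=> p _; rewrite !mulr_ge0|by move=> p _; rewrite !mulr_ge0].
rewrite !EFin_integralZl//; [|by move=> p _; rewrite !mulr_ge0
  |by move=> p _; rewrite !mulr_ge0].
rewrite (rotate mk' k0 mF F0 sT qT) -ge0_muleDl ?lee_fin//.
by rewrite -EFinD (_ : 2^-1 + 2^-1 = 1 :> R) ?mul1e//; field.
Qed.

Let half12 (p : R3 R) : R3 R := (- p.1.1, - p.1.2, p.2).
Let half23 (p : R3 R) : R3 R := (p.1.1, - p.1.2, - p.2).
Let turn12 (p : R3 R) : R3 R := (- p.1.2, p.1.1, p.2).
Let turn23 (p : R3 R) : R3 R := (p.1.1, - p.2, p.1.2).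

Let turn12E : shears12 (-1) 1 = turn12.
Proof.
by apply/funext => -[[a b] c]; rewrite /shears12 /turn12 /=; congr (_, _, _); ring.
Qed.

Let turn23E : shears23 (-1) 1 = turn23.
Proof.
by apply/funext => -[[a b] c]; rewrite /shears23 /turn23 /=; congr (_, _, _); ring.
Qed.

Let scales_turn12 : scales_measure mu 1 turn12.
Proof. by rewrite -turn12E; exact: scales_measure_shears12. Qed.

Let scales_turn23 : scales_measure mu 1 turn23.
Proof. by rewrite -turn23E; exact: scales_measure_shears23. Qed.

Let scales_half12 : scales_measure mu 1 half12.
Proof.
have := scales_measure_comp scales_turn12 scales_turn12; rewrite mulr1.
by rewrite (_ : turn12 \o turn12 = half12)//.
Qed.

Let scales_half23 : scales_measure mu 1 half23.
Proof.
have := scales_measure_comp scales_turn23 scales_turn23; rewrite mulr1.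
by rewrite (_ : turn23 \o turn23 = half23)//.
Qed.

(* Averaging over the half turns about the axes removes the mixed products,
   and quarter turns exchange the squares of the coordinates. *)
Lemma radial_second_moment k (w : 'rV[R]_3) : measurable_fun [set: R] k ->
  (forall s, 0 <= k s) ->
  (\int[mu]_p ((\sum_j w 0 j * row3 p 0 j) ^+ 2 * k (sqnorm3 p))%:E =
   ((\sum_j w 0 j ^+ 2) / 3)%:E * \int[mu]_p (sqnorm3 p * k (sqnorm3 p))%:E)%E.
Proof.
move=> mk' k0.
have mr j := @measurable_row3 R j.
pose F1 (p : R3 R) := (\sum_j w 0 j * row3 p 0 j) ^+ 2.
pose F2 (p : R3 R) := (w 0 0 * row3 p 0 0 + w 0 1 * row3 p 0 1) ^+ 2
  + (w 0 2%:R * row3 p 0 2%:R) ^+ 2.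
pose F3 (p : R3 R) := \sum_j w 0 j ^+ 2 * row3 p 0 j ^+ 2.
have mF1 : measurable_fun setT F1.
  by apply: measurable_funX; apply: measurable_sum => j; exact: measurable_funM.
have mF2 : measurable_fun setT F2.
  by apply: measurable_funD; apply: measurable_funX; [apply: measurable_funD|];
    exact: measurable_funM.
rewrite (@average k F1 F2 half12)//; [|by move=> p; exact: sqr_ge0
  |by move=> p; rewrite !sqnorm3E /half12/= !sqrrN|]; last first.
  by move=> p; rewrite /F1 /F2 !sum_ord3 !mxE/=; field.
rewrite (@average k F2 F3 half23)//; [|by move=> p; rewrite addr_ge0 ?sqr_ge0
  |by move=> p; rewrite !sqnorm3E /half23/= !sqrrN|]; last first.
  by move=> p; rewrite /F2 /F3 !sum_ord3 !mxE/=; field.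
have mc j : measurable_fun setT (fun p : R3 R => row3 p 0 j ^+ 2 * k (sqnorm3 p)).
  by apply: measurable_funM; [exact: measurable_funX|exact: mk].
pose c j := (\int[mu]_p (row3 p 0 j ^+ 2 * k (sqnorm3 p))%:E)%E.
have c0 j : (0 <= c j)%E.
  by apply: integral_ge0 => p _; rewrite lee_fin mulr_ge0 ?sqr_ge0.
have sumc (a : 'I_3 -> R) : (forall j, 0 <= a j) ->
    (\int[mu]_p ((\sum_j a j * row3 p 0 j ^+ 2) * k (sqnorm3 p))%:E =
     (a 0%R)%:E * c 0%R + (a 1%R)%:E * c 1%R + (a 2%:R)%:E * c 2%:R)%E.
  move=> a0; rewrite -!EFin_integralZl//;
    try by move=> p _; rewrite mulr_ge0 ?sqr_ge0.
  have mac j : measurable_fun setT (fun p : R3 R => a j * (row3 p 0 j ^+ 2 * k (sqnorm3 p))).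
    exact: measurable_funM.
  have ac0 j p : [set: R3 R] p -> 0 <= a j * (row3 p 0 j ^+ 2 * k (sqnorm3 p)).
    by move=> _; rewrite mulr_ge0// mulr_ge0// sqr_ge0.
  rewrite -!EFin_integralD//; try exact: measurable_funD;
    try by move=> p Tp; rewrite ?addr_ge0 ?ac0.
  by apply: eq_integral => p _; rewrite sum_ord3 !mulrDl !mulrA.
have c10 : c 1 = c 0.
  rewrite /c -(@rotate k _ turn12)//; [|exact: measurable_funX
    |by move=> p; exact: sqr_ge0|by move=> p; rewrite !sqnorm3E/=; ring].
  by apply: eq_integral => p _; rewrite !mxE/=.
have c21 : c 2%:R = c 1.
  rewrite /c -(@rotate k _ turn23)//; [|exact: measurable_funX
    |by move=> p; exact: sqr_ge0|by move=> p; rewrite !sqnorm3E/=; ring].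
  by apply: eq_integral => p _; rewrite !mxE/=.
have -> : (\int[mu]_p (sqnorm3 p * k (sqnorm3 p))%:E = \int[mu]_p
    ((\sum_j 1 * row3 p 0 j ^+ 2) * k (sqnorm3 p))%:E)%E.
  by apply: eq_integral => p _; rewrite /sqnorm3; under [in RHS]eq_bigr do rewrite mul1r.
rewrite !sumc//; last by move=> j; exact: sqr_ge0.
rewrite c21 c10 -!ge0_muleDl ?adde_ge0 ?lee_fin ?sqr_ge0//.
rewrite muleA -!EFinD -EFinM sum_ord3; congr (_%:E * _)%E.
by field.
Qed.

End radial.

(** * Volume of a thin shell in momentum space *)

Section shell_weight.
Context {R : realType}.
Local Notation mu := (@lebesgue3 R).
Local Notation leb := (@lebesgue_measure R).
Local Notation sq := (@sqnorm3 R).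

(** The parameter is the squared radius, the quantity that enters the energy; volumes therefore
    scale with its power 3/2. *)
Let ball (r : R) : set (R3 R) := [set p | sq p < r].
Let cball (r : R) : set (R3 R) := [set p | sq p <= r].

Let mball r : measurable (ball r).
Proof.
rewrite (_ : ball r = setT `&` sq @^-1` `]-oo, r[).
  by apply: measurable_sqnorm3 => //; exact: measurable_itv.
by apply/seteqP; split=> p /=; rewrite in_itv/=; [|case].
Qed.

Let mcball r : measurable (cball r).
Proof.
rewrite (_ : cball r = setT `&` sq @^-1` `]-oo, r]).
  by apply: measurable_sqnorm3 => //; exact: measurable_itv.
by apply/seteqP; split=> p /=; rewrite in_itv/=; [|case].
Qed.

Let cball_fin r : (mu (cball r) < +oo)%E.
Proof.
have mcube := measurable_cube (`|r| + 1).
apply: le_lt_trans (lebesgue3_cube_fin (`|r| + 1)).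
apply: le_measure; rewrite ?inE// => p /= pr j.
have r0 := normr_ge0 r.
rewrite -(@ler_pXn2r _ 2) ?nnegrE ?addr_ge0//.
have : `|row3 p 0 j| ^+ 2 <= sq p.
  rewrite real_normK ?num_real// /sqnorm3 (bigD1 j)//= lerDl.
  by apply: sumr_ge0 => i _; exact: sqr_ge0.
move=> /le_trans -> //; apply: (le_trans pr); apply: (le_trans (ler_norm r)).
by rewrite sqrrD1 -[leLHS]addr0 lerD// ?mulr_ge0// addrC mulr2n; nra.
Qed.

Let ball_le_cball r : (mu (ball r) <= mu (cball r))%E.
Proof. by apply: le_measure; rewrite ?inE// => p /= /ltW. Qed.

Let ball_fin r : mu (ball r) \is a fin_num.
Proof. by rewrite ge0_fin_numE// (le_lt_trans (ball_le_cball r)). Qed.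

Let scaled (a : R) (p : R3 R) : sq (a * p.1.1, a * p.1.2, a * p.2) = a ^+ 2 * sq p.
Proof. by rewrite !sqnorm3E/=; ring. Qed.

Let ball_dilation r : 0 < r -> mu (ball r) = ((Num.sqrt r ^+ 3)%:E * mu (ball 1))%E.
Proof.
move=> r0; have s0 : 0 < (Num.sqrt r)^-1 by rewrite invr_gt0 sqrtr_gt0.
have [_ H] := lebesgue3_dilation s0; rewrite -[in RHS](invrK (Num.sqrt r)) -H//.
congr (mu _); apply/seteqP; split => p /=; rewrite /ball/= scaled exprVn;
  by rewrite (sqr_sqrtr (ltW r0)) mulrC ltr_pdivrMr// mul1r.
Qed.

Let cball_dilation r : 0 < r -> mu (cball r) = ((Num.sqrt r ^+ 3)%:E * mu (cball 1))%E.
Proof.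
move=> r0; have s0 : 0 < (Num.sqrt r)^-1 by rewrite invr_gt0 sqrtr_gt0.
have [_ H] := lebesgue3_dilation s0; rewrite -[in RHS](invrK (Num.sqrt r)) -H//.
congr (mu _); apply/seteqP; split => p /=; rewrite /cball/= scaled exprVn;
  by rewrite (sqr_sqrtr (ltW r0)) mulrC ler_pdivrMr// mul1r.
Qed.

Let V1 := fine (mu (ball 1)).

Let V1_gt0 : 0 < V1.
Proof.
pose I : set (measurableTypeR R) := `[0, 2^-1]%classic.
have mI : measurable I by exact: measurable_itv.
have lebI : leb I = (2^-1)%:E.
  by rewrite /I lebesgue_measure_itv/= lte_fin invr_gt0 ltr0n oppr0 adde0.
have le : (mu ((I `*` I) `*` I) <= mu (ball 1))%E.
  apply: le_measure; rewrite ?inE//; first by do 2 ?apply: measurableX.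
  move=> p /=; rewrite /I/= !in_itv/= /ball/= sqnorm3E.
  move=> [[/andP[? ?] /andP[? ?]] /andP[? ?]].
  have h (x : R) : 0 <= x -> x <= 2^-1 -> x ^+ 2 <= 4^-1.
    by move=> ? ?; rewrite expr2; nra.
  by have := h p.1.1; have := h p.1.2; have := h p.2; lra.
have : (0 < mu (ball 1))%E.
  apply: lt_le_trans le; rewrite /lebesgue3 product_measure1E//=; last exact: measurableX.
  by rewrite /lebesgue2 product_measure1E//= lebI !mule_gt0// lte_fin.
by move=> h; rewrite /V1 fine_gt0// h/= ltey_eq ball_fin.
Qed.

Let V1E : mu (ball 1) = V1%:E.
Proof. by rewrite /V1 fineK. Qed.

(* The unit sphere is null since the closed ball lies in every larger open
   ball. *)
Let cball1 : mu (cball 1) = V1%:E.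
Proof.
apply/le_anti/andP; split; last by rewrite -V1E; exact: ball_le_cball.
have fc : mu (cball 1) \is a fin_num by rewrite ge0_fin_numE.
rewrite -(fineK fc) lee_fin; set c := fine _.
have le t : 1 < t -> c <= t ^+ 3 * V1.
  move=> t1; rewrite -lee_fin /c fineK//.
  have t0 : 0 < t by exact: lt_trans t1.
  have := ball_dilation (exprn_gt0 2 t0); rewrite sqrtr_sqr (gtr0_norm t0) V1E -EFinM.
  move=> <-; apply: le_measure; rewrite ?inE// => p /= /le_lt_trans; apply.
  by rewrite expr2; nra.
have cv : (fun t : R => t ^+ 3 * V1) t @[t --> 1^'+] --> 1 ^+ 3 * V1.
  apply: cvg_at_right_filter; apply: cvgM; last exact: cvg_cst.
  by apply: (@exprn_continuous _ 3).
rewrite -[leRHS]mul1r -{1}(expr1n _ 3).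
apply: (cvgr_to_ge cv); near=> t; apply: le; near: t.
exact: nbhs_right_gt.
Unshelve. all: by end_near. Qed.

Let thin (tau th : R) : set (R3 R) := [set p | `|sq p - tau| < th].

Let mu_thin tau th : 0 < th -> th < tau ->
  mu (thin tau th) = (V1 * (Num.sqrt (tau + th) ^+ 3 - Num.sqrt (tau - th) ^+ 3))%:E.
Proof.
move=> th0 tht.
have -> : thin tau th = ball (tau + th) `\` cball (tau - th).
  apply/seteqP; split => p; rewrite /thin /ball /cball /= ltr_norml.
    by move=> /andP[? ?]; split; [lra|apply/negP; rewrite -ltNge; lra].
  by move=> [? /negP]; rewrite -ltNge => ?; apply/andP; split; lra.
have fb : (mu (ball (tau + th)) < +oo)%E.
  by rewrite (le_lt_trans (ball_le_cball _)).
have bI : ball (tau + th) `&` cball (tau - th) = cball (tau - th).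
  by apply/setIidPr => p; rewrite /ball /cball /= => ?; lra.
have := measureD (mball (tau + th)) (mcball (tau - th)) fb.
have b0 : 0 < tau + th by lra.
have c0 : 0 < tau - th by lra.
rewrite bI => ->; move: (ball_dilation b0) (cball_dilation c0) => /= -> ->.
by rewrite V1E cball1 -!EFinM -EFinB; congr (_%:E); ring.
Qed.

(** For A = sqrt (tau + th) and B = sqrt (tau - th) these are mean value bounds for the power 3/2;
    each gap is (A - B)^2 times a nonnegative factor. *)
Let cube_diff (A B th : R) : 0 <= B -> B <= A -> A ^+ 2 - B ^+ 2 = 2 * th ->
  3 * th * B <= A ^+ 3 - B ^+ 3 <= 3 * th * A.
Proof.
move=> B0 AB E; have -> : th = (A ^+ 2 - B ^+ 2) / 2 by rewrite E; field.
have h : 0 <= (A - B) ^+ 2 by exact: sqr_ge0.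
have h1 : 0 <= (A - B) ^+ 2 * (A + B / 2) by rewrite mulr_ge0//; lra.
have h2 : 0 <= (A - B) ^+ 2 * (A / 2 + B) by rewrite mulr_ge0//; lra.
by rewrite -subr_ge0 -[X in _ && X]subr_ge0; apply/andP; split;
  [move: h1|move: h2]; congr (0 <= _); field.
Qed.

(** tau enters the bounds through the square root only and th as a linear factor, so integration
    over th will separate the two. *)
Let thin_bounds d tau th : 0 <= th -> th <= d -> d < tau ->
  ((3 * V1 * th * Num.sqrt (tau - d))%:E <= mu (thin tau th)
   <= (3 * V1 * th * Num.sqrt (tau + d))%:E)%E.
Proof.
rewrite le_eqVlt => /orP[/eqP <- _ _|th0 thd dtau].
  rewrite mulr0 !mul0r (_ : thin _ _ = set0) ?measure0 ?lexx//.
  by apply/seteqP; split => // p; rewrite /thin/= ltNge normr_ge0.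
rewrite mu_thin ?(le_lt_trans thd)// !lee_fin.
have V0 := V1_gt0.
have /andP[h1 h2] : 3 * th * Num.sqrt (tau - th) <=
    Num.sqrt (tau + th) ^+ 3 - Num.sqrt (tau - th) ^+ 3 <=
    3 * th * Num.sqrt (tau + th).
  apply: cube_diff; first exact: sqrtr_ge0.
    by rewrite ler_sqrt; lra.
  by rewrite !sqr_sqrtr; lra.
have h3 : Num.sqrt (tau - d) <= Num.sqrt (tau - th) by rewrite ler_sqrt; lra.
have h4 : Num.sqrt (tau + th) <= Num.sqrt (tau + d) by rewrite ler_sqrt; lra.
have th3 : 0 < 3 * th by lra.
apply/andP; split.
  rewrite (_ : 3 * V1 * th = V1 * (3 * th)) -?mulrA; last by ring.
  rewrite ler_pM2l// (le_trans _ h1)// mulrA ler_pM2l//.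
rewrite (_ : 3 * V1 * th = V1 * (3 * th)) -?mulrA; last by ring.
by rewrite ler_pM2l// (le_trans h2)// mulrA ler_pM2l.
Qed.

(** Half-width in energy of the layer where the squared cutoff exceeds u. As the square root of a
    negative number is 0, the layer is empty for u >= d^4. *)
Let theta (d u : R) := Num.sqrt (d ^+ 2 - Num.sqrt u).

Let cutoff_layer d s u : 0 <= u -> (u < cutoff d s ^+ 2) = (`|s| < theta d u).
Proof.
move=> u0; rewrite /cutoff /theta.
rewrite -{1}(sqr_sqrtr u0) ltr_pXn2r ?nnegrE ?sqrtr_ge0 ?le_max ?lexx//.
rewrite lt_max ltNge sqrtr_ge0/= -sqrtr_sqr.
have [h|h] := ltP 0 (d ^+ 2 - Num.sqrt u).
  by rewrite ltr_sqrt//; apply/idP/idP => ?; lra.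
rewrite (ler0_sqrtr h) ltNge [RHS]ltNge sqrtr_ge0/=.
by apply/negbF; have := sqr_ge0 s; lra.
Qed.

Let msqrt : measurable_fun [set: R] (@Num.sqrt R).
Proof. by apply: continuous_measurable_fun; exact: sqrt_continuous. Qed.

Let mtheta d : measurable_fun [set: R] (theta d).
Proof.
by apply: measurableT_comp => //; exact: measurable_funB.
Qed.

Let mcutoff d tau : measurable_fun [set: R3 R] (fun p => cutoff d (sq p - tau) ^+ 2).
Proof.
apply: measurable_funX; apply: measurable_maxr => //.
apply: measurable_funB => //; apply: measurable_funX; apply: measurable_funB => //.
exact: measurable_sqnorm3.
Qed.

(* Layer-cake integration over the values of the squared cutoff reduces this
   to the volumes of thin spherical shells. *)
Lemma shell_weight d : 0 < d -> exists2 c, 0 < c & forall tau, d < tau ->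
  ((c * Num.sqrt (tau - d))%:E <=
   \int[mu]_p (cutoff d (sqnorm3 p - tau) ^+ 2)%:E <=
   (c * Num.sqrt (tau + d))%:E)%E.
Proof.
move=> d0.
pose I : set (measurableTypeR R) := `[0, d ^+ 4]%classic.
have mI : measurable I by exact: measurable_itv.
have Ifin : (leb I < +oo)%E.
  by rewrite /I lebesgue_measure_itv/=; case: ifPn; rewrite // -EFinB ltry.
pose g u := 3 * V1 * theta d u.
have V0 := V1_gt0.
have th0 u : 0 <= theta d u by exact: sqrtr_ge0.
have thd u : theta d u <= d.
  rewrite -[leRHS](ger0_norm (ltW d0)) -sqrtr_sqr ler_sqrt ?sqr_ge0//.
  by rewrite gerBl sqrtr_ge0.
have mg : measurable_fun [set: R] g by apply: measurable_funM => //; exact: mtheta.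
have g0 u : 0 <= g u.
  by rewrite /g; apply: mulr_ge0 => //; apply: mulr_ge0 => //; exact: ltW.
have gfin : (\int[leb]_(u in I) (g u)%:E)%E \is a fin_num.
  apply: (@EFin_integral_fin_num _ _ _ leb I mI g (3 * V1 * d)) => // u _.
  by rewrite g0/= /g ler_pM2l ?mulr_gt0.
(* The integral of 3 V1 theta over all layers, independent of tau. It is positive because theta is
   at least sqrt (d^2 / 2) on the layers up to (d^2 / 2)^2. *)
exists (fine (\int[leb]_(u in I) (g u)%:E)%E).
  pose J : set (measurableTypeR R) := `[0, (d ^+ 2 / 2) ^+ 2]%classic.
  have mJ : measurable J by exact: measurable_itv.
  have d20 : 0 < d ^+ 2 / 2 by rewrite divr_gt0// exprn_gt0.
  have JI : J `<=` I.
    move=> u; rewrite /J /I /= !in_itv/= => /andP[-> /le_trans]; apply.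
    by rewrite (_ : d ^+ 4 = (d ^+ 2) ^+ 2); [nra|ring].
  have gJ u : J u -> 3 * V1 * Num.sqrt (d ^+ 2 / 2) <= g u.
    rewrite /J/= in_itv/= => /andP[u0 uJ].
    rewrite /g ler_pM2l ?mulr_gt0// /theta ler_sqrt; last first.
      have := ler_sqrt u (sqr_ge0 (d ^+ 2 / 2)); rewrite uJ sqrtr_sqr gtr0_norm//.
      by move=> ?; lra.
    have := ler_sqrt u (sqr_ge0 (d ^+ 2 / 2)); rewrite uJ sqrtr_sqr gtr0_norm//.
    by move=> ?; lra.
  apply: fine_gt0; rewrite ltey_eq gfin andbT.
  apply: (@lt_le_trans _ _ (\int[leb]_(u in J) (3 * V1 * Num.sqrt (d ^+ 2 / 2))%:E)%E).
    have lebJ : (0 < leb J)%E.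
      by rewrite /J lebesgue_measure_itv/= lte_fin exprn_gt0//= oppr0 adde0 lte_fin exprn_gt0.
    rewrite integral_cst//; apply: mule_gt0 => //.
    by rewrite lte_fin !mulr_gt0// sqrtr_gt0.
  apply: (@le_trans _ _ (\int[leb]_(u in J) (g u)%:E)%E).
    apply: EFin_le_integral => // u _.
    by apply: mulr_ge0; [apply: mulr_ge0 => //; exact: ltW|exact: sqrtr_ge0].
  apply: ge0_subset_integral => //; first exact: measurable_fun_EFin.
  by move=> u _; rewrite lee_fin.
move=> tau dtau.
pose ct p := cutoff d (sq p - tau) ^+ 2.
have ctd p : ct p <= d ^+ 4.
  rewrite /ct; have /andP[h1 h2] := cutoff_bounds d (sq p - tau).
  by rewrite (_ : d ^+ 4 = (d ^+ 2) ^+ 2); [rewrite lerXn2r ?nnegrE ?sqr_ge0|ring].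
pose S : set (R3 R * measurableTypeR R) := [set z | 0 <= z.2 < ct z.1].
have mS : measurable S.
  have -> : S = (setT `&` snd @^-1` `[0, +oo[) `&`
      (setT `&` (fun z : R3 R * measurableTypeR R => ct z.1 - z.2) @^-1` `]0, +oo[).
    apply/seteqP; split => z /=; rewrite /S/= !in_itv/= !andbT subr_gt0.
      by move=> /andP[].
    by move=> [[_ ->] [_ ->]].
  apply: measurableI; first by apply: measurable_snd => //; exact: measurable_itv.
  have mf : measurable_fun [set: R3 R * measurableTypeR R] (fun z => ct z.1 - z.2).
    apply: measurable_funB; last exact: measurable_snd.
    exact: (measurableT_comp (mcutoff d tau) measurable_fst).
  by apply: mf => //; exact: measurable_itv.
have -> : (\int[mu]_p (ct p)%:E = \int[leb]_u mu (ysection S u))%E.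
  have <- : ((mu \x leb) S = \int[leb]_u mu (ysection S u))%E.
    apply: (@product_measure_unique _ _ _ _ _ mu leb
      (mu \x^ leb : {measure set _ -> \bar R})%E) => // A A' mA mA'.
    exact: product_measure2E.
  apply: eq_integral => p _ /=.
  have -> : xsection S p = `[0, ct p[%classic.
    by apply/seteqP; split => u /=; rewrite xsectionE/= in_itv/=.
  rewrite lebesgue_measure_itv/= lte_fin oppr0 adde0; case: ifPn => //.
  by rewrite -leNgt => h; congr (_%:E); apply/eqP; rewrite eq_le h sqr_ge0.
have -> : (\int[leb]_u mu (ysection S u) = \int[leb]_(u in I) mu (thin tau (theta d u)))%E.
  rewrite [RHS]integral_mkcond; apply: eq_integral => u _.
  rewrite /patch; case: ifPn; rewrite ?inE ?notin_setE /I/= in_itv/=.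
    move=> /andP[u0 _]; congr (mu _); apply/seteqP; split => p;
    by rewrite ysectionE /S/= u0/= cutoff_layer.
  move=> nu; rewrite (_ : ysection S u = set0) ?measure0//.
  apply/seteqP; split => // p; rewrite ysectionE /S/= => /andP[u0 up].
  by apply: nu; rewrite u0 (le_trans (ltW up)).
have mthin : measurable_fun I (fun u => mu (thin tau (theta d u))).
  have : measurable_fun I (fun u => mu (ysection S u)).
    by apply: measurable_funTS; exact: measurable_fun_ysection.
  apply: eq_measurable_fun => u; rewrite inE /I/= in_itv/= => /andP[u0 _].
  congr (mu _); apply/seteqP; split => p;
  by rewrite ysectionE /S/= u0/= cutoff_layer.
have gb u := thin_bounds (th0 u) (thd u) dtau.
have scal K : 0 <= K -> ((fine (\int[leb]_(u in I) (g u)%:E)%E * K)%:E =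
    \int[leb]_(u in I) (g u * K)%:E)%E.
  move=> K0; have -> : (\int[leb]_(u in I) (g u * K)%:E =
      \int[leb]_(u in I) (K * g u)%:E)%E.
    by apply: eq_integral => u _; rewrite mulrC.
  rewrite (EFin_integralZl leb mI mg (fun u _ => g0 u) K0).
  by rewrite -[X in (_ * X)%E](fineK gfin) -EFinM mulrC.
rewrite !scal ?sqrtr_ge0//; apply/andP; split.
  apply: ge0_le_integral => //.
  - by move=> u _; rewrite lee_fin mulr_ge0 ?sqrtr_ge0.
  - by apply: measurable_fun_EFin; exact: measurable_funM.
  - by move=> u _; have /andP[] := gb u.
apply: ge0_le_integral => //.
- by apply: measurable_fun_EFin; exact: measurable_funM.
- by move=> u _; have /andP[] := gb u.
Qed.

End shell_weight.

Section momentum_integrals.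
Context {R : realType}.
Local Notation mu := (@lebesgue3 R).
Local Notation sq := (@sqnorm3 R).
Variables (d tau c : R).
Hypothesis d_gt0 : 0 < d.
Hypothesis d_tau : d < tau.
Hypothesis lower : ((c * Num.sqrt (tau - d))%:E <=
   \int[mu]_p (cutoff d (sq p - tau) ^+ 2)%:E)%E.
Hypothesis upper : (\int[mu]_p (cutoff d (sq p - tau) ^+ 2)%:E <=
   (c * Num.sqrt (tau + d))%:E)%E.

Let k s := cutoff d (s - tau) ^+ 2.

Let k0 s : 0 <= k s. Proof. exact: sqr_ge0. Qed.

Let mk : measurable_fun [set: R] k.
Proof.
apply: measurable_funX; apply: measurable_maxr => //.
by apply: measurable_funB => //; apply: measurable_funX; exact: measurable_funB.
Qed.

Let mksq : measurable_fun [set: R3 R] (fun p => k (sq p)).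
Proof. by apply: measurableT_comp => //; exact: measurable_sqnorm3. Qed.

Let k_supp s : k s = 0 \/ `|s - tau| < d.
Proof.
have [h|h] := ltP `|s - tau| d; first by right.
by left; rewrite /k cutoff_out// expr0n.
Qed.

Let msq : measurable_fun [set: R3 R] sq.
Proof. exact: measurable_sqnorm3. Qed.

Lemma momentum_lower (w : 'rV[R]_3) :
  (((\sum_j w 0 j ^+ 2) / 3 * ((tau - d) * (c * Num.sqrt (tau - d))))%:E <=
  \int[mu]_p ((\sum_j w 0 j * row3 p 0 j) ^+ 2 * k (sq p))%:E)%E.
Proof.
have td : 0 <= tau - d by move: d_tau; lra.
rewrite radial_second_moment// EFinM.
apply: lee_wpmul2l; first by rewrite lee_fin divr_ge0// sumr_ge0// => j _; exact: sqr_ge0.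
rewrite EFinM; apply: (@le_trans _ _ ((tau - d)%:E * \int[mu]_p (k (sq p))%:E)%E).
  by apply: lee_wpmul2l => //; rewrite lee_fin.
rewrite -(EFin_integralZl mu measurableT mksq)//.
apply: EFin_le_integral => //.
- exact: measurable_funM.
- exact: measurable_funM.
- by move=> p _; apply: mulr_ge0.
- move=> p _; have [->|] := k_supp (sq p); first by rewrite !mulr0.
  by rewrite ltr_norml => /andP[? _]; apply: ler_wpM2r => //; lra.
Qed.

Let quad_bound (S : 'I_3 -> 'I_3 -> R) (p : 'rV[R]_3) :
  (\sum_j (\sum_l S j l * p 0 l) * p 0 j) ^+ 2 <=
  (\sum_j p 0 j ^+ 2) * \sum_j (\sum_l S j l * p 0 l) ^+ 2.
Proof.
pose g j := \sum_l S j l * p 0 l.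
rewrite (sum_ord3 (fun j => g j * p 0 j)) (sum_ord3 (fun j => p 0 j ^+ 2)).
rewrite (sum_ord3 (fun j => g j ^+ 2)).
move: (g 0) (g 1) (g 2%:R) => a b e.
move: (p 0 0) (p 0 1) (p 0 2%:R) => x y z.
rewrite -subr_ge0 (_ : _ - _ = (a * y - b * x) ^+ 2 + (a * z - e * x) ^+ 2
  + (b * z - e * y) ^+ 2); last by ring.
by rewrite !addr_ge0 ?sqr_ge0.
Qed.

(** Cauchy-Schwarz replaces the fourth-order term S(p, p)^2 by |p|^2 |S p|^2, a radial factor times
    squares of linear forms, so [radial_second_moment] applies row by row. Its factor 1/3 also
    occurs in [momentum_lower] and cancels against it. The term with b carries the energy, less than
    d on the support, and disappears with d. *)
Lemma momentum_upper (S : 'I_3 -> 'I_3 -> R) (b : R) :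
  (\int[mu]_p ((\sum_j (\sum_l S j l * row3 p 0 l) * row3 p 0 j
      - (sq p - tau) * b) ^+ 2 * k (sq p))%:E <=
   (((1 + d) * (tau + d) ^+ 2 * ((\sum_j \sum_l S j l ^+ 2) / 3) +
     (d + d ^+ 2) * b ^+ 2) * (c * Num.sqrt (tau + d)))%:E)%E.
Proof.
have dp := d_gt0; have dt := d_tau.
have mr j := @measurable_row3 R j.
pose A (j : 'I_3) (p : R3 R) := (\sum_l S j l * row3 p 0 l) ^+ 2.
have mA j : measurable_fun [set: R3 R] (A j).
  by apply: measurable_funX; apply: measurable_sum => l; exact: measurable_funM.
have A0 j p : 0 <= A j p by exact: sqr_ge0.
have mAk j : measurable_fun [set: R3 R] (fun p => A j p * k (sq p)).
  exact: measurable_funM.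
have Ak0 j p : 0 <= A j p * k (sq p) by exact: mulr_ge0.
have dtau0 : 0 <= (1 + d) * (tau + d) by rewrite mulr_ge0; lra.
have db0 : 0 <= (d + d ^+ 2) * b ^+ 2.
  by rewrite mulr_ge0 ?sqr_ge0// addr_ge0 ?sqr_ge0//; lra.
pose G p := (1 + d) * (tau + d) * (A 0 p * k (sq p) + A 1 p * k (sq p)
  + A 2%:R p * k (sq p)) + (d + d ^+ 2) * b ^+ 2 * k (sq p).
apply: (@le_trans _ _ (\int[mu]_p (G p)%:E)%E).
  apply: EFin_le_integral => //.
  - apply: measurable_funM => //; apply: measurable_funX.
    apply: measurable_funB; last first.
      by apply: measurable_funM => //; exact: measurable_funB.
    apply: measurable_sum => j; apply: measurable_funM => //.
    by apply: measurable_sum => l; exact: measurable_funM.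
  - apply: measurable_funD; apply: measurable_funM => //.
    by apply: measurable_funD => //; exact: measurable_funD.
  - by move=> p _; apply: mulr_ge0 => //; exact: sqr_ge0.
  - move=> p _; rewrite /G -!mulrDl mulrA -mulrDl.
    have [->|] := k_supp (sq p); first by rewrite !mulr0.
    move=> kd; apply: ler_wpM2r => //.
    have sqp0 := sqnorm3_ge0 p.
    set s := sq p - tau in kd *.
    have sd : s ^+ 2 <= d ^+ 2.
      rewrite -(real_normK (num_real s)) ler_pXn2r ?nnegrE ?normr_ge0 ?(ltW dp)//.
      exact: ltW kd.
    have sptd : sq p <= tau + d.
      by move: kd; rewrite /s ltr_norml => /andP[_ ?]; lra.
    have := quad_bound S (row3 p); rewrite -/(sq p) (sum_ord3 (fun j => A j p)).
    set Q := \sum_j _; move=> QA.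
    have A3 : 0 <= A 0 p + A 1 p + A 2%:R p by rewrite !addr_ge0.
    have QA2 : Q ^+ 2 <= (tau + d) * (A 0 p + A 1 p + A 2%:R p).
      by rewrite (le_trans QA)// ler_wpM2r.
    (* Young's inequality with weights d and 1/d *)
    have Y : (Q - s * b) ^+ 2 <= (1 + d) * Q ^+ 2 + (1 + d^-1) * (s ^+ 2 * b ^+ 2).
      rewrite -subr_ge0 (_ : _ - _ = d^-1 * (d * Q + s * b) ^+ 2).
        by rewrite mulr_ge0 ?sqr_ge0// invr_ge0 ltW.
      by field; rewrite gt_eqF.
    apply: (le_trans Y); apply: lerD.
      by rewrite -mulrA ler_wpM2l//; lra.
    rewrite mulrA ler_wpM2r ?sqr_ge0//.
    have -> : d + d ^+ 2 = (1 + d^-1) * d ^+ 2 by field; rewrite gt_eqF.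
    by rewrite ler_wpM2l// addr_ge0// invr_ge0 ltW.
rewrite EFin_integralD//; last 4 first.
- by apply: measurable_funM => //; apply: measurable_funD => //; exact: measurable_funD.
- exact: measurable_funM.
- by move=> p _; apply: mulr_ge0 => //; rewrite !addr_ge0.
- by move=> p _; apply: mulr_ge0.
rewrite (EFin_integralZl mu measurableT _ _ dtau0); last 2 first.
- by apply: measurable_funD => //; exact: measurable_funD.
- by move=> p _; rewrite !addr_ge0.
rewrite (EFin_integralZl mu measurableT mksq)//.
rewrite EFin_integralD//; last 2 first.
- exact: measurable_funD.
- by move=> p _; rewrite !addr_ge0.
rewrite EFin_integralD//.
pose row_ j : 'rV[R]_3 := \row_l S j l.
have momE j : (\int[mu]_p (A j p * k (sq p))%:E =
    ((\sum_l S j l ^+ 2) / 3)%:E * \int[mu]_p (sq p * k (sq p))%:E)%E.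
  have := radial_second_moment (row_ j) mk k0.
  have -> : \sum_l row_ j 0 l ^+ 2 = \sum_l S j l ^+ 2.
    by apply: eq_bigr => l _; rewrite mxE.
  move=> <-; apply: eq_integral => p _.
  by congr ((_ ^+ 2 * _)%:E); apply: eq_bigr => l _; rewrite [row_ j _ _]mxE.
have S0 j : 0 <= (\sum_l S j l ^+ 2) / 3.
  by apply: divr_ge0 => //; apply: sumr_ge0 => l _; exact: sqr_ge0.
rewrite !momE -!ge0_muleDl ?lee_fin ?addr_ge0// -!EFinD muleA -EFinM.
pose W := (\int[mu]_p (k (sq p))%:E)%E.
have sqle : (\int[mu]_p (sq p * k (sq p))%:E <= (tau + d)%:E * W)%E.
  rewrite -(EFin_integralZl mu measurableT mksq)//; last lra.
  apply: EFin_le_integral => //.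
  - exact: measurable_funM.
  - exact: measurable_funM.
  - by move=> p _; apply: mulr_ge0 => //; exact: sqnorm3_ge0.
  - move=> p _; have [->|] := k_supp (sq p); first by rewrite !mulr0.
    by rewrite ltr_norml => /andP[_ ?]; apply: ler_wpM2r => //; lra.
have W0 : (0 <= W)%E by apply: integral_ge0 => p _; rewrite lee_fin.
set K := (1 + d) * (tau + d) * _.
have K0 : 0 <= K by rewrite /K mulr_ge0// !addr_ge0.
apply: (@le_trans _ _ (K%:E * ((tau + d)%:E * W) + ((d + d ^+ 2) * b ^+ 2)%:E * W)%E).
  by apply: leeD => //; apply: lee_wpmul2l => //; rewrite lee_fin.
rewrite muleA -EFinM -ge0_muleDl ?lee_fin//; last by rewrite mulr_ge0//; lra.
rewrite -EFinD EFinM (sum_ord3 (fun j => \sum_l S j l ^+ 2)).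
rewrite [X in (X%:E * W)%E](_ : _ = (1 + d) * (tau + d) ^+ 2 *
  ((\sum_l S 0 l ^+ 2 + \sum_l S 1 l ^+ 2 + \sum_l S 2%:R l ^+ 2) / 3) +
  (d + d ^+ 2) * b ^+ 2); last by rewrite /K; field.
apply: lee_wpmul2l => //; rewrite lee_fin addr_ge0//.
rewrite mulr_ge0//; first by rewrite mulr_ge0 ?sqr_ge0//; lra.
by rewrite divr_ge0// !addr_ge0// sumr_ge0// => l _; exact: sqr_ge0.
Qed.

End momentum_integrals.

(** * Integration over the domain *)

Section domain_integrals.
Context {R : realType}.
Local Notation V := 'rV[R]_3.
Local Notation mu := (@lebesgue3 R).
Variable M : set V.
Hypothesis cM : compact M.
Local Notation O := (interior M).
Implicit Types F G : V -> R.

Definition continuous_each (A : set V) F := forall x, A x -> {for x, continuous F}.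

Definition domain : set (R3 R) := row3 @^-1` O.

Definition oint F : R := (\int[mu]_(t in domain) F (row3 t))%R.

Let OM (x : V) : O x -> M x. Proof. exact: interior_subset. Qed.

Lemma measurable_domain : measurable domain.
Proof. by apply: measurable_row3_open; exact: open_interior. Qed.

Let mD := measurable_domain.

Lemma measurable_domain_fun F : continuous_each M F ->
  measurable_fun domain (fun t : R3 R => F (row3 t)).
Proof.
move=> cF; have mF := measurable_row3_patch (@open_interior _ M)
  (fun x Ox => cF x (OM Ox)).
apply: (eq_measurable_fun (fun t : R3 R => (F \_ O) (row3 t))).
  by move=> t; rewrite inE => Ot; rewrite /patch mem_set.
exact: measurable_funTS.
Qed.

Lemma domain_fin : (mu domain < +oo)%E.
Proof.
have [X HX] : exists X, forall x, M x -> `|x| <= X.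
  by apply: (@compact_norm_bound _ _ _ _ id) => // x _; exact: cvg_id.
apply: le_lt_trans (lebesgue3_cube_fin X).
apply: le_measure; rewrite ?inE//.
  exact: measurable_cube.
move=> t Ot j; rewrite (le_trans (coord_le_norm _ _))// HX//; exact: OM.
Qed.

Let bound F : continuous_each M F -> exists B, forall x, M x -> `|F x| <= B.
Proof.
move=> cF; apply: (@compact_upper_bound _ _ M (fun x => `|F x|)) => // x Mx.
by apply: continuous_comp; [exact: cF|exact: norm_continuous].
Qed.

Lemma domain_integrable F : continuous_each M F ->
  mu.-integrable domain (EFin \o (fun t => F (row3 t))).
Proof.
move=> cF; have [B HB] := bound cF.
apply: measurable_bounded_integrable => //; first exact: domain_fin.
- exact: measurable_domain_fun.
- exists B; split; first exact: num_real.
  move=> C BC t Ot; apply: le_trans (ltW BC); apply: HB; exact: OM.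
Qed.

Lemma EFin_oint F : continuous_each M F ->
  (oint F)%:E = (\int[mu]_(t in domain) (F (row3 t))%:E)%E.
Proof.
by move=> cF; rewrite fineK//; apply: integrable_fin_num => //;
  exact: domain_integrable.
Qed.

Lemma ointD F G : continuous_each M F -> continuous_each M G ->
  oint (fun x => F x + G x) = oint F + oint G.
Proof. by move=> cF cG; apply: RintegralD => //; exact: domain_integrable. Qed.

Lemma ointZ F (a : R) : continuous_each M F ->
  oint (fun x => a * F x) = a * oint F.
Proof. by move=> cF; apply: RintegralZl => //; exact: domain_integrable. Qed.

Lemma oint_eq F G : (forall x, O x -> F x = G x) -> oint F = oint G.
Proof.
by move=> FG; apply: eq_Rintegral => t; rewrite inE => Ot; exact: FG.
Qed.

Lemma oint_ge0 F : (forall x, O x -> 0 <= F x) -> 0 <= oint F.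
Proof. by move=> F0; apply: Rintegral_ge0 => t Ot; exact: F0. Qed.

Lemma oint_le F G : continuous_each M F -> continuous_each M G ->
  (forall x, O x -> F x <= G x) -> oint F <= oint G.
Proof.
by move=> cF cG FG; apply: le_Rintegral => //;
  [exact: domain_integrable|exact: domain_integrable|move=> t Ot; exact: FG].
Qed.

Lemma oint_eq0 F : continuous_each M F -> (forall x, O x -> 0 <= F x) ->
  oint F = 0 -> forall x, O x -> F x = 0.
Proof.
move=> cF F0 I0 x Ox; have [//|Fx] := eqVneq (F x) 0.
have Fx0 : 0 < F x by rewrite lt_def Fx F0.
have : \forall y \near x, O y /\ F x / 2 < F y.
  near=> y; split; near: y.
    by apply: open_nbhs_nbhs; split => //; exact: open_interior.
  by apply: (cvgr_gt (F x)); [exact: (cF _ (OM Ox))|lra].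
move=> /nbhs_ballP[r /= r0 Hr].
pose r2 := r / 2.
pose I (a : R) : set (measurableTypeR R) := `[a, a + r2]%classic.
have mI a : measurable (I a) by exact: measurable_itv.
have lebI a : lebesgue_measure (I a) = r2%:E.
  rewrite /I lebesgue_measure_itv/= lte_fin ltrDl divr_gt0//.
  by rewrite -EFinB addrC addKr.
pose Q := (I (x 0 0) `*` I (x 0 1)) `*` I (x 0 2%:R).
have mQ : measurable Q by apply: measurableX => //; exact: measurableX.
have muQ : (0 < mu Q)%E.
  rewrite /Q /lebesgue3 product_measure1E//=; last exact: measurableX.
  rewrite /lebesgue2 product_measure1E//=.
  by move: (lebI (x 0 0)) (lebI (x 0 1)) (lebI (x 0 2%:R)) => /= -> -> ->;
    rewrite !mule_gt0 ?lte_fin ?divr_gt0.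
have QO t : Q t -> O (row3 t) /\ F x / 2 < F (row3 t).
  move=> Qt; apply: Hr; rewrite -ball_normE /=.
  apply: norm_lt_coord => //; elim/ord3_ind; rewrite !mxE/=;
    move: Qt; rewrite /Q /I /= !in_itv/= => -[[/andP[a0 a1] /andP[a2 a3]] /andP[a4 a5]];
    by rewrite ltr_norml; apply/andP; split; move: a0 a1 a2 a3 a4 a5; rewrite /r2; lra.
have QD : Q `<=` domain by move=> t /QO[].
have h2 : ((F x / 2)%:E * mu Q <= (oint F)%:E)%E.
  rewrite EFin_oint//.
  apply: (@le_trans _ _ (\int[mu]_(t in Q) (F (row3 t))%:E)%E); last first.
    apply: ge0_subset_integral => //.
      by apply/measurable_EFinP; exact: measurable_domain_fun.
    by move=> t Dt; rewrite lee_fin F0.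
  rewrite -integral_cst//; apply: ge0_le_integral => //.
  - by move=> t _; rewrite lee_fin divr_ge0// ltW.
  - apply/measurable_EFinP; apply: measurable_funS QD _ => //.
    exact: measurable_domain_fun.
  - by move=> t /QO[_ /ltW]; rewrite lee_fin.
exfalso; move: h2; rewrite I0 leNgt => /negP; apply.
by rewrite mule_gt0// lte_fin divr_gt0.
Unshelve. all: by end_near. Qed.

End domain_integrals.

(** * Poincare inequality on the domain *)

Section poincare.
Context {R : realType}.
Local Notation V := 'rV[R]_3.
Local Notation R6 := (R3 R * R3 R)%type.
Local Notation mu := (@lebesgue3 R).
Variables (M U : set V) (N : V -> R) (w : 'I_3 -> V -> R).
Variables (h : V -> 'M[R]_3) (D : R).
Hypothesis cM : compact M.
Hypothesis oU : open U.
Hypothesis MU : M `<=` U.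
Hypothesis sN : Cdiff 2 U N.
Hypothesis N_gt0 : forall x, U x -> 0 < N x.
Hypothesis sw : forall j, Cdiff 1 U (w j).
Hypothesis w0 : forall j x, bdry M x -> w j x = 0.
Hypothesis hE : forall x, U x -> h x = N x *: 1%:M.
Hypothesis hD : is_diameter M h D.
Local Notation O := (interior M).

Let OM (x : V) : O x -> M x. Proof. exact: interior_subset. Qed.
Let OU (x : V) : O x -> U x. Proof. by move=> /OM /MU. Qed.

Definition slope (x : V) : R := (\sum_i w i x * (2^-1 * partial i N x)) / N x.

(** For w = v / N, N times this matrix is the inner derivative of v, see [strain_sym_grad]. The
    diagonal part is the contribution of the force, with N written as |p|^2 on the zero energy
    level. *)
Definition strain (j k : 'I_3) (x : V) : R :=
  2^-1 * (partial k (w j) x + partial j (w k) x) + (j == k)%:R * slope x.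

(** With v = N w, [pd] and [ed] are |v|^2 and |dv|^2 times the volume density N^(3/2) of h; the
    factor sqrt N arises as the weight of the momentum shell. [rd] belongs to a remainder of order
    d. *)
Let pd (x : V) : R := Num.sqrt (N x) * (N x ^+ 2 * \sum_j w j x ^+ 2).
Let ed (x : V) : R := Num.sqrt (N x) * (N x * \sum_j \sum_k strain j k x ^+ 2).
Let rd (x : V) : R := Num.sqrt (N x) * (slope x ^+ 2 / N x).

Let sX k F : Cdiff k U F -> Cdiff k U (fun x => F x ^+ 2).
Proof. by move=> sF; apply: Cdiff_eq (CdiffM oU sF sF) => // x _; rewrite expr2. Qed.

Let sNV : Cdiff 2 U (fun x => (N x)^-1).
Proof. by apply: CdiffV => // x Ux; rewrite gt_eqF// N_gt0. Qed.

Let sslope : Cdiff 0 U slope.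
Proof.
apply: CdiffM => //; last exact: (@Cdiff_le _ _ 0 2).
apply: Cdiff_sum => // i; apply: CdiffM => //; first exact: (@Cdiff_le _ _ 0 1).
apply: CdiffM => //; apply: (@Cdiff_le _ _ 0 1) => //.
exact: Cdiff_partial.
Qed.

Let sstrain j k : Cdiff 0 U (strain j k).
Proof.
apply: CdiffD => //; last by apply: CdiffM => //; exact: sslope.
apply: CdiffM => //.
by apply: CdiffD => //; exact: Cdiff_partial.
Qed.

Let csqrtN F : Cdiff 0 U F -> continuous_each M (fun x => Num.sqrt (N x) * F x).
Proof.
move=> sF x Mx; apply: (@continuousM _ _ (fun x => Num.sqrt (N x)) F x).
  apply: continuous_comp; last exact: sqrt_continuous.
  exact: (Cdiff_continuous sN (MU Mx)).
exact: (Cdiff_continuous sF (MU Mx)).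
Qed.

Let cpd : continuous_each M pd.
Proof.
apply: csqrtN; apply: CdiffM => //; first by apply: sX; exact: (@Cdiff_le _ _ 0 2).
by apply: Cdiff_sum => // j; apply: sX; exact: (@Cdiff_le _ _ 0 1).
Qed.

Let ced : continuous_each M ed.
Proof.
apply: csqrtN; apply: CdiffM => //; first exact: (@Cdiff_le _ _ 0 2).
by apply: Cdiff_sum => // j; apply: Cdiff_sum => // k; exact: sX.
Qed.

Let crd : continuous_each M rd.
Proof.
apply: csqrtN; apply: CdiffM => //; first exact: sX.
exact: (@Cdiff_le _ _ 0 2).
Qed.

Let cZ F (a : R) : continuous_each M F -> continuous_each M (fun x => a * F x).
Proof. by move=> cF x Mx; apply: continuousM; [exact: cst_continuous|exact: cF]. Qed.

Let shell_fubini d (f : R6 -> R) : measurable_fun [set: R6] f ->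
  (forall z, 0 <= f z) -> (forall z, ~ shell M N d z -> f z = 0) ->
  measurable_fun (domain M) (fun t => \int[mu]_p (f (t, p))%:E)%E /\
  (\int[lebesgue6]_(z in shell M N d) (f z)%:E =
   \int[mu]_(t in domain M) \int[mu]_p (f (t, p))%:E)%E.
Proof.
move=> mf f0 fout.
have mfE : measurable_fun [set: R6] (EFin \o f) by exact/measurable_EFinP.
have f0E z : (0 <= (EFin \o f) z)%E by rewrite lee_fin.
split.
  apply: measurable_funTS.
  exact: (@measurable_fun_fubini_tonelli_F _ _ _ _ _ mu _ mfE f0E).
rewrite integral_mkcond [RHS]integral_mkcond.
have -> : (\int[lebesgue6]_z ((fun z => (f z)%:E) \_ (shell M N d)) z =
    \int[mu \x mu]_z (EFin \o f) z)%E.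
  apply: eq_integral => z _; rewrite /patch; case: ifPn => //.
  by rewrite notin_setE => /fout /= ->.
rewrite (@fubini_tonelli1 _ _ _ _ _ mu mu _ mfE f0E).
apply: eq_integral => t _; rewrite /fubini_F /patch; case: ifPn => //.
rewrite notin_setE => nt; apply: integral0_eq => p _ /=.
by rewrite fout//; move=> [/nt].
Qed.

(** The derivative of w . p along the flow is the strain evaluated on p, minus the energy times the
    slope; only the symmetric part of the derivative of w contributes. *)
Let quad_split (dw : 'I_3 -> 'I_3 -> R) (p : 'I_3 -> R) (s t : R) :
  \sum_j (\sum_k dw j k * p k) * p j + t * s =
  \sum_j (\sum_l (2^-1 * (dw j l + dw l j) + (j == l)%:R * s) * p l) * p j
  - (\sum_j p j ^+ 2 - t) * s.
Proof. by rewrite !sum_ord3 /=; field. Qed.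

(** The momenta are integrated at fixed x. The relation d <= q N turns bounds in N - d and N + d
    into powers of 1 - q and 1 + q, after which c cancels. *)
Let phase_poincare_density L d q c : D < L -> 0 < d -> 0 < q < 1 -> 0 < c ->
  (forall x, M x -> d <= q * N x) ->
  (forall tau, d < tau ->
   ((c * Num.sqrt (tau - d))%:E <=
   \int[mu]_p (cutoff d (sqnorm3 p - tau) ^+ 2)%:E <=
   (c * Num.sqrt (tau + d))%:E)%E) ->
  (\int[lebesgue6]_(z in shell M N d)
     (2 / L ^+ 2 * ((N \_ O) (row3 z.1) * phase_fun M N w d z ^+ 2))%:E <=
   \int[lebesgue6]_(z in shell M N d)
     (phase_derivative M N w d z ^+ 2 / (N \_ O) (row3 z.1))%:E)%E ->
  (1 - q) ^+ 2 * (2 / L ^+ 2 / 3) * oint M pd <=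
  (1 + d) * (1 + q) ^+ 3 / 3 * oint M ed + (d + d ^+ 2) * (1 + q) * oint M rd.
Proof.
move=> DL d0 /andP[q0 q1] c0 dqN Hc.
have mN : measurable_fun [set: R6] (fun z : R6 => (N \_ O) (row3 z.1)).
  have mO := measurable_row3_patch (@open_interior _ M)
    (fun x Ox => Cdiff_continuous sN (OU Ox)).
  by have := measurableT_comp mO (@measurable_fst _ _ (R3 R) (R3 R)).
have mpf := measurable_phase_fun MU sN sw d.
have mpd := measurable_phase_derivative oU MU sN sw d.
have N0 z : 0 <= (N \_ O) (row3 z).
  by rewrite /patch; case: ifPn => //; rewrite inE => /OU /N_gt0 /ltW.
have L20 : 0 <= 2 / L ^+ 2 by rewrite divr_ge0 ?sqr_ge0.
pose fl (z : R6) := 2 / L ^+ 2 * ((N \_ O) (row3 z.1) * phase_fun M N w d z ^+ 2).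
pose fr (z : R6) := phase_derivative M N w d z ^+ 2 / (N \_ O) (row3 z.1).
rewrite -[leLHS]/(\int[lebesgue6]_(z in shell M N d) (fl z)%:E)%E.
rewrite -[leRHS]/(\int[lebesgue6]_(z in shell M N d) (fr z)%:E)%E.
have [mFl ->] : measurable_fun (domain M) (fun t => \int[mu]_p (fl (t, p))%:E)%E /\
   (\int[lebesgue6]_(z in shell M N d) (fl z)%:E =
    \int[mu]_(t in domain M) \int[mu]_p (fl (t, p))%:E)%E.
  apply: shell_fubini.
  - by apply: measurable_funM => //; apply: measurable_funM => //; exact: measurable_funX.
  - by move=> z; rewrite mulr_ge0// mulr_ge0// sqr_ge0.
  - by move=> z nz; rewrite /fl phase_fun_out// expr0n !mulr0.
have [mFr ->] : measurable_fun (domain M) (fun t => \int[mu]_p (fr (t, p))%:E)%E /\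
   (\int[lebesgue6]_(z in shell M N d) (fr z)%:E =
    \int[mu]_(t in domain M) \int[mu]_p (fr (t, p))%:E)%E.
  apply: shell_fubini.
  - by apply: measurable_funM; [exact: measurable_funX|exact: measurable_funV].
  - by move=> z; rewrite divr_ge0 ?sqr_ge0.
  - by move=> z nz; rewrite /fr phase_derivative_out// expr0n mul0r.
move=> H.
pose A := (1 - q) ^+ 2 * (2 / L ^+ 2 / 3).
pose B := (1 + d) * (1 + q) ^+ 3 / 3.
pose C := (d + d ^+ 2) * (1 + q).
have A0 : 0 <= A by rewrite mulr_ge0 ?sqr_ge0// divr_ge0.
have pd0 x : 0 <= pd x.
  by rewrite mulr_ge0 ?sqrtr_ge0// mulr_ge0 ?sqr_ge0// sumr_ge0// => j _; exact: sqr_ge0.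
have lower : ((oint M (fun x => c * A * pd x))%:E <=
    \int[mu]_(t in domain M) \int[mu]_p (fl (t, p))%:E)%E.
  rewrite (EFin_oint cM (@cZ _ (c * A) cpd)).
  apply: ge0_le_integral => //.
  - exact: measurable_domain.
  - move=> t _; rewrite lee_fin; apply: mulr_ge0 => //.
    by apply: mulr_ge0 => //; exact: ltW.
  - by apply/measurable_EFinP; exact: (measurable_domain_fun (@cZ _ (c * A) cpd)).
  - move=> t Ot; set x := row3 t; have Ox : O x by [].
    have Nx := N_gt0 (OU Ox).
    have dN := dqN _ (OM Ox).
    have qN : q * N x < N x by rewrite gtr_pMl.
    have dN' : d < N x by exact: le_lt_trans dN qN.
    have /andP[lo up] := Hc _ dN'.
    pose v : V := \row_j w j x.
    have := momentum_lower d0 dN' lo v.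
    have -> : \sum_j v 0 j ^+ 2 = \sum_j w j x ^+ 2.
      by apply: eq_bigr => j _; rewrite mxE.
    set Q := \sum_j w j x ^+ 2 => mom.
    have Q0 : 0 <= Q by rewrite sumr_ge0// => j _; exact: sqr_ge0.
    have k0 : 0 <= 2 / L ^+ 2 * N x by rewrite mulr_ge0// ltW.
    have -> : (\int[mu]_p (fl (t, p))%:E = (2 / L ^+ 2 * N x)%:E *
      \int[mu]_p ((\sum_j v 0 j * row3 p 0 j) ^+ 2 *
         cutoff d (sqnorm3 p - N x) ^+ 2)%:E)%E.
      rewrite -EFin_integralZl//.
      - apply: eq_integral => p _; rewrite /fl /phase_fun /energy /= -/x.
        have PO F : (F \_ O) x = F x by rewrite /patch mem_set.
        rewrite PO; congr (_%:E).
        have -> : \sum_j (w j \_ O) x * row3 p 0 j =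
            \sum_j v 0 j * row3 p 0 j.
          by apply: eq_bigr => j _; rewrite PO [v _ _]mxE.
        by rewrite exprMn !mulrA.
      - apply: measurable_funM.
          apply: measurable_funX; apply: measurable_sum => j.
          by apply: measurable_funM => //; exact: measurable_row3.
        apply: measurable_funX; apply: measurable_maxr => //.
        apply: measurable_funB => //; apply: measurable_funX.
        by apply: measurable_funB => //; exact: measurable_sqnorm3.
      - by move=> p _; rewrite mulr_ge0 ?sqr_ge0.
    apply: le_trans (lee_wpmul2l _ mom); last by rewrite lee_fin.
    rewrite -EFinM lee_fin /pd -/Q.
    have sN0 : 0 <= Num.sqrt (N x) by exact: sqrtr_ge0.
    have q1m : 0 <= 1 - q by rewrite subr_ge0 ltW.
    (* Uses 1 - q <= sqrt (1 - q): rounding half powers to integers costs nothing in the limit and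
       keeps the final bound polynomial. *)
    have sle : (1 - q) * Num.sqrt (N x) <= Num.sqrt (N x - d).
      rewrite -[leLHS]ger0_norm; last exact: mulr_ge0.
      rewrite -sqrtr_sqr exprMn sqr_sqrtr ?(ltW Nx)// ler_sqrt; last lra.
      have -> : (1 - q) ^+ 2 * N x = N x - q * N x - q * (1 - q) * N x by ring.
      have qq : 0 <= q * (1 - q) * N x.
        apply: mulr_ge0; last exact: ltW.
        by apply: mulr_ge0; [exact: ltW|rewrite subr_ge0 ltW].
      by rewrite (le_trans (_ : _ <= N x - q * N x)) ?gerBl// lerD2l lerN2.
    have Nle : (1 - q) * N x <= N x - d by rewrite mulrBl mul1r lerD2l lerN2.
    have key : (1 - q) ^+ 2 * (N x * Num.sqrt (N x)) <=
        (N x - d) * Num.sqrt (N x - d).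
      rewrite (_ : _ * _ = (1 - q) * N x * ((1 - q) * Num.sqrt (N x))); last by ring.
      by apply: ler_pM; [apply: mulr_ge0 => //; exact: ltW|exact: mulr_ge0|
        exact: Nle|exact: sle].
    rewrite (_ : c * A * _ = (c * (2 / L ^+ 2 * N x) * (Q / 3)) *
      ((1 - q) ^+ 2 * (N x * Num.sqrt (N x)))); last by rewrite /A; ring.
    rewrite (_ : 2 / L ^+ 2 * N x * _ = (c * (2 / L ^+ 2 * N x) * (Q / 3)) *
      ((N x - d) * Num.sqrt (N x - d))); last by ring.
    apply: ler_wpM2l => //; apply: mulr_ge0; last by rewrite divr_ge0.
    by apply: mulr_ge0 => //; exact: ltW.
have upper : (\int[mu]_(t in domain M) \int[mu]_p (fr (t, p))%:E <=
    (oint M (fun x => c * (B * ed x + C * rd x)))%:E)%E.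
  have cBC : continuous_each M (fun x => c * (B * ed x + C * rd x)).
    by apply: cZ => x Mx; apply: (@continuousD _ _ _ (fun x => B * ed x)
      (fun x => C * rd x) x); exact: cZ.
  rewrite (EFin_oint cM cBC).
  apply: ge0_le_integral => //.
  - exact: measurable_domain.
  - by move=> t _; apply: integral_ge0 => p _; rewrite lee_fin divr_ge0 ?sqr_ge0.
  - by apply/measurable_EFinP; exact: (measurable_domain_fun cBC).
  - move=> t Ot; set x := row3 t; have Ox : O x by [].
    have Nx := N_gt0 (OU Ox).
    have dN := dqN _ (OM Ox).
    have qN : q * N x < N x by rewrite gtr_pMl.
    have dN' : d < N x by exact: le_lt_trans dN qN.
    have /andP[lo up] := Hc _ dN'.
    have mom := momentum_upper d0 dN' up (fun j k => strain j k x) (slope x).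
    have -> : (\int[mu]_p (fr (t, p))%:E = ((N x)^-1)%:E *
      \int[mu]_p ((\sum_j (\sum_l strain j l x * row3 p 0 l) * row3 p 0 j
        - (sqnorm3 p - N x) * slope x) ^+ 2 * cutoff d (sqnorm3 p - N x) ^+ 2)%:E)%E.
      rewrite -EFin_integralZl ?invr_ge0 ?(ltW Nx)//.
      - apply: eq_integral => p _; rewrite /fr /phase_derivative /energy /= -/x.
        have PO F : (F \_ O) x = F x by rewrite /patch mem_set.
        rewrite PO; congr (_%:E); rewrite exprMn mulrC; congr (_ * (_ ^+ 2 * _)).
        have -> : \sum_j (w j \_ O) x * ((fun x0 => 2^-1 * partial j N x0) \_ O) x =
            N x * slope x.
          rewrite /slope mulrC divfK ?gt_eqF//; apply: eq_bigr => j _.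
          by rewrite !PO.
        have -> : \sum_j (\sum_k (partial k (w j) \_ O) x * row3 p 0 k) *
            row3 p 0 j =
            \sum_j (\sum_k partial k (w j) x * row3 p 0 k) * row3 p 0 j.
          by apply: eq_bigr => j _; congr (_ * _); apply: eq_bigr => k _; rewrite PO.
        exact: (quad_split (fun j k => partial k (w j) x) (fun j => row3 p 0 j)).
      - apply: measurable_funM.
          apply: measurable_funX; apply: measurable_funB.
            apply: measurable_sum => j; apply: measurable_funM; last exact: measurable_row3.
            apply: measurable_sum => l; apply: measurable_funM => //.
            exact: measurable_row3.
          by apply: measurable_funM => //; apply: measurable_funB => //;
            exact: measurable_sqnorm3.
        apply: measurable_funX; apply: measurable_maxr => //.
        apply: measurable_funB => //; apply: measurable_funX.
        by apply: measurable_funB => //; exact: measurable_sqnorm3.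
      - by move=> p _; rewrite mulr_ge0 ?sqr_ge0.
    apply: le_trans (lee_wpmul2l _ mom) _; first by rewrite lee_fin invr_ge0 ltW.
    rewrite -EFinM lee_fin /ed /rd.
    set Q := \sum_j \sum_l _.
    have Q0 : 0 <= Q.
      by apply: sumr_ge0 => j _; apply: sumr_ge0 => l _; exact: sqr_ge0.
    have sN0 : 0 <= Num.sqrt (N x) by exact: sqrtr_ge0.
    have q1p : 0 <= 1 + q by apply: addr_ge0 => //; exact: ltW.
    have sle : Num.sqrt (N x + d) <= (1 + q) * Num.sqrt (N x).
      rewrite -[leRHS]ger0_norm; last by apply: mulr_ge0.
      rewrite -sqrtr_sqr exprMn sqr_sqrtr ?(ltW Nx)// ler_sqrt; last first.
        by apply: mulr_ge0; [exact: sqr_ge0|exact: ltW].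
      have : 0 <= q * (1 + q) * N x.
        by apply: mulr_ge0; [apply: mulr_ge0 => //; exact: ltW|exact: ltW].
      have -> : (1 + q) ^+ 2 * N x = N x + (q * N x + q * (1 + q) * N x) by ring.
      by move=> ?; rewrite lerD2l (le_trans dN)// lerDl.
    have Nle : N x + d <= (1 + q) * N x by rewrite mulrDl mul1r lerD2l.
    have N2le : (N x + d) ^+ 2 <= ((1 + q) * N x) ^+ 2.
      rewrite lerXn2r ?nnegrE//; last by apply: mulr_ge0 => //; exact: ltW.
      by apply: addr_ge0; exact: ltW.
    have key : (1 + d) * (N x + d) ^+ 2 * (Q / 3) + (d + d ^+ 2) * slope x ^+ 2 <=
       (1 + d) * ((1 + q) * N x) ^+ 2 * (Q / 3) + (d + d ^+ 2) * slope x ^+ 2.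
      rewrite lerD2r; apply: ler_wpM2r; first by apply: divr_ge0.
      by apply: ler_wpM2l => //; apply: addr_ge0 => //; exact: ltW.
    have key0 : 0 <= (1 + d) * (N x + d) ^+ 2 * (Q / 3) + (d + d ^+ 2) * slope x ^+ 2.
      apply: addr_ge0; apply: mulr_ge0; [|exact: divr_ge0| |exact: sqr_ge0].
        by apply: mulr_ge0; [apply: addr_ge0 => //; exact: ltW|exact: sqr_ge0].
      by apply: addr_ge0; [exact: ltW|exact: sqr_ge0].
    have key2 := ler_pM key0 (sqrtr_ge0 _) key sle.
    rewrite (_ : (N x)^-1 * _ = c / N x * (((1 + d) * (N x + d) ^+ 2 * (Q / 3) +
       (d + d ^+ 2) * slope x ^+ 2) * Num.sqrt (N x + d))); last by ring.
    apply: (@le_trans _ _ (c / N x * (((1 + d) * ((1 + q) * N x) ^+ 2 * (Q / 3) +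
       (d + d ^+ 2) * slope x ^+ 2) * ((1 + q) * Num.sqrt (N x))))).
      by apply: ler_wpM2l => //; apply: divr_ge0; exact: ltW.
    rewrite le_eqVlt; apply/orP; left; apply/eqP; rewrite /B /C.
    by field; rewrite gt_eqF.
have := le_trans lower (le_trans H upper); rewrite lee_fin.
rewrite (@ointZ _ M cM _ c); last first.
  by move=> x Mx; apply: (@continuousD _ _ _ (fun x => B * ed x)
    (fun x => C * rd x) x); exact: cZ.
rewrite ointD//; [|exact: cZ|exact: cZ].
rewrite (ointZ cM (c * A) cpd) (ointZ cM B ced) (ointZ cM C crd).
by rewrite -[c * A * _]mulrA ler_pM2l.
Qed.

Lemma poincare : oint M pd <= D ^+ 2 / 2 * oint M ed.
Proof.
have D0 : 0 <= D by exact: (diameter_ge0 hD).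
have N_gt0' x : M x -> 0 < N x by move=> /MU /N_gt0.
have cN x : M x -> {for x, continuous N}.
  by move=> Mx; exact: (Cdiff_continuous sN (MU Mx)).
have [N0 N00 HN0] := compact_pos_lower_bound cM cN N_gt0'.
have step L : D < L -> 2 / L ^+ 2 * oint M pd <= oint M ed.
  move=> DL; have [d0 d00 Hd] := phase_poincare cM oU MU sN N_gt0' sw w0 hE hD DL.
  pose lhs d := (1 - d / N0) ^+ 2 * (2 / L ^+ 2 / 3) * oint M pd.
  pose rhs d := (1 + d) * (1 + d / N0) ^+ 3 / 3 * oint M ed +
    (d + d ^+ 2) * (1 + d / N0) * oint M rd.
  have ineq d : 0 < d -> d <= d0 -> d < N0 -> lhs d <= rhs d.
    move=> dp dd dN; have [c c0 Hc] := shell_weight dp.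
    apply: (phase_poincare_density DL dp _ c0 _ Hc); last by apply: Hd; rewrite dp.
      by rewrite divr_gt0//= ltr_pdivrMr// mul1r.
    move=> x Mx; rewrite mulrAC ler_pdivlMr// ler_pM2l//; exact: HN0.
  (* The difference of the two sides as a polynomial in the shell width; its value at 0, where the
     term with [rd] drops out, is a limit of nonnegative numbers. *)
  pose p : {poly R} := ((1%:P + 'X) * (1%:P + (N0^-1)%:P * 'X) ^+ 3 * (3^-1)%:P * (oint M ed)%:P +
    ('X + 'X ^+ 2) * (1%:P + (N0^-1)%:P * 'X) * (oint M rd)%:P) -
    (1%:P - (N0^-1)%:P * 'X) ^+ 2 * (2 / L ^+ 2 / 3 * oint M pd)%:P.
  have pE d : p.[d] = rhs d - lhs d.
    rewrite /p /rhs /lhs !(hornerD, hornerN, hornerM, horner_exp, hornerX, hornerC).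
    by ring.
  have cp : p.[d] @[d --> 0^'+] --> p.[0].
    by apply: cvg_at_right_filter; exact: continuous_horner.
  have : 0 <= p.[0].
    apply: (cvgr_to_ge cp); near=> d; rewrite pE subr_ge0; apply: ineq.
    - by near: d; exact: nbhs_right_gt.
    - by near: d; exact: nbhs_right_le.
    - by near: d; exact: nbhs_right_lt.
  by rewrite pE /rhs /lhs; lra.
have bound L : D < L -> oint M pd <= L ^+ 2 / 2 * oint M ed.
  move=> DL; have L0 : 0 < L by exact: le_lt_trans DL.
  have := step L DL; have L20 : 0 < L ^+ 2 / 2 by rewrite divr_gt0// exprn_gt0.
  rewrite -(ler_pM2l L20) mulrA (_ : _ * (2 / _) = 1) ?mul1r//.
  by field; rewrite gt_eqF.
have cv : L ^+ 2 / 2 * oint M ed @[L --> D^'+] --> D ^+ 2 / 2 * oint M ed.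
  apply: cvg_at_right_filter; apply: cvgM; last exact: cvg_cst.
  by apply: cvgM; [exact: exprn_continuous|exact: cvg_cst].
apply: (cvgr_to_ge cv); near=> L; apply: bound; near: L.
exact: nbhs_right_gt.
Unshelve. all: by end_near. Qed.

End poincare.

(** * Divergence theorem for functions vanishing on the boundary *)

Section divergence.
Context {R : realType}.
Local Notation V := 'rV[R]_3.
Local Notation mu := (@lebesgue3 R).
Variables (M U : set V) (F : V -> R) (j : 'I_3).
Hypothesis cM : compact M.
Hypothesis oU : open U.
Hypothesis MU : M `<=` U.
Hypothesis sF : Cdiff 1 U F.
Hypothesis F0 : forall x, bdry M x -> F x = 0.
Local Notation O := (interior M).

Let OM (x : V) : O x -> M x. Proof. exact: interior_subset. Qed.

Let one (x : V) : R := ((fun _ : V => 1 : R) \_ O) x.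
Let Phi (x : V) : R := (F \_ O) x.

Let oneB x : 0 <= one x <= 1.
Proof. by rewrite /one /patch; case: ifPn; rewrite ?lexx ?ler01. Qed.

Let mshift (G : V -> R) (b : V) : measurable_fun [set: R3 R] (fun t => G (row3 t)) ->
  measurable_fun [set: R3 R] (fun t => G (row3 t + b)).
Proof.
move=> mG; have := measurableT_comp mG (lebesgue3_translation_row b).1.
by apply: eq_measurable_fun => t _ /=; rewrite row3K.
Qed.

Let mone : measurable_fun [set: R3 R] (fun t => one (row3 t)).
Proof.
by apply: measurable_row3_patch => [|x _]; [exact: open_interior|exact: cst_continuous].
Qed.

Let mPhi : measurable_fun [set: R3 R] (fun t => Phi (row3 t)).
Proof.
apply: measurable_row3_patch => [|x Ox]; first exact: open_interior.
exact: (Cdiff_continuous sF (MU (OM Ox))).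
Qed.

Let PhiB : exists2 B, 0 <= B & forall x, `|Phi x| <= B.
Proof.
have [B HB] : exists B, forall x, M x -> `|F x| <= B.
  apply: (@compact_upper_bound _ _ M (fun x => `|F x|)) => // x Mx.
  apply: continuous_comp; last exact: norm_continuous.
  exact: (Cdiff_continuous sF (MU Mx)).
exists `|B| => // x; rewrite /Phi /patch; case: ifPn; last by rewrite normr0.
by rewrite inE => /OM /HB /le_trans; apply; exact: ler_norm.
Qed.

Let bounded_integrable (f : R3 R -> R) B : measurable_fun [set: R3 R] f ->
  (forall t, domain M t -> `|f t| <= B) -> mu.-integrable (domain M) (EFin \o f).
Proof.
move=> mf fB; apply: measurable_bounded_integrable.
- exact: measurable_domain.
- exact: domain_fin.
- exact: measurable_funTS.
- exists B; split; first exact: num_real.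
  by move=> C BC t Dt; apply: le_trans (ltW BC); exact: fB.
Qed.

(** Both sides integrate the zero extension of F over the intersection of the interior with its
    translate by b. *)
Let translated (b : V) :
  (\int[mu]_(t in domain M) Phi (row3 t + b) =
   \int[mu]_(t in domain M) (one (row3 t - b) * Phi (row3 t)))%R.
Proof.
have [B B0 HB] := PhiB.
pose Psi (t : R3 R) := one (row3 t - b) * Phi (row3 t).
have mPsi : measurable_fun setT Psi.
  by apply: measurable_funM; [exact: (mshift (- b) mone)|exact: mPhi].
have PsiD t : ~ domain M t -> Psi t = 0.
  by move=> nt; rewrite /Psi /Phi /patch memNset// mulr0.
have iPsi : mu.-integrable (domain M) (EFin \o Psi).
  apply: (@bounded_integrable _ B) => // t _; rewrite normrM.
  have /andP[h0 h1] := oneB (row3 t - b).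
  by rewrite ger0_norm// -[leRHS]mul1r ler_pM.
have iPsiT : mu.-integrable [set: R3 R] (EFin \o Psi).
  have := integrable_mkcond (EFin \o Psi) (measurable_domain M).
  move=> /(_ mu) /iffLR /(_ iPsi); apply: eq_integrable => // t _.
  by rewrite /patch; case: ifPn => //; rewrite notin_setE => /PsiD /= ->.
have eqT (f : R3 R -> R) : (forall t, ~ domain M t -> f t = 0) ->
    (\int[mu]_(t in domain M) f t = \int[mu]_t f t)%R.
  move=> f0; rewrite Rintegral_mkcond; apply: eq_Rintegral => t _.
  by rewrite /patch; case: ifPn => //; rewrite notin_setE => /f0 ->.
rewrite [RHS]eqT//.
have := integral_scales_measure (lebesgue3_translation_row b) iPsiT.
rewrite /Rintegral => <- /=.
rewrite -[LHS]/(\int[mu]_(t in domain M) Phi (row3 t + b))%R.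
have -> : (\int[mu]_(t in domain M) Phi (row3 t + b))%R =
    (\int[mu]_(t in domain M) (one (row3 t) * Phi (row3 t + b)))%R.
  apply: eq_Rintegral => t; rewrite inE => Ot.
  by rewrite /one /patch mem_set// mul1r.
rewrite eqT; last by move=> t nt; rewrite /one /patch memNset// mul0r.
congr fine; apply: eq_integral => t _.
by rewrite /Psi row3K addrK.
Qed.

(** Translation invariance in place of a boundary integral: the quotients [K k] have integral 0, are
    bounded by the Lipschitz estimates and converge to the derivative at each interior point, so
    dominated convergence applies. *)
Lemma oint_partial : oint M (partial j F) = 0.
Proof.
have bnd k : exists B, forall x, M x -> `|partial k F x| <= B.
  apply: (@compact_upper_bound _ _ M (fun x => `|partial k F x|)) => // x Mx.
  apply: continuous_comp; last exact: norm_continuous.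
  exact: (Cdiff_continuous (Cdiff_partial k sF) (MU Mx)).
have [B B0 HB'] := fin_common_bound bnd.
have HB x k : M x -> `|partial k F x| <= B by exact: HB'.
pose C := 3%:R * B.
have dF x : U x -> differentiable F x by move=> Ux; exact: (Cdiff_differentiable sF Ux).
have lip := @patch_lipschitz_in _ _ M U cM MU F B dF HB F0.
pose e : V := delta_mx 0 j.
have ne : `|e| <= 1.
  apply: norm_le_coord => // k; rewrite mxE.
  by case: (_ && _); rewrite ?normr1 ?normr0 ?ler01.
pose s (k : nat) : R := k.+1%:R^-1.
have s0 k : 0 < s k by rewrite invr_gt0.
pose K k (t : R3 R) := (s k)^-1 * (Phi (row3 t + s k *: e)
  - one (row3 t - s k *: e) * Phi (row3 t)).
have mK k : measurable_fun setT (K k).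
  apply: measurable_funM => //; apply: measurable_funB.
    exact: (mshift (s k *: e) mPhi).
  by apply: measurable_funM; [exact: (mshift (- (s k *: e)) mone)|exact: mPhi].
have C0 : 0 <= C by exact: mulr_ge0.
have KB k t : domain M t -> `|K k t| <= 2 * C.
  move=> Ot; rewrite /K normrM normfV (gtr0_norm (s0 k)) mulrC ler_pdivrMr//.
  have Ox : O (row3 t) by [].
  have nse : `|s k *: e| <= s k by rewrite normrZ (gtr0_norm (s0 k)) ler_piMr// ltW.
  have [h1 _] := lip (row3 t) (row3 t + s k *: e) Ox.
  have [_ h2] := lip (row3 t) (row3 t - s k *: e) Ox.
  have h1' : `|Phi (row3 t + s k *: e) - Phi (row3 t)| <= C * s k.
    by rewrite (le_trans h1)// [row3 t + _ - _]addrAC subrr add0r ler_wpM2l.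
  (* The indicator differs from 1 only where the backward translate leaves the interior; there F
     itself is of order [s k] by the second half of [patch_lipschitz_in]. *)
  have h2' : `|(1 - one (row3 t - s k *: e)) * Phi (row3 t)| <= C * s k.
    have [Oy|nOy] := pselect (O (row3 t - s k *: e)).
      by rewrite /one /patch mem_set// subrr mul0r normr0 mulr_ge0// ltW.
    rewrite /one /patch (memNset nOy) subr0 mul1r.
    have := h2 (ex_intro2 _ _ 1 _ _); rewrite [row3 t - _ - _]addrAC subrr add0r.
    rewrite ler01 lexx normrN => /(_ isT).
    rewrite scale1r => /(_ nOy) h3.
    apply: le_trans (le_trans h3 (ler_wpM2l C0 nse)).
    by rewrite lerDr; exact: normr_ge0.
  rewrite (_ : _ - _ = (Phi (row3 t + s k *: e) - Phi (row3 t)) +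
    (1 - one (row3 t - s k *: e)) * Phi (row3 t)); last by ring.
  rewrite (le_trans (ler_normD _ _))// (_ : 2 * C * s k = C * s k + C * s k); last by ring.
  exact: lerD.
have intK k : (\int[mu]_(t in domain M) (K k t)%:E = 0)%E.
  have i1 : mu.-integrable (domain M) (EFin \o (fun t => Phi (row3 t + s k *: e))).
    have [B1 B10 HB1] := PhiB.
    by apply: (@bounded_integrable _ B1) => //; exact: (mshift (s k *: e) mPhi).
  have i2 : mu.-integrable (domain M)
      (EFin \o (fun t => one (row3 t - s k *: e) * Phi (row3 t))).
    have [B1 B10 HB1] := PhiB.
    apply: (@bounded_integrable _ B1).
      by apply: measurable_funM; [exact: (mshift (- (s k *: e)) mone)|exact: mPhi].
    move=> t _; have /andP[h0 h1] := oneB (row3 t - s k *: e).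
    by rewrite normrM ger0_norm// -[leRHS]mul1r ler_pM.
  have iK : mu.-integrable (domain M) (EFin \o K k).
    by apply: (@bounded_integrable _ (2 * C)) => // t; exact: KB.
  rewrite -[LHS]fineK; last by apply: integrable_fin_num => //; exact: measurable_domain.
  rewrite -[fine _]/(\int[mu]_(t in domain M) K k t)%R /K.
  rewrite RintegralZl//; [|exact: measurable_domain
    |exact: (integrableB (measurable_domain M) i1 i2)].
  by rewrite RintegralB//; [rewrite translated subrr mulr0|exact: measurable_domain].
have cp : continuous_each M (partial j F).
  by move=> x Mx; exact: (Cdiff_continuous (Cdiff_partial j sF) (MU Mx)).
have s_cvg : s @ \oo --> 0 by exact: cvg_harmonic.
have Kcvg t : domain M t -> K k t @[k --> \oo] --> partial j F (row3 t).
  move=> Ot; set x := row3 t; have Ox : O x by [].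
  have nbx : \forall y \near x, O y.
    by apply: open_nbhs_nbhs; split => //; exact: open_interior.
  have se_cvg (d : V) : x + s k *: d @[k --> \oo] --> x.
    rewrite -[X in _ --> X]addr0 -(scale0r d).
    apply: cvgD; first exact: cvg_cst.
    by apply: cvgZr_tmp.
  have n1 : \forall k \near \oo, O (x + s k *: e) by exact: (se_cvg e _ nbx).
  have n2 : \forall k \near \oo, O (x + s k *: - e) by exact: (se_cvg (- e) _ nbx).
  have Dg : is_derive (0 : R) 1 (fun r : R => F (x + r *: e)) (partial j F x).
    have := @is_derive_comp_curve _ _ F (fun r => x + r *: e) 0 e.
    rewrite scale0r addr0 => /(_ (dF _ (MU (OM Ox))) (is_derive_line _ _ _)).
    move=> /is_derive_eq; apply; rewrite (bigD1 j)//= big1 => [|i ij].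
      by rewrite mxE !eqxx mul1r addr0.
    by rewrite mxE (negbTE ij) andbF mul0r.
  have lim := is_derive_seq Dg s0 s_cvg.
  apply: cvg_trans lim; apply: near_eq_cvg; apply: filterS2 n1 n2 => k O1.
  rewrite scalerN => O2.
  rewrite /K /Phi /one -/x /patch !mem_set// scale0r addr0 mul1r mulrC.
  by [].
have intc : mu.-integrable (domain M) (fun=> (2 * C)%:E).
  by apply: (@bounded_integrable (fun=> 2 * C) (2 * C)) => // t _; rewrite ger0_norm// mulr_ge0.
have Idom : (\int[mu]_(t in domain M) (K k t)%:E)%E @[k --> \oo] -->
    (\int[mu]_(t in domain M) (partial j F (row3 t))%:E)%E.
  apply: (@dominated_cvg _ _ _ mu _ (measurable_domain M) _ _ (fun=> (2 * C)%:E)).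
  - by move=> k; apply/measurable_EFinP; exact: measurable_funTS.
  - by move=> t Dt; apply: cvg_EFin; [exact: nearW|exact: Kcvg].
  - by move=> t _.
  - exact: intc.
  - by move=> k t Dt; rewrite abse_EFin lee_fin; exact: KB.
have Icst : (\int[mu]_(t in domain M) (K k t)%:E)%E @[k --> \oo] --> (0 : \bar R).
  by under eq_fun do rewrite intK; exact: cvg_cst.
apply: EFin_inj; rewrite (EFin_oint cM cp).
exact: (cvg_unique _ Idom Icst).
Unshelve. all: by end_near. Qed.

End divergence.

(** * Operators of a conformally Euclidean metric *)

Section sqrt_calculus.
Context {R : realType} {n : nat}.
Local Notation V := 'rV[R]_n.
Variables (U : set V) (N : V -> R).
Hypothesis oU : open U.
Hypothesis N_gt0 : forall x, U x -> 0 < N x.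

Lemma partial_sqrt x j : U x -> differentiable N x ->
  partial j (fun y => Num.sqrt (N y)) x = (2 * Num.sqrt (N x))^-1 * partial j N x.
Proof.
move=> Ux dN; pose g (s : R) := N (x + s *: delta_mx 0 j).
have dg : is_derive (0 : R) 1 g (partial j N x).
  have := @is_derive_comp_curve _ _ N (fun s => x + s *: delta_mx 0 j) 0 (delta_mx 0 j).
  rewrite scale0r addr0 => /(_ dN (is_derive_line _ _ _)).
  move=> /is_derive_eq; apply; rewrite (bigD1 j)//= big1 => [|i ij].
    by rewrite mxE !eqxx mul1r addr0.
  by rewrite mxE (negbTE ij) andbF mul0r.
have g0 : g 0 = N x by rewrite /g scale0r addr0.
have ds := is_derive1_sqrt (N_gt0 Ux); rewrite -g0 in ds.
have := is_derive1_comp ds dg; rewrite g0 => -[dc <-].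
have E : (fun r : R => r^-1 *: (((fun y => Num.sqrt (N y)) \o shift x)
    (r *: delta_mx 0 j) - Num.sqrt (N x))) =
    (fun r : R => r^-1 *: (((Num.sqrt \o g) \o shift 0) (r *: 1) - (Num.sqrt \o g) 0)).
  by apply/funext => r; rewrite /= /g scale0r !addr0 [r *: 1]mulr1 [x + _]addrC.
by rewrite /partial /derive E.
Qed.

Lemma Cdiff1_sqrt : Cdiff 1 U N -> Cdiff 1 U (fun x => Num.sqrt (N x)).
Proof.
move=> sN.
have ds x : U x -> differentiable (fun x => Num.sqrt (N x)) x.
  move=> Ux.
  have d2 : differentiable (@Num.sqrt R : R -> R) (N x).
    by apply/derivable1_diffP; have [] := is_derive1_sqrt (N_gt0 Ux).
  exact: (differentiable_comp (Cdiff_differentiable sN Ux) d2).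
split=> // j; split => // x Ux.
apply: (@near_eq_differentiable _ _ _
  (fun y => (2 * Num.sqrt (N y))^-1 * partial j N y)).
  apply: (open_near_eq oU) => // y Uy; rewrite partial_sqrt//.
  exact: (Cdiff_differentiable sN Uy).
apply: differentiableM; last exact: (Cdiff_differentiable (Cdiff_partial j sN) Ux).
apply: differentiableV; first by apply: differentiableM => //; exact: ds.
by rewrite mulf_neq0// gt_eqF// sqrtr_gt0 N_gt0.
Qed.

End sqrt_calculus.

Section conformal_operators.
Context {R : realType}.
Local Notation V := 'rV[R]_3.
Variables (U : set V) (N : V -> R) (h : V -> 'M[R]_3) (v : V -> V).
Hypothesis oU : open U.
Hypothesis sN : Cdiff 2 U N.
Hypothesis N_gt0 : forall x, U x -> 0 < N x.
Hypothesis hE : forall x, U x -> h x = N x *: 1%:M.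
Hypothesis sv : forall j, Cdiff 2 U (fun x => v x 0 j).

Let dN x : U x -> differentiable N x.
Proof. by move=> Ux; exact: (Cdiff_differentiable sN Ux). Qed.

Let N_neq0 x : U x -> N x != 0.
Proof. by move=> /N_gt0 /gt_eqF ->. Qed.

(** The inner derivative of v for N times the Euclidean metric, with the Christoffel symbols written
    out so that its differentiability can be read off. *)
Definition sym_grad (j k : 'I_3) (x : V) : R :=
  2^-1 * (partial j (fun y => v y 0 k) x + partial k (fun y => v y 0 j) x)
  - (2 * N x)^-1 * (partial j N x * v x 0 k + partial k N x * v x 0 j)
  + (j == k)%:R * ((2 * N x)^-1 * \sum_l partial l N x * v x 0 l).

Lemma Cdiff_sym_grad j k : Cdiff 1 U (sym_grad j k).
Proof.
have s2N : Cdiff 1 U (fun x => (2 * N x)^-1).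
  apply: CdiffV => // [x Ux|]; first by rewrite mulf_neq0 ?N_neq0.
  by apply: CdiffM => //; [exact: Cdiff_cst|exact: CdiffW].
have sv1 i : Cdiff 1 U (fun x => v x 0 i) by exact: (CdiffW (sv i)).
have sdN i : Cdiff 1 U (partial i N) by exact: (Cdiff_partial i sN).
have sdv i l : Cdiff 1 U (partial i (fun x => v x 0 l)) by exact: (Cdiff_partial i (sv l)).
apply: CdiffD => //; [apply: CdiffB => //|].
- by apply: CdiffM => //; [exact: Cdiff_cst|exact: CdiffD].
- by apply: CdiffM => //; apply: CdiffD => //; exact: CdiffM.
- apply: CdiffM => //; first exact: Cdiff_cst.
  by apply: CdiffM => //; apply: Cdiff_sum => // l; exact: CdiffM.
Qed.

Lemma sym_gradC j k x : sym_grad j k x = sym_grad k j x.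
Proof. by rewrite /sym_grad eq_sym [_ + partial k _ _]addrC [_ + partial k N x * _]addrC. Qed.

Let cov_covector_conformal x j k : U x -> cov_covector h v x j k =
  partial j (fun y => v y 0 k) x - (2 * N x)^-1 *
    (partial j N x * v x 0 k + partial k N x * v x 0 j
     - (j == k)%:R * \sum_l partial l N x * v x 0 l).
Proof.
move=> Ux; rewrite /cov_covector; congr (_ - _).
have sumE i (c : R) : \sum_l (l == i)%:R * c * v x 0 l = c * v x 0 i.
  rewrite (bigD1 i)//= big1 ?addr0 ?eqxx ?mul1r// => l /negbTE ->.
  by rewrite !mul0r.
rewrite (eq_bigr (fun l => (2 * N x)^-1 * ((l == k)%:R * partial j N x * v x 0 l
   + (l == j)%:R * partial k N x * v x 0 l
   - (j == k)%:R * (partial l N x * v x 0 l)))); last first.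
  by move=> l _; rewrite (christoffel_conformal oU hE dN)//; ring.
by rewrite -mulr_sumr sumrB big_split/= !sumE -mulr_sumr.
Qed.

Lemma inner_d_conformal x j k : U x -> inner_d h v x j k = sym_grad j k x.
Proof.
move=> Ux; rewrite mxE !cov_covector_conformal// /sym_grad (eq_sym k j).
by field; exact: N_neq0.
Qed.

Lemma div_covector_conformal x : U x ->
  div_covector h v x = (N x)^-1 * \sum_j sym_grad j j x.
Proof.
move=> Ux; rewrite /div_covector mulr_sumr; apply: eq_bigr => j _.
rewrite (bigD1 j)//= big1 ?addr0; last first.
  by move=> k kj; rewrite (hinv_conformal hE)// eq_sym (negbTE kj) !mul0r.
rewrite (hinv_conformal hE)// eqxx mul1r cov_covector_conformal// /sym_grad eqxx.
by field; exact: N_neq0.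
Qed.

(** The index algebra of the divergence of a symmetric tensor, with F, its derivatives P and Q =
    grad N as free symbols. The last coefficient is (dim - 2) / (2 n) with dim = 3. *)
Let contraction (n : R) (F : 'I_3 -> 'I_3 -> R) (P Q : 'I_3 -> R) (j : 'I_3) :
  n != 0 -> (forall i k, F i k = F k i) ->
  \sum_k (P k - \sum_m (2 * n)^-1 * ((m == j)%:R * Q k + (m == k)%:R * Q j
      - (k == j)%:R * Q m) * F m k
    - \sum_m (2 * n)^-1 * ((m == k)%:R * Q k + (m == k)%:R * Q k
      - (k == k)%:R * Q m) * F j m) =
  \sum_k P k - (2 * n)^-1 * Q j * (\sum_k F k k) + (2 * n)^-1 * \sum_k Q k * F j k.
Proof.
move=> n0 FC; rewrite !sum_ord3.
move: j; elim/ord3_ind; rewrite /= ?(FC 1 0) ?(FC 2%:R 0) ?(FC 2%:R 1); field; exact: n0.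
Qed.

Lemma div_tensor_conformal x j : U x -> div_tensor h (inner_d h v) x 0 j =
  (N x)^-1 * (\sum_k partial k (sym_grad j k) x
    - (2 * N x)^-1 * partial j N x * (\sum_k sym_grad k k x)
    + (2 * N x)^-1 * \sum_k partial k N x * sym_grad j k x).
Proof.
move=> Ux; rewrite mxE.
rewrite (eq_bigr (fun k => (N x)^-1 * cov_tensor h (inner_d h v) x k j k)); last first.
  move=> k _; rewrite (bigD1 k)//= big1 ?addr0; last first.
    by move=> l lk; rewrite (hinv_conformal hE)// eq_sym (negbTE lk) !mul0r.
  by rewrite (hinv_conformal hE)// eqxx mul1r.
rewrite -mulr_sumr; congr (_ * _).
have pE k : partial k (fun y => inner_d h v y j k) x = partial k (sym_grad j k) x.
  by apply: (partial_eq _ oU) => // y Uy; exact: inner_d_conformal.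
rewrite -(@contraction (N x) (fun i k => sym_grad i k x)
  (fun k => partial k (sym_grad j k) x) (fun k => partial k N x)).
- rewrite /cov_tensor; apply: eq_bigr => k _; rewrite pE; congr (_ - _ - _);
    by apply: eq_bigr => m _; rewrite (christoffel_conformal oU hE dN)// inner_d_conformal.
- exact: N_neq0.
- by move=> i k; exact: sym_gradC.
Qed.

Lemma tensor_app_conformal (alpha : V -> V) x j : U x ->
  tensor_app h (inner_d h v) alpha x 0 j =
  (N x)^-1 * \sum_k sym_grad j k x * alpha x 0 k.
Proof.
move=> Ux; rewrite mxE mulr_sumr; apply: eq_bigr => k _.
rewrite (bigD1 k)//= big1 ?addr0; last first.
  by move=> l lk; rewrite (hinv_conformal hE)// eq_sym (negbTE lk) !mul0r.
by rewrite (hinv_conformal hE)// eqxx mul1r inner_d_conformal// mulrA.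
Qed.

Lemma norm_covector_conformal x (alpha : V) : U x ->
  norm_covector h x alpha = Num.sqrt ((N x)^-1 * \sum_j alpha 0 j ^+ 2).
Proof.
move=> Ux; rewrite /norm_covector mulr_sumr; congr Num.sqrt.
apply: eq_bigr => k _; rewrite (bigD1 k)//= big1 ?addr0; last first.
  by move=> l lk; rewrite (hinv_conformal hE)// eq_sym (negbTE lk) !mul0r.
by rewrite (hinv_conformal hE)// eqxx mul1r expr2 mulrA.
Qed.

Lemma strain_sym_grad x j k : U x ->
  N x * strain N (fun i y => v y 0 i / N y) j k x = sym_grad j k x.
Proof.
move=> Ux.
have dv i : differentiable (fun y => v y 0 i) x by exact: (Cdiff_differentiable (sv i) Ux).
have dNV : differentiable (fun y => (N y)^-1) x.
  by apply: differentiableV; [exact: dN|exact: N_neq0].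
have pw i l : partial i (fun y => v y 0 l / N y) x =
    (N x)^-1 * partial i (fun y => v y 0 l) x - N x ^- 2 * v x 0 l * partial i N x.
  rewrite partialM// partialV; [by ring|exact: N_neq0|exact: dN].
rewrite /strain /sym_grad !pw /slope.
have -> : \sum_i v x 0 i / N x * (2^-1 * partial i N x) =
    (2 * N x)^-1 * \sum_l partial l N x * v x 0 l.
  by rewrite mulr_sumr; apply: eq_bigr => i _; field; exact: N_neq0.
by field; exact: N_neq0.
Qed.

End conformal_operators.

(** * The energy inequality and uniqueness *)

Section pointwise_energy.
Context {R : realType}.
Implicit Types (n : R) (v Q dphi al gam : 'I_3 -> R) (D F dF : 'I_3 -> 'I_3 -> R).

(* The equation tested with n v, as a divergence identity at one point; [n]
   is the square root of the conformal factor, [Q] its gradient, [D j k]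
   stands for the derivative of v_k in direction j, [F] for the inner
   derivative of v and [dF j k] for the derivative of F_{jk} in direction k. *)
Lemma energy_identity n v Q dphi al gam D F dF (ap tau : R) : n != 0 ->
  (forall j k, F j k = 2^-1 * (D j k + D k j)
     - (2 * n ^+ 2)^-1 * (Q j * v k + Q k * v j)
     + (j == k)%:R * ((2 * n ^+ 2)^-1 * \sum_l Q l * v l)) ->
  tau = n ^- 2 * \sum_j F j j ->
  (forall j, dphi j = n ^- 2 * (\sum_k dF j k
     - (2 * n ^+ 2)^-1 * Q j * (\sum_k F k k)
     + (2 * n ^+ 2)^-1 * \sum_k Q k * F j k)
     + n ^- 2 * (\sum_k F j k * al k) - tau * gam j) ->
  \sum_k ((2 * n)^-1 * Q k * (ap * tau) * v k + n * dphi k * v k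
     + n * (ap * tau) * D k k
     + n ^- 2 * ((2 * n)^-1 * Q k) * (\sum_j F j k * v j)
     - n^-1 * (\sum_j (dF j k * v j + F j k * D k j)))
  + n^-1 * (\sum_j \sum_k F j k ^+ 2) =
  n ^+ 3 * ap * tau ^+ 2 + n^-1 * (\sum_j v j * \sum_k F j k * al k)
  - n * tau * (\sum_j v j * gam j).
Proof.
move=> n0 FE tauE dphiE.
have DE j k : D k j = 2 * F j k - D j k + n ^- 2 * (Q j * v k + Q k * v j)
    - (j == k)%:R * (n ^- 2 * \sum_l Q l * v l).
  by rewrite FE; field.
have D00 j : D j j = F j j + n ^- 2 * (Q j * v j) - (2 * n ^+ 2)^-1 * \sum_l Q l * v l.
  by rewrite FE eqxx mul1r; field.
have FC j k : F k j = F j k by rewrite !FE (eq_sym k j); ring.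
have DE01 := DE 0 1; have DE02 := DE 0 2%:R; have DE12 := DE 1 2%:R.
have D0 := D00 0; have D1 := D00 1; have D2 := D00 2%:R.
have F01 := FC 0 1; have F02 := FC 0 2%:R; have F12 := FC 1 2%:R.
rewrite !sum_ord3 in DE01 DE02 DE12 D0 D1 D2 tauE.
rewrite !sum_ord3 !dphiE !sum_ord3 DE01 DE02 DE12 D0 D1 D2 F01 F02 F12 tauE /=.
by field.
Qed.

Lemma sum3_CS (a b : 'I_3 -> R) :
  (\sum_j a j * b j) ^+ 2 <= (\sum_j a j ^+ 2) * \sum_j b j ^+ 2.
Proof.
rewrite !sum_ord3 -subr_ge0 (_ : _ - _ = (a 0 * b 1 - a 1 * b 0) ^+ 2
  + (a 0 * b 2%:R - a 2%:R * b 0) ^+ 2 + (a 1 * b 2%:R - a 2%:R * b 1) ^+ 2); last by ring.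
by rewrite !addr_ge0 ?sqr_ge0.
Qed.

(** Young's inequality in squared form, so that v, F and the coefficients enter only through their
    squared norms. *)
Lemma young_sqr (X a b c : R) : 0 <= a -> 0 <= b -> X ^+ 2 <= c -> c <= 4 * (a * b) ->
  X <= a + b.
Proof.
move=> a0 b0 Xc cab; rewrite (le_trans (ler_norm X))//.
rewrite -(@ler_pXn2r _ 2) ?nnegrE ?addr_ge0// real_normK ?num_real//.
have : 0 <= (a - b) ^+ 2 by exact: sqr_ge0.
by rewrite !expr2 in Xc *; nra.
Qed.

(** The bound (tr F)^2 <= 3 |F|^2 gives 3 a0. The coefficients are bounded by A^2 and B^2, and
    Young's inequality splits A^2 as A^(1/2) A^(3/2) between |F| and |v|, whence A / 2 and A^3 / 2.
    For B the trace brings a factor sqrt 3 on the side of |F|, whence 3 B / 2 and B^3 / 2. *)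
Lemma energy_bound n v al gam F (ap tau a0 A B : R) : 0 < n ->
  tau = n ^- 2 * \sum_j F j j -> `|ap| <= a0 -> 0 <= A -> 0 <= B ->
  \sum_j al j ^+ 2 <= n ^+ 2 * A ^+ 4 ->
  \sum_j gam j ^+ 2 <= n ^+ 2 * B ^+ 4 ->
  n ^+ 3 * ap * tau ^+ 2 + n^-1 * (\sum_j v j * \sum_k F j k * al k)
  - n * tau * (\sum_j v j * gam j) <=
  (3 * a0 + 2^-1 * A + 3 / 2 * B) * (n^-1 * \sum_j \sum_k F j k ^+ 2) +
  (2^-1 * A ^+ 3 + 2^-1 * B ^+ 3) * (n * \sum_j v j ^+ 2).
Proof.
move=> n0 tauE apa A0 B0 alA gamB.
have nn0 : n != 0 by rewrite gt_eqF.
set S := \sum_j \sum_k _; set W := \sum_j v j ^+ 2.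
have W0 : 0 <= W by apply: sumr_ge0 => j _; exact: sqr_ge0.
have S0 : 0 <= S by do 2 (apply: sumr_ge0 => ? _); exact: sqr_ge0.
have in0 : 0 <= n^-1 by rewrite invr_ge0 ltW.
have tr : (\sum_j F j j) ^+ 2 <= 3 * S.
  rewrite /S !sum_ord3 -subr_ge0.
  rewrite (_ : _ - _ = (F 0 0 - F 1 1) ^+ 2 + (F 0 0 - F 2%:R 2%:R) ^+ 2 +
    (F 1 1 - F 2%:R 2%:R) ^+ 2 + 3 * (F 0 1 ^+ 2 + F 1 0 ^+ 2 + F 0 2%:R ^+ 2
    + F 2%:R 0 ^+ 2 + F 1 2%:R ^+ 2 + F 2%:R 1 ^+ 2)); last by ring.
  by rewrite !addr_ge0 ?sqr_ge0// mulr_ge0// !addr_ge0 ?sqr_ge0.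
have t1 : n ^+ 3 * ap * tau ^+ 2 <= 3 * a0 * (n^-1 * S).
  rewrite tauE (_ : n ^+ 3 * ap * _ = n^-1 * (ap * (\sum_j F j j) ^+ 2)); last by field.
  rewrite (_ : 3 * a0 * _ = n^-1 * (a0 * (3 * S))); last by ring.
  apply: ler_wpM2l => //; apply: (@le_trans _ _ (a0 * (\sum_j F j j) ^+ 2)).
    by apply: ler_wpM2r; [exact: sqr_ge0|exact: le_trans (ler_norm _) apa].
  by apply: ler_wpM2l => //; exact: le_trans (normr_ge0 _) apa.
have t2 : n^-1 * (\sum_j v j * \sum_k F j k * al k) <=
    2^-1 * A * (n^-1 * S) + 2^-1 * A ^+ 3 * (n * W).
  apply: (@young_sqr _ _ _ (W * S * A ^+ 4)).
  - by apply: mulr_ge0; apply: mulr_ge0.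
  - by apply: mulr_ge0; apply: mulr_ge0 => //; [exact: exprn_ge0|exact: ltW].
  - have h1 := sum3_CS v (fun j => \sum_k F j k * al k).
    have h2 : \sum_j (\sum_k F j k * al k) ^+ 2 <= S * \sum_k al k ^+ 2.
      rewrite /S mulr_suml; apply: ler_sum => j _; exact: sum3_CS.
    rewrite exprMn exprVn [n ^- 2 * _]mulrC ler_pdivrMr ?exprn_gt0//.
    rewrite (_ : W * S * A ^+ 4 * n ^+ 2 = W * (S * (n ^+ 2 * A ^+ 4))); last by ring.
    apply: (le_trans h1); apply: ler_wpM2l => //.
    by apply: (le_trans h2); exact: ler_wpM2l.
  - rewrite le_eqVlt; apply/orP; left; apply/eqP; by field.
have t3 : - (n * tau * (\sum_j v j * gam j)) <=
    3 / 2 * B * (n^-1 * S) + 2^-1 * B ^+ 3 * (n * W).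
  apply: (@young_sqr _ _ _ (3 * S * W * B ^+ 4)).
  - by apply: mulr_ge0; apply: mulr_ge0 => //; exact: divr_ge0.
  - by apply: mulr_ge0; apply: mulr_ge0 => //; [exact: exprn_ge0|exact: ltW].
  - rewrite sqrrN tauE (_ : n * _ * _ = n^-1 * ((\sum_j F j j) * (\sum_j v j * gam j)));
      last by field.
    rewrite exprMn exprVn [n ^- 2 * _]mulrC ler_pdivrMr ?exprn_gt0// exprMn.
    have h := le_trans (sum3_CS v gam) (ler_wpM2l W0 gamB).
    rewrite (_ : 3 * S * W * B ^+ 4 * n ^+ 2 = 3 * S * (W * (n ^+ 2 * B ^+ 4))); last by ring.
    by apply: ler_pM => //; exact: sqr_ge0.
  - rewrite le_eqVlt; apply/orP; left; apply/eqP; by field.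
rewrite (_ : (3 * a0 + _ + _) * _ + _ = 3 * a0 * (n^-1 * S) +
  (2^-1 * A * (n^-1 * S) + 2^-1 * A ^+ 3 * (n * W)) +
  (3 / 2 * B * (n^-1 * S) + 2^-1 * B ^+ 3 * (n * W))); last by ring.
by apply: lerD => //; exact: lerD.
Qed.

End pointwise_energy.

Section uniqueness.
Context {R : realType}.
Local Notation V := 'rV[R]_3.
Variables (M U : set V) (N ap : V -> R) (h : V -> 'M[R]_3) (v alpha gam : V -> V).
Variables (a0 A B D : R).
Hypothesis cM : compact M.
Hypothesis oU : open U.
Hypothesis MU : M `<=` U.
Hypothesis sN : Cdiff 2 U N.
Hypothesis N_gt0 : forall x, U x -> 0 < N x.
Hypothesis hE : forall x, U x -> h x = N x *: 1%:M.
Hypothesis sv : forall j, Cdiff 2 U (fun x => v x 0 j).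
Hypothesis v0 : forall x, bdry M x -> v x = 0.
Hypothesis sap : Cdiff 1 U ap.
Hypothesis hD : is_diameter M h D.
Hypothesis A_ge0 : 0 <= A.
Hypothesis B_ge0 : 0 <= B.
Hypothesis apB : forall x, M x -> `|ap x| <= a0.
Hypothesis alphaB : forall x, M x -> norm_covector h x (alpha x) <= A ^+ 2.
Hypothesis gamB : forall x, M x -> norm_covector h x (gam x) <= B ^+ 2.
Hypothesis eqn : forall x, M x -> forall j,
  ap x * partial j (div_covector h v) x - div_tensor h (inner_d h v) x 0 j
  - tensor_app h (inner_d h v) alpha x 0 j
  + div_covector h v x * (gam x 0 j + partial j ap x) = 0.
Local Notation O := (interior M).

Let OM (x : V) : O x -> M x. Proof. exact: interior_subset. Qed.
Let OU (x : V) : O x -> U x. Proof. by move=> /OM /MU. Qed.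

Let n (x : V) : R := Num.sqrt (N x).
Let F j k (x : V) : R := sym_grad N v j k x.
Let tau (x : V) : R := (N x)^-1 * \sum_j F j j x.
(** [e] and [p] are the densities of |dv|^2 and |v|^2, norms in h, including the volume factor
    N^(3/2). *)
Let e (x : V) : R := (n x)^-1 * \sum_j \sum_k F j k x ^+ 2.
Let p (x : V) : R := n x * \sum_j v x 0 j ^+ 2.
Let G k (x : V) : R := \sum_j F j k x * v x 0 j.
(** N^(3/2) times the vector field obtained by raising the index of (a' delta v) v - (dv) v: with
    this weight the Riemannian divergence becomes a Euclidean one. *)
Let b k (x : V) : R := n x * (ap x * tau x) * v x 0 k - (n x)^-1 * G k x.

Let n_gt0 x : U x -> 0 < n x.
Proof. by move=> Ux; rewrite sqrtr_gt0 N_gt0. Qed.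

Let n_neq0 x : U x -> n x != 0.
Proof. by move=> Ux; rewrite gt_eqF// n_gt0. Qed.

Let nE x : U x -> n x ^+ 2 = N x.
Proof. by move=> Ux; rewrite sqr_sqrtr// ltW// N_gt0. Qed.

Let sn : Cdiff 1 U n.
Proof. exact: (Cdiff1_sqrt oU N_gt0 (CdiffW sN)). Qed.

Let snV : Cdiff 1 U (fun x => (n x)^-1).
Proof. exact: CdiffV oU n_neq0 sn. Qed.

Let sF j k : Cdiff 1 U (F j k).
Proof. exact: Cdiff_sym_grad. Qed.

Let sv1 j : Cdiff 1 U (fun x => v x 0 j).
Proof. exact: (CdiffW (sv j)). Qed.

Let stau : Cdiff 1 U tau.
Proof.
apply: (CdiffM oU); last by apply: Cdiff_sum => // j; exact: sF.
by apply: (CdiffV oU) => [x Ux|]; [rewrite gt_eqF// N_gt0|exact: CdiffW].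
Qed.

Let sG k : Cdiff 1 U (G k).
Proof. by apply: (Cdiff_sum oU) => j; exact: (CdiffM oU (sF j k) (sv1 j)). Qed.

Let sphi : Cdiff 1 U (fun x => ap x * tau x).
Proof. exact: (CdiffM oU sap stau). Qed.

Let sb k : Cdiff 1 U (b k).
Proof.
exact: (CdiffB oU (CdiffM oU (CdiffM oU sn sphi) (sv1 k)) (CdiffM oU snV (sG k))).
Qed.

Let partial_sum3 k (f : 'I_3 -> V -> R) x : (forall j, differentiable (f j) x) ->
  partial k (fun y => \sum_j f j y) x = \sum_j partial k (f j) x.
Proof.
move=> df; rewrite sum_ord3.
rewrite (_ : (fun y => _) = fun y => f 0 y + f 1 y + f 2%:R y); last first.
  by apply/funext => y; rewrite sum_ord3.
by rewrite partialD ?partialD//; exact: differentiableD.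
Qed.

Let partial_b k x : U x -> partial k (b k) x =
  (2 * n x)^-1 * partial k N x * (ap x * tau x) * v x 0 k
  + n x * partial k (fun y => ap y * tau y) x * v x 0 k
  + n x * (ap x * tau x) * partial k (fun y => v y 0 k) x
  + n x ^- 2 * ((2 * n x)^-1 * partial k N x) * (\sum_j F j k x * v x 0 j)
  - (n x)^-1 * (\sum_j (partial k (F j k) x * v x 0 j
      + F j k x * partial k (fun y => v y 0 j) x)).
Proof.
move=> Ux.
have d f : Cdiff 1 U f -> differentiable f x by move=> sf; exact: (Cdiff_differentiable sf Ux).
have snphi := CdiffM oU sn sphi.
rewrite /b (partialD _ (d _ (CdiffM oU snphi (sv1 k))) (d _ (CdiffN oU (CdiffM oU snV (sG k))))).
rewrite partialN; last exact: (d _ (CdiffM oU snV (sG k))).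
rewrite (partialM _ (d _ snphi) (d _ (sv1 k))) (partialM _ (d _ sn) (d _ sphi)).
rewrite (partialM _ (d _ snV) (d _ (sG k))) partialV//; [|exact: n_neq0|exact: (d _ sn)].
rewrite (partial_sqrt N_gt0 _ Ux); last exact: (Cdiff_differentiable sN Ux).
rewrite /G partial_sum3; last by move=> j; exact: (d _ (CdiffM oU (sF j k) (sv1 j))).
have -> : \sum_j partial k (fun y => F j k y * v y 0 j) x =
    \sum_j (partial k (F j k) x * v x 0 j + F j k x * partial k (fun y => v y 0 j) x).
  apply: eq_bigr => j _; rewrite (partialM _ (d _ (sF j k)) (d _ (sv1 j))).
  by rewrite addrC [v x 0 j * _]mulrC.
by rewrite -/(n x); ring.
Qed.

Let norm_bound x (w : V) K : U x -> norm_covector h x w <= K ^+ 2 ->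
  \sum_j w 0 j ^+ 2 <= n x ^+ 2 * K ^+ 4.
Proof.
move=> Ux; rewrite (norm_covector_conformal hE)// => H.
have S0 : 0 <= (N x)^-1 * \sum_j w 0 j ^+ 2.
  rewrite mulr_ge0 ?invr_ge0 ?(ltW (N_gt0 Ux))//.
  by apply: sumr_ge0 => j _; exact: sqr_ge0.
rewrite nE// -ler_pdivrMl ?N_gt0// -(sqr_sqrtr S0) (_ : K ^+ 4 = (K ^+ 2) ^+ 2); last by ring.
by rewrite lerXn2r ?nnegrE ?sqrtr_ge0 ?sqr_ge0.
Qed.

Let pointwise x : O x -> e x + \sum_k partial k (b k) x <=
  (3 * a0 + 2^-1 * A + 3 / 2 * B) * e x + (2^-1 * A ^+ 3 + 2^-1 * B ^+ 3) * p x.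
Proof.
move=> Ox; have Ux := OU Ox; have Mx := OM Ox.
have dtau y : U y -> differentiable tau y.
  by move=> Uy; exact: (Cdiff_differentiable stau Uy).
have tauE y : U y -> div_covector h v y = tau y.
  by move=> Uy; rewrite (div_covector_conformal v oU sN N_gt0 hE).
have id := @energy_identity R (n x) (fun j => v x 0 j) (fun j => partial j N x)
  (fun j => partial j (fun y => ap y * tau y) x) (fun j => alpha x 0 j)
  (fun j => gam x 0 j) (fun j k => partial j (fun y => v y 0 k) x)
  (fun j k => F j k x) (fun j k => partial k (F j k) x) (ap x) (tau x) (n_neq0 Ux).
rewrite addrC (eq_bigr _ (fun k _ => partial_b k Ux)) id.
- apply: energy_bound => //; first exact: n_gt0.
  + by rewrite nE.
  + exact: apB.
  + by apply: norm_bound => //; exact: alphaB.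
  + by apply: norm_bound => //; exact: gamB.
- by move=> j k; rewrite nE.
- by rewrite nE.
- move=> j; have := eqn Mx j.
  (* The terms a' d(delta v) and (delta v) grad a' of the equation add up to d(a' delta v), the
     field that [energy_identity] expects. *)
  rewrite (partial_eq _ oU tauE Ux) tauE//.
  rewrite (div_tensor_conformal v oU sN N_gt0 hE)// (tensor_app_conformal v oU sN N_gt0 hE)//.
  rewrite (partialM _ (Cdiff_differentiable sap Ux) (dtau _ Ux)) nE// -/(F _ _).
  move/eqP; rewrite -subr_eq0 => /eqP H.
  apply/eqP; rewrite -subr_eq0; apply/eqP; rewrite -[RHS]H /F.
  by ring.
Qed.

Let ce : continuous_each M e.
Proof.
move=> x Mx; apply: (Cdiff_continuous _ (MU Mx)); apply: (CdiffM oU snV).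
apply: (Cdiff_sum oU) => j; apply: (Cdiff_sum oU) => k.
by apply: Cdiff_eq (CdiffM oU (sF j k) (sF j k)) => // y _; rewrite expr2.
Qed.

Let cp : continuous_each M p.
Proof.
move=> x Mx; apply: (Cdiff_continuous _ (MU Mx)); apply: (CdiffM oU sn).
apply: (Cdiff_sum oU) => j.
by apply: Cdiff_eq (CdiffM oU (sv1 j) (sv1 j)) => // y _; rewrite expr2.
Qed.

Let cdb k : continuous_each M (partial k (b k)).
Proof. by move=> x Mx; exact: (Cdiff_continuous (Cdiff_partial k (sb k)) (MU Mx)). Qed.

Let cD f g : continuous_each M f -> continuous_each M g ->
  continuous_each M (fun x => f x + g x).
Proof. by move=> cf cg x Mx; apply: (@continuousD _ _ _ f g x); [exact: cf|exact: cg]. Qed.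

Let cZ (c : R) f : continuous_each M f -> continuous_each M (fun x => c * f x).
Proof. by move=> cf x Mx; apply: continuousM; [exact: cst_continuous|exact: cf]. Qed.

Let flux k : oint M (partial k (b k)) = 0.
Proof.
have b0 x : bdry M x -> b k x = 0.
  move=> bx; rewrite /b /G v0// mxE mulr0 big1 ?mulr0 ?subr0// => j _.
  by rewrite mxE mulr0.
exact: (oint_partial k cM MU (sb k) b0).
Qed.

Lemma energy_inequality : oint M e <=
  (3 * a0 + 2^-1 * A + 3 / 2 * B) * oint M e +
  (2^-1 * A ^+ 3 + 2^-1 * B ^+ 3) * oint M p.
Proof.
pose db x := partial 0 (b 0) x + partial 1 (b 1) x + partial 2%:R (b 2%:R) x.
have cdb3 : continuous_each M db.
  exact: (cD (cD (@cdb 0) (@cdb 1)) (@cdb 2%:R)).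
have := oint_le cM (cD ce cdb3)
  (cD (@cZ (3 * a0 + 2^-1 * A + 3 / 2 * B) _ ce) (@cZ (2^-1 * A ^+ 3 + 2^-1 * B ^+ 3) _ cp)).
have H x : O x -> e x + db x <= (3 * a0 + 2^-1 * A + 3 / 2 * B) * e x +
    (2^-1 * A ^+ 3 + 2^-1 * B ^+ 3) * p x.
  by move=> /pointwise; rewrite sum_ord3.
move=> /(_ H).
rewrite (ointD cM ce cdb3) (ointD cM (@cZ _ _ ce) (@cZ _ _ cp)) (ointZ cM _ ce) (ointZ cM _ cp).
rewrite (ointD cM (cD (@cdb 0) (@cdb 1)) (@cdb 2%:R)) (ointD cM (@cdb 0) (@cdb 1)).
by rewrite !flux !addr0.
Qed.

Lemma vanishing : 3 * a0 + 2^-1 * A + 3 / 2 * B + 4^-1 * (A ^+ 3 + B ^+ 3) * D ^+ 2 < 1 ->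
  forall x, O x -> v x = 0.
Proof.
move=> small.
have w0 j x : bdry M x -> v x 0 j / N x = 0.
  by move=> bx; rewrite v0// mxE mul0r.
have sNV : Cdiff 1 U (fun x => (N x)^-1).
  by apply: (CdiffV oU) => [x Ux|]; [rewrite gt_eqF// N_gt0|exact: CdiffW].
have := poincare cM oU MU sN N_gt0 (fun j => CdiffM oU (sv1 j) sNV) w0 hE hD.
rewrite [leLHS](@oint_eq _ _ _ p); last first.
  move=> x /OU Ux; rewrite /p /n mulr_sumr; congr (_ * _); apply: eq_bigr => j _.
  by have := N_gt0 Ux => Nx; field; rewrite gt_eqF.
rewrite [X in _ <= _ * X](@oint_eq _ _ _ e); last first.
  move=> x /OU Ux; rewrite /e.
  have -> : \sum_j \sum_k F j k x ^+ 2 = N x ^+ 2 *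
      \sum_j \sum_k strain N (fun i y => v y 0 i / N y) j k x ^+ 2.
    rewrite mulr_sumr; apply: eq_bigr => j _; rewrite mulr_sumr; apply: eq_bigr => k _.
    by rewrite /F -(strain_sym_grad sN N_gt0 sv)// exprMn.
  rewrite -/(n x) -nE//; set S := \sum_j _.
  by have nx := n_neq0 Ux; field.
move=> PE; have EP := energy_inequality.
have K0 : 0 <= 2^-1 * A ^+ 3 + 2^-1 * B ^+ 3.
  by rewrite addr_ge0// mulr_ge0// exprn_ge0.
have e0 x : O x -> 0 <= e x.
  move=> /OU Ux; rewrite mulr_ge0 ?invr_ge0 ?sqrtr_ge0//.
  by do 2 (apply: sumr_ge0 => ? _); exact: sqr_ge0.
have p0 x : O x -> 0 <= p x.
  move=> /OU Ux; rewrite mulr_ge0 ?sqrtr_ge0//.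
  by apply: sumr_ge0 => ? _; exact: sqr_ge0.
have E0 : 0 <= oint M e by exact: oint_ge0.
have P0 : 0 <= oint M p by exact: oint_ge0.
have Ez : oint M e = 0.
  apply/eqP; rewrite eq_le E0 andbT leNgt; apply/negP => Ep.
  have h1 : oint M e <= (3 * a0 + 2^-1 * A + 3 / 2 * B +
      4^-1 * (A ^+ 3 + B ^+ 3) * D ^+ 2) * oint M e.
    rewrite (le_trans EP)// [leRHS]mulrDl lerD2l.
    rewrite (_ : 4^-1 * _ * _ * _ = (2^-1 * A ^+ 3 + 2^-1 * B ^+ 3) *
      (D ^+ 2 / 2 * oint M e)); last by field.
    exact: ler_wpM2l.
  have := le_lt_trans h1 (_ : _ < 1 * oint M e).
  by rewrite ltr_pM2r// mul1r ltxx => /(_ small).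
have Pz : oint M p = 0.
  by apply/eqP; rewrite eq_le P0 andbT (le_trans PE)// Ez mulr0.
move=> x Ox; have := oint_eq0 cM cp p0 Pz Ox.
have Ux := OU Ox.
move=> /eqP; rewrite mulf_eq0 (negbTE (n_neq0 Ux))/= psumr_eq0 => [|j _]; last exact: sqr_ge0.
move=> /allP H; apply/rowP => j; rewrite mxE; apply/eqP.
by have := H j (mem_index_enum j); rewrite sqrf_eq0.
Qed.

End uniqueness.

(** * Common neighbourhoods of smoothness *)

Section smooth_neighbourhoods.
Context {R : realType} {n : nat}.
Local Notation V := 'rV[R]_n.
Implicit Types (U M : set V) (f : V -> R).

Lemma open_gt0 U f : open U -> Cdiff 0 U f -> open [set x | U x /\ 0 < f x].
Proof.
move=> oU sf; rewrite openE => x [Ux fx].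
near=> y; split; near: y; first exact: open_nbhs_nbhs.
by apply: (cvgr_gt (f x)) => //; exact: (Cdiff_continuous sf Ux).
Unshelve. all: by end_near. Qed.

Lemma open_neq0 U f : open U -> Cdiff 0 U f -> open [set x | U x /\ f x != 0].
Proof.
move=> oU sf; rewrite (_ : [set x | _] = [set x | U x /\ 0 < f x * f x]).
  by apply: open_gt0 => //; exact: CdiffM.
by apply/seteqP; split => x /= [Ux fx]; split => //; move: fx;
  rewrite -expr2 exprn_even_gt0.
Qed.

Lemma smooth_common M (I : finType) (f : I -> V -> R) :
  (forall i, smooth_on M (f i)) ->
  exists U, [/\ open U, M `<=` U & forall i k, Cdiff k U (f i)].
Proof.
move=> sf; have {}sf i := smooth_Cdiff (sf i).
have [U HU] := choice sf.
exists [set x | forall i, U i x]; split.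
- rewrite openE => x Ux.
  apply: (@filter_forall _ _ (fun i y => U i y) _ (nbhs_filter x)) => i.
  by apply: open_nbhs_nbhs; split; [have [] := HU i|exact: Ux].
- by move=> x Mx i; have [_ + _] := HU i; exact.
- by move=> i k; have [_ _] := HU i => /(_ k); apply: CdiffS => x; exact.
Qed.

Lemma le_sup_compact M f x : compact M ->
  (forall x, M x -> {for x, continuous f}) -> M x -> f x <= sup [set f x | x in M].
Proof.
move=> cM cf Mx; apply: ub_le_sup; last by exists x.
have [B HB] := compact_upper_bound cM cf.
by exists B => _ [y My <-]; exact: HB.
Qed.

End smooth_neighbourhoods.

Theorem theorem3p3 (R : realType) (M : set 'rV[R]_3)
    (lambda mu rho nu1 nu2 nu3 nu4 : 'rV[R]_3 -> R) (D : R)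
    (hM : closed_bounded_domain M) (hbM : smooth_boundary M)
    (hlambda : smooth_on M lambda) (hmu : smooth_on M mu)
    (hrho : smooth_on M rho)
    (hnu1 : smooth_on M nu1) (hnu2 : smooth_on M nu2)
    (hnu3 : smooth_on M nu3) (hnu4 : smooth_on M nu4)
    (rho_gt0 : forall x, M x -> 0 < rho x)
    (lame_gt0 : forall x, M x -> 0 < lambda x + 2 * mu x)
    (nu_neq0 : forall x, M x ->
       3 * (nu1 x + nu2 x) + 2 * (1 + nu3 x + nu4 x) != 0)
    (nu34_neq0 : forall x, M x -> 1 + nu3 x + nu4 x != 0) :
  let vp := fun x => Num.sqrt ((lambda x + 2 * mu x) / rho x) in
  let h := fun x => (vp x ^- 2) *: (1%:M : 'M[R]_3) in
  let a := fun x => (nu1 x + nu2 x) / (2 * (1 + nu3 x + nu4 x)) in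
  let b := fun x => rho x * vp x ^+ 4 / (1 + nu3 x + nu4 x) in
  let c := fun x => vp x ^+ 2 in
  let alpha := fun x => (b x)^-1 *: grad b x + (2^-1 * (c x)^-1) *: grad c x in
  let beta := fun x => - ((2^-1 * (c x)^-1) *: grad c x) in
  let a' := fun x => a x / (1 + 3 * a x) in
  let a0 := sup [set `|a' x| | x in M] in
  let alpha0 := Num.sqrt (sup [set norm_covector h x (alpha x) | x in M]) in
  let beta0 := Num.sqrt (sup [set norm_covector h x
                 ((1 + 3 * a x)^-1 *: (a x *: alpha x - beta x)) | x in M]) in
  CNTM M h ->
  is_diameter M h D ->
  3 * a0 + 2^-1 * alpha0 + 3 / 2 * beta0
    + 4^-1 * (alpha0 ^+ 3 + beta0 ^+ 3) * D ^+ 2 < 1 ->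
  forall v : 'rV[R]_3 -> 'rV[R]_3,
    smooth_covector_on M v ->
    (forall x, M x ->
       (a' x *: grad (div_covector h v) x - div_tensor h (inner_d h v) x)
       - tensor_app h (inner_d h v) alpha x
       + ((1 + 3 * a x)^-1 * div_covector h v x) *:
           (a x *: alpha x - beta x + (1 + 3 * a x) *: grad a' x) = 0) ->
    (forall x, bdry M x -> v x = 0) ->
    forall x, M x -> v x = 0.
Proof.
move=> vp h a b c alpha beta a' a0 alpha0 beta0 [cM _ _] hD small v sv eqv v0.
pose coeff (i : 'I_7) := nth lambda [:: lambda; mu; rho; nu1; nu2; nu3; nu4] i.
have scoeff i : smooth_on M (coeff i).
  by case: i => [[|[|[|[|[|[|[|//]]]]]]] ?].
have [U1 [oU1 MU1 sc]] := smooth_common scoeff.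
have [U2 [oU2 MU2 sv2]] := smooth_common sv.
pose U0 := U1 `&` U2.
have oU0 : open U0 by exact: openI.
have U01 : U0 `<=` U1 by move=> x [].
have sl k : Cdiff k U0 lambda := CdiffS U01 (sc (@Ordinal 7 0 isT) k).
have sm k : Cdiff k U0 mu := CdiffS U01 (sc (@Ordinal 7 1 isT) k).
have sr k : Cdiff k U0 rho := CdiffS U01 (sc (@Ordinal 7 2 isT) k).
have s1 k : Cdiff k U0 nu1 := CdiffS U01 (sc (@Ordinal 7 3 isT) k).
have s2 k : Cdiff k U0 nu2 := CdiffS U01 (sc (@Ordinal 7 4 isT) k).
have s3 k : Cdiff k U0 nu3 := CdiffS U01 (sc (@Ordinal 7 5 isT) k).
have s4 k : Cdiff k U0 nu4 := CdiffS U01 (sc (@Ordinal 7 6 isT) k).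
have cst k (r : R) : Cdiff k U0 (fun=> r) by exact: Cdiff_cst.
have slame k : Cdiff k U0 (fun x => lambda x + 2 * mu x).
  exact: (CdiffD oU0 (sl k) (CdiffM oU0 (cst k 2) (sm k))).
have s34 k : Cdiff k U0 (fun x => 1 + nu3 x + nu4 x).
  exact: (CdiffD oU0 (CdiffD oU0 (cst k 1) (s3 k)) (s4 k)).
have s12 k : Cdiff k U0 (fun x => nu1 x + nu2 x) := CdiffD oU0 (s1 k) (s2 k).
have sden k : Cdiff k U0 (fun x => 3 * (nu1 x + nu2 x) + 2 * (1 + nu3 x + nu4 x)).
  exact: (CdiffD oU0 (CdiffM oU0 (cst k 3) (s12 k)) (CdiffM oU0 (cst k 2) (s34 k))).
(* Derivatives at boundary points of M involve values around them, so the sign and nonvanishing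
   conditions are extended to an open neighbourhood on which all quotients are smooth. *)
pose U := ([set x | U0 x /\ 0 < rho x] `&` [set x | U0 x /\ 0 < lambda x + 2 * mu x])
  `&` ([set x | U0 x /\ 3 * (nu1 x + nu2 x) + 2 * (1 + nu3 x + nu4 x) != 0]
  `&` [set x | U0 x /\ 1 + nu3 x + nu4 x != 0]).
have oU : open U.
  by apply: openI; apply: openI;
    [exact: (open_gt0 oU0 (sr 0))|exact: (open_gt0 oU0 (slame 0))
    |exact: (open_neq0 oU0 (sden 0))|exact: (open_neq0 oU0 (s34 0))].
have MU : M `<=` U.
  move=> x Mx; have U0x : U0 x by split; [exact: MU1|exact: MU2].
  by split; split; split => //; [exact: rho_gt0|exact: lame_gt0|exact: nu_neq0
    |exact: nu34_neq0].
have UU0 : U `<=` U0 by move=> x [[[]]].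
have rhoU x : U x -> 0 < rho x by move=> [[[]]].
have lameU x : U x -> 0 < lambda x + 2 * mu x by move=> [[_ []]].
have denU x : U x -> 3 * (nu1 x + nu2 x) + 2 * (1 + nu3 x + nu4 x) != 0.
  by move=> [_ [[]]].
have nuU x : U x -> 1 + nu3 x + nu4 x != 0 by move=> [_ [_ []]].
have toU k f : Cdiff k U0 f -> Cdiff k U f by exact: CdiffS.
(* v_p^-2 without the square root, so that smoothness follows from that of quotients. *)
pose N x := rho x / (lambda x + 2 * mu x).
have N_gt0 x : U x -> 0 < N x.
  by move=> Ux; rewrite divr_gt0 ?rhoU ?lameU.
have sN k : Cdiff k U N.
  apply: (CdiffM oU (toU _ _ (sr k))); apply: (CdiffV oU _ (toU _ _ (slame k))).
  by move=> x Ux; rewrite gt_eqF// lameU.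
have sNV k : Cdiff k U (fun x => (N x)^-1).
  by apply: (CdiffV oU _ (sN k)) => x Ux; rewrite gt_eqF// N_gt0.
have cE x : U x -> c x = (N x)^-1.
  move=> Ux; rewrite /c /vp sqr_sqrtr ?divr_ge0 ?(ltW (lameU _ Ux)) ?(ltW (rhoU _ Ux))//.
  by rewrite /N invf_div.
have hE x : U x -> h x = N x *: 1%:M.
  by move=> Ux; rewrite /h -[vp x ^+ 2]/(c x) cE// invrK.
have sv' k j : Cdiff k U (fun x => v x 0 j).
  by apply: CdiffS (sv2 j k) => x /UU0 [].
have sc' k : Cdiff k U c.
  by apply: (Cdiff_eq oU _ (sNV k)) => x /cE.
have cU x : U x -> c x != 0 by move=> Ux; rewrite cE// invr_eq0 gt_eqF// N_gt0.
have sb k : Cdiff k U b.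
  have s34V : Cdiff k U (fun x => (1 + nu3 x + nu4 x)^-1).
    exact: (CdiffV oU nuU (toU _ _ (s34 k))).
  apply: (Cdiff_eq oU _ (CdiffM oU (CdiffM oU (toU _ _ (sr k)) (CdiffM oU (sc' k) (sc' k))) s34V)).
  by move=> x Ux; rewrite /b /c; congr (_ * _ / _); ring.
have bU x : U x -> b x != 0.
  move=> Ux; rewrite /b (_ : vp x ^+ 4 = c x ^+ 2); last by rewrite /c; ring.
  apply: mulf_neq0; last by rewrite invr_eq0 nuU.
  by apply: mulf_neq0; [rewrite gt_eqF// rhoU|rewrite expf_neq0// cU].
have sa k : Cdiff k U a.
  apply: (CdiffM oU (toU _ _ (s12 k))).
  apply: (CdiffV oU _ (toU _ _ (CdiffM oU0 (cst k 2) (s34 k)))) => x Ux.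
  by rewrite mulf_neq0// nuU.
have a3U x : U x -> 1 + 3 * a x != 0.
  move=> Ux; have nx := nuU _ Ux; rewrite /a.
  rewrite (_ : 1 + _ = (3 * (nu1 x + nu2 x) + 2 * (1 + nu3 x + nu4 x)) /
    (2 * (1 + nu3 x + nu4 x))); last by field.
  by apply: mulf_neq0; [exact: denU|rewrite invr_eq0 mulf_neq0].
have sa3 k : Cdiff k U (fun x => (1 + 3 * a x)^-1).
  apply: (CdiffV oU a3U).
  exact: (CdiffD oU (toU _ _ (cst k 1)) (CdiffM oU (toU _ _ (cst k 3)) (sa k))).
have sa' k : Cdiff k U a' := CdiffM oU (sa k) (sa3 k).
have sgc j : Cdiff 0 U (fun x => 2^-1 * (c x)^-1 * partial j c x).
  apply: (CdiffM oU); last exact: Cdiff_partial.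
  exact: (CdiffM oU (toU _ _ (cst 0 2^-1)) (CdiffV oU cU (sc' 0))).
have salpha j : Cdiff 0 U (fun x => alpha x 0 j).
  apply: (Cdiff_eq oU _ (CdiffD oU (CdiffM oU (CdiffV oU bU (sb 0))
    (Cdiff_partial j (sb 1))) (sgc j))).
  by move=> x _; rewrite !mxE.
pose gam x := (1 + 3 * a x)^-1 *: (a x *: alpha x - beta x).
have sgam j : Cdiff 0 U (fun x => gam x 0 j).
  apply: (Cdiff_eq oU _ (CdiffM oU (sa3 0) (CdiffD oU (CdiffM oU (sa 0) (salpha j)) (sgc j)))).
  by move=> x _; rewrite /gam /beta !mxE opprK.
(* The square of [alpha0] or [beta0] is the supremum itself, once this is a true upper bound, by
   continuity on compact M, and nonnegative, by its value at x. *)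
have supB (w : 'rV[R]_3 -> 'rV[R]_3) : (forall j, Cdiff 0 U (fun x => w x 0 j)) ->
    forall x, M x -> norm_covector h x (w x) <=
      Num.sqrt (sup [set norm_covector h x (w x) | x in M]) ^+ 2.
  move=> sw x Mx.
  have cw y : M y -> {for y, continuous (fun x => norm_covector h x (w x))}.
    move=> My; have Uy := MU _ My.
    have sS : Cdiff 0 U (fun x => (N x)^-1 * \sum_j w x 0 j ^+ 2).
      apply: (CdiffM oU (sNV 0)); apply: (Cdiff_sum oU) => j.
      by apply: (Cdiff_eq oU _ (CdiffM oU (sw j) (sw j))) => z _; rewrite expr2.
    have cS := @continuous_comp _ _ _ (fun x => (N x)^-1 * \sum_j w x 0 j ^+ 2)
      (@Num.sqrt R) y (Cdiff_continuous sS Uy) (@sqrt_continuous _ _).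
    have E : \near y, Num.sqrt ((N y)^-1 * \sum_j w y 0 j ^+ 2) = norm_covector h y (w y).
      by apply: (open_near_eq oU) => // z Uz; rewrite (norm_covector_conformal hE).
    have := cvg_trans (near_eq_cvg E) cS.
    rewrite /= (nbhs_singleton E). exact.
  have le := le_sup_compact cM cw Mx.
  by rewrite sqr_sqrtr// (le_trans _ le)// sqrtr_ge0.
have a0B x : M x -> `|a' x| <= a0.
  move=> Mx; apply: (@le_sup_compact _ _ M (fun x => `|a' x|)) => // y My.
  apply: continuous_comp; last exact: norm_continuous.
  exact: (Cdiff_continuous (sa' 0) (MU _ My)).
(* Componentwise form after cancelling 1 + 3 a in front of grad a'; [gam] is the field whose norm
   defines [beta0]. *)
have eqj x : M x -> forall j,
    a' x * partial j (div_covector h v) x - div_tensor h (inner_d h v) x 0 j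
    - tensor_app h (inner_d h v) alpha x 0 j
    + div_covector h v x * (gam x 0 j + partial j a' x) = 0.
  move=> Mx j; have a3x := a3U _ (MU _ Mx).
  have := congr1 (fun w : 'rV[R]_3 => w 0 j) (eqv x Mx).
  rewrite /gam; move: (alpha x) (beta x) => al be.
  move: (div_tensor h _ x) (tensor_app h _ alpha x) => T S.
  rewrite !mxE; move: (a x) a3x => r r3 <-.
  by field.
have vO : forall x, interior M x -> v x = 0.
  exact: (@vanishing R M U N a' h v alpha gam a0 alpha0 beta0 D cM oU MU (sN 2)
    N_gt0 hE (sv' 2) v0 (sa' 1) hD (sqrtr_ge0 _) (sqrtr_ge0 _) a0B
    (supB _ salpha) (supB _ sgam) eqj small).
move=> x Mx; have [/vO //|nOx] := pselect (interior M x).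
by apply: v0; split => //; exact: subset_closure.
Qed.
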